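(* (Simultaneous identification of $f$ and $b$ with $\gamma$ known.) Let $b$ satisfy (B), $f$ satisfy (F), $\gamma>0$, and let $\phi$ be a solution of the Cahn-Hilliard system with parameters $(\gamma,b,f)$. Fix $t\in(0,T)$ with $\phi=\phi(\cdot,t)\in H^3(\Omega)$ and $\partial_t\phi=\partial_t\phi(\cdot,t)\in H^{-1}(\Omega)$. For each $\delta>0$ let data $\phi^\delta=\phi^\delta(\cdot,t)\in H^3(\Omega)$, $\partial_t\phi^\delta=\partial_t\phi^\delta(\cdot,t)\in H^{-1}(\Omega)$ be given with $\phi^\delta(x,t)\in(-1,1)$ for all $x\in\Omega$ and $$\|\phi-\phi^\delta\|_{H^3(\Omega)}\le\delta,\qquad \|\partial_t\phi-\partial_t\phi^\delta\|_{H^{-1}(\Omega)}\le\delta .$$ Set $y=\partial_t\phi$, $y^\delta=\partial_t\phi^\delta$, and define $T,T^\delta:H^2(-1,1)^2\to H^{-1}(\Omega)$ by $$T^\delta(\beta,c)=-\gamma\operatorname{div}\big(\beta(\phi^\delta)\nabla\Delta\phi^\delta\big)+\operatorname{div}\big(c(\phi^\delta)\nabla\phi^\delta\big),\qquad T(\beta,c)=-\gamma\operatorname{div}\big(\beta(\phi)\nabla\Delta\phi\big)+\operatorname{div}\big(c(\phi)\nabla\phi\big).$$ For $\alpha>0$ let $(b_\alpha^\delta,c_\alpha^\delta)$ be the minimizer over $(\beta,c)\in H^2(-1,1)^2$ of $$\|T^\delta(\beta,c)-y^\delta\|_{H^{-1}(\Omega)}^2+\alpha\|(\beta,c)\|_{H^2(-1,1)^2}^2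 .$$ If $\alpha=\alpha(\delta)$ is chosen such that $\alpha\to0$ and $\delta^2/\alpha\to0$ as $\delta\to0$, then $(b_\alpha^\delta,c_\alpha^\delta)$ converges in $H^2(-1,1)^2$, as $\delta\to0$, to the minimum-norm solution of $T(\beta,c)=y$.
   Context: $\Omega$ is the $d$-dimensional torus $\mathbb{T}^d$, $d\in\{1,2,3\}$; all functions on $\Omega$ are periodic, and $H^{-1}(\Omega)$ is the dual of $H^1(\Omega)$. Divergences are understood in the weak sense: $\langle\operatorname{div}(g),v\rangle=-\int_\Omega g\cdot\nabla v\,dx$ for $v\in H^1(\Omega)$. (B): $b:\mathbb{R}\to\mathbb{R}_+$, $b\in C^2(\mathbb{R})$, and there are constants $\beta_1,\beta_2,\beta_3,\beta_4$ with $0<\beta_1\le b(s)\le\beta_2$ for all $s$, $\|b'\|_\infty\le\beta_3$, $\|b''\|_\infty\le\beta_4$. (F): $f=F'$ with $F\in C^4(\mathbb{R})$ such that $F(s)\ge-\kappa$ and $F''(s)\ge-\kappa$ for all $s$ and some $\kappa\ge0$, and $|F^{(k)}(s)|\le p_k+q_k|s|^{4-k}$ for $0\le k\le4$ and all $s$, with constants $p_k,q_k\ge0$. The Cahn-Hilliard system with parameters $(\gamma,b,f)$ is $\partial_t\phi=\operatorname{div}(b(\phi)\nabla\mu)$, $\mu=-\gamma\Delta\phi+f(\phi)$ on $\Omega\times(0,T)$ with periodic boundary conditions. At the fixed time $t$ it holds in $H^{-1}(\Omega)$, so that the pair $(b,bf')$ (restricted to $(-1,1)$) satisfies $T(b,bf')=y$.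 $H^2(-1,1)^2$ carries the product Hilbert norm $\|(\beta,c)\|^2=\|\beta\|_{H^2(-1,1)}^2+\|c\|_{H^2(-1,1)}^2$, and the minimum-norm solution is the solution of $T(\beta,c)=y$ of smallest norm. Elements of $H^2(-1,1)$ are identified with their continuous representatives on $[-1,1]$. *)

(* Defs.v *)
From HB Require Import structures.
From mathcomp Require Import all_boot all_order all_algebra.
From mathcomp Require Import all_classical all_reals all_analysis.

Set Implicit Arguments.
Unset Strict Implicit.
Unset Printing Implicit Defensive.
Import Order.TTheory GRing.Theory Num.Theory.
Import numFieldNormedType.Exports.
Local Open Scope classical_set_scope.
Local Open Scope ring_scope.

(** [wd i u g] is the integration-by-parts identity "g is an i-th weak partial
    derivative of u".  Weak derivatives are unique up to null sets, so that
    picking one of them is harmless: functions stand for their classes in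
    L^2(mu), and only integrals of the derivatives are ever used. *)
Section Sobolev.
Context {disp : measure_display} {T : measurableType disp} {R : realType}.
Variables (mu : {measure set T -> \bar R}) (I : finType).
Variable wd : I -> (T -> R) -> (T -> R) -> Prop.

Definition has_wpartial (i : I) (u g : T -> R) : Prop :=
  g \in Lfun mu 2%:E /\ wd i u g.

Definition wpartial (i : I) (u : T -> R) : T -> R :=
  xget (cst 0) [set g | has_wpartial i u g].

Fixpoint sobolev (k : nat) (u : T -> R) : Prop :=
  u \in Lfun mu 2%:E /\
  if k is k'.+1 then
    forall i, (exists g, has_wpartial i u g) /\ sobolev k' (wpartial i u)
  else True.

(* unfolds to \sum_(j <= k) || nabla^j u ||_{L^2}^2, where nabla^j u is the
   tensor of all j-fold partial derivatives with its Euclidean norm *)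
Fixpoint sobolev_sqnorm (k : nat) (u : T -> R) : R :=
  \int[mu]_x (u x ^+ 2) +
  if k is k'.+1 then \sum_(i : I) sobolev_sqnorm k' (wpartial i u) else 0.

Definition sobolev_norm (k : nat) (u : T -> R) : R :=
  Num.sqrt (sobolev_sqnorm k u).

End Sobolev.

(** T^d = R^d / Z^d.  Functions on the torus are functions on R^d; continuous
    ones are required to be Z^d-periodic, while those standing for an L^2 class
    only matter through their values on the cell [0,1]^d. *)

(* the sigma-algebra on R^d generated by the coordinates, i.e. the Borel sets *)
Definition row_display : measure_display. Proof. exact: default_measure_display. Qed.

Section BorelRow.
Variables (R : realType) (d : nat).

Let coors (i : 'I_d) (x : 'rV[R]_d) : R := x ord0 i.

Let row_set0 : g_sigma_preimage coors set0.
Proof. exact: sigma_algebra0. Qed.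

Let row_setC A : g_sigma_preimage coors A -> g_sigma_preimage coors (~` A).
Proof. exact: sigma_algebraC. Qed.

Let row_bigcup (F : _^nat) : (forall i, g_sigma_preimage coors (F i)) ->
  g_sigma_preimage coors (\bigcup_i (F i)).
Proof. exact: sigma_algebra_bigcup. Qed.

HB.instance Definition _ := @isMeasurable.Build row_display
  'rV[R]_d (g_sigma_preimage coors) row_set0 row_setC row_bigcup.

End BorelRow.

Section TorusMeasure.
Variable R : realType.

Definition cons_tuple (d : nat) (p : measurableTypeR R * d.-tuple R) :
    d.+1.-tuple R :=
  [the d.+1.-tuple R of p.1 :: p.2].

Lemma measurable_cons_tuple (d : nat) :
  measurable_fun [set: measurableTypeR R * d.-tuple R] (@cons_tuple d).
Proof. by apply: measurable_cons. Qed.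

HB.instance Definition _ (d : nat) :=
  @isMeasurableFun.Build _ _ _ _ (@cons_tuple d) (@measurable_cons_tuple d).

Fixpoint cube_prob (d : nat) : probability (d.-tuple R) R :=
  if d is d'.+1 then
    distribution (uniform_prob (@ltr01 R) \x cube_prob d')%E (@cons_tuple d')
  else dirac [tuple].

Definition row_of_tuple (d : nat) (t : d.-tuple R) : 'rV[R]_d :=
  \row_(i < d) tnth t i.

Lemma measurable_row_of_tuple (d : nat) :
  measurable_fun [set: d.-tuple R] (@row_of_tuple d).
Proof.
have := @g_sigma_preimage_comp _ R d _ (fun i (x : 'rV[R]_d) => x ord0 i) _
  (@row_of_tuple d).
have -> : (fun i => (fun x : 'rV[R]_d => x ord0 i) \o @row_of_tuple d) =
          (fun i (t : d.-tuple R) => tnth t i).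
  by apply/funext => i; apply/funext => t /=; rewrite mxE.
move=> E _ A mA; rewrite [X in X _]/measurable /= E.
by exists A.
Qed.

HB.instance Definition _ (d : nat) :=
  @isMeasurableFun.Build _ _ _ _ (@row_of_tuple d) (@measurable_row_of_tuple d).

(* Lebesgue measure of the unit cell [0,1]^d, as a measure on R^d *)
Definition torus_measure (d : nat) : probability 'rV[R]_d R :=
  distribution (cube_prob d) (@row_of_tuple d).

End TorusMeasure.

Section Torus.
Variables (R : realType) (d : nat).
Implicit Types (u v : 'rV[R]_d -> R) (i : 'I_d).

Notation mu := (torus_measure R d).

Definition torus_periodic u : Prop :=
  forall i x, u (x + delta_mx 0 i) = u x.

Definition torus_test u : Prop :=
  [/\ torus_periodic u, (forall x, differentiable u x) &
      forall i, continuous (fun x => 'D_(delta_mx 0 i) u x)].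

Definition torus_wd i u g : Prop := forall psi, torus_test psi ->
  \int[mu]_x (u x * 'D_(delta_mx 0 i) psi x) = - \int[mu]_x (g x * psi x).

Definition pd i u : 'rV[R]_d -> R := wpartial mu torus_wd i u.

Definition Hk (k : nat) u : Prop := sobolev mu torus_wd k u.

Definition Hk_norm (k : nat) u : R := sobolev_norm mu torus_wd k u.

(* d <= 3: an element of H^3 is taken in its continuous representative *)
Definition H3 u : Prop := [/\ torus_periodic u, continuous u & Hk 3 u].

Definition laplacian u : 'rV[R]_d -> R := fun x => \sum_(i < d) pd i (pd i u) x.

(** H^{-1}: bounded linear functionals on H^1; their values outside H^1 are
    irrelevant, so that equality in H^{-1} is [eq_Hm1]. *)
Definition Hm1 (l : ('rV[R]_d -> R) -> R) : Prop :=
  (forall (a : R) v w, Hk 1 v -> Hk 1 w ->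
     l (fun x => a * v x + w x) = a * l v + l w) /\
  (exists C : R, forall v, Hk 1 v -> `|l v| <= C * Hk_norm 1 v).

Definition eq_Hm1 (l l' : ('rV[R]_d -> R) -> R) : Prop :=
  forall v, Hk 1 v -> l v = l' v.

Definition Hm1_norm (l : ('rV[R]_d -> R) -> R) : R :=
  sup [set `|l v| | v in [set v | Hk 1 v /\ Hk_norm 1 v <= 1]].

Definition div (g : 'I_d -> 'rV[R]_d -> R) : ('rV[R]_d -> R) -> R :=
  fun v => - \int[mu]_x (\sum_(i < d) g i x * pd i v x).

End Torus.

Section Interval.
Variable R : realType.
Implicit Types (a b : R) (u g : R -> R).

(* C^1 functions with compact support in ]a, b[ *)
Definition itv_test a b u : Prop :=
  [/\ (forall x, derivable u x 1), continuous (derive1 u) &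
      exists a' b', [/\ a < a', b' < b & forall x, u x != 0 -> a' <= x <= b']].

Definition itv_wd a b (_ : unit) u g : Prop := forall psi, itv_test a b psi ->
  \int[lebesgue_measure]_(x in `]a, b[) (u x * derive1 psi x) =
  - \int[lebesgue_measure]_(x in `]a, b[) (g x * psi x).

Definition itv_measure a b : {measure set (measurableTypeR R) -> \bar R} :=
  mrestr lebesgue_measure (measurable_itv `]a, b[).

(** H^2(-1,1), in continuous representatives on [-1,1]; values outside [-1,1]
    are irrelevant. *)
Definition H2 u : Prop := {within `[-1, 1], continuous u} /\
  sobolev (itv_measure (-1) 1) (itv_wd (-1) 1) 2 u.

Definition H2_sqnorm u : R :=
  sobolev_sqnorm (itv_measure (-1) 1) (itv_wd (-1) 1) 2 u.

Definition H22 (z : (R -> R) * (R -> R)) : Prop := H2 z.1 /\ H2 z.2.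

Definition H22_sqnorm (z : (R -> R) * (R -> R)) : R :=
  H2_sqnorm z.1 + H2_sqnorm z.2.

Definition H22_norm (z : (R -> R) * (R -> R)) : R := Num.sqrt (H22_sqnorm z).

Definition eq_H22 (z z' : (R -> R) * (R -> R)) : Prop :=
  forall s, -1 <= s <= 1 -> z.1 s = z'.1 s /\ z.2 s = z'.2 s.

Definition Cn (n : nat) u : Prop :=
  (forall k, (k < n)%N -> forall s, derivable (derive1n k u) s 1) /\
  continuous (derive1n n u).

Definition condition_B (b : R -> R) : Prop :=
  Cn 2 b /\
  exists beta1 beta2 beta3 beta4 : R,
    [/\ 0 < beta1, (forall s, beta1 <= b s <= beta2),
        (forall s, `|derive1 b s| <= beta3) & (forall s, `|derive1n 2 b s| <= beta4)].

Definition condition_F (f : R -> R) : Prop :=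
  exists F : R -> R, [/\ f = derive1 F, Cn 4 F,
    (exists kappa : R, 0 <= kappa /\
       forall s, - kappa <= F s /\ - kappa <= derive1n 2 F s) &
    (exists p q : nat -> R, forall k, (k <= 4)%N ->
       [/\ 0 <= p k, 0 <= q k &
           forall s, `|derive1n k F s| <= p k + q k * `|s| ^+ (4 - k)])].

End Interval.

Section CahnHilliard.
Variables (R : realType) (d : nat).
Implicit Types (u : 'rV[R]_d -> R) (y : ('rV[R]_d -> R) -> R).

Notation mu := (torus_measure R d).

(** The two equations in H^{-1} at a fixed time, with [u] and [y] the values of
    phi and of its time derivative at that time. *)
Definition cahn_hilliard_at (gamma : R) (b f : R -> R) u y : Prop :=
  [/\ Hk 1 u, Hm1 y & exists m : 'rV[R]_d -> R,
    [/\ Hk 1 m,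
        eq_Hm1 (fun w => \int[mu]_x (m x * w x))
               (fun w => - gamma * div (fun i => pd i u) w +
                         \int[mu]_x (f (u x) * w x)) &
        eq_Hm1 y (div (fun i x => b (u x) * pd i m x))]].

(** Weak solutions on (0,T): [dphi] is the distributional time derivative of
    [phi] in H^{-1}, and the equations hold at almost every time. *)
Definition cahn_hilliard_solution (gamma : R) (b f : R -> R) (T : R)
    (phi : R -> 'rV[R]_d -> R) (dphi : R -> ('rV[R]_d -> R) -> R) : Prop :=
  (forall v, Hk 1 v ->
     let p s := \int[mu]_x (phi s x * v x) in
     let q s := dphi s v in
     [/\ locally_integrable `]0, T[ p, locally_integrable `]0, T[ q &
         itv_wd 0 T tt p q]) /\
  {ae lebesgue_measure, forall s : R, 0 < s < T ->
     cahn_hilliard_at gamma b f (phi s) (dphi s)}.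

(* the operator T of the identification problem for the state [u] *)
Definition CHop (gamma : R) u (z : (R -> R) * (R -> R)) :
    ('rV[R]_d -> R) -> R :=
  fun v => - gamma * div (fun i x => z.1 (u x) * pd i (laplacian u) x) v +
           div (fun i x => z.2 (u x) * pd i u x) v.

Definition tikhonov (gamma : R) u y (alpha : R) (z : (R -> R) * (R -> R)) : R :=
  Hm1_norm (fun v => CHop gamma u z v - y v) ^+ 2 + alpha * H22_sqnorm z.

Definition is_minimizer (J : (R -> R) * (R -> R) -> R)
    (z : (R -> R) * (R -> R)) : Prop :=
  H22 z /\ forall z', H22 z' -> J z <= J z'.

Definition is_min_norm_solution (gamma : R) u y (z : (R -> R) * (R -> R)) :
    Prop :=
  [/\ H22 z, eq_Hm1 (CHop gamma u z) y &
      forall z', H22 z' -> eq_Hm1 (CHop gamma u z') y ->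
        H22_norm z <= H22_norm z'].

End CahnHilliard.

(* Main.v *)
(** The residual z |-> |T z - y| is convex and Lipschitz for the H^2 x H^2 norm,
    and the perturbed residuals satisfy
    | |T^delta z - y^delta| - |T z - y| | <= delta (C |z| + 1).
    Comparing the functional at the minimizer x and at the minimum-norm solution z+
    gives |x|^2 <= |z+|^2 + O(delta^2 / alpha) and |T x - y| -> 0.  By the
    parallelogram law applied to the midpoint of x and z+, strong convergence then
    follows once elements of small residual have norm at least |z+| - o(1); this is
    again a parallelogram argument along an almost-minimizing sequence, so that no
    weak compactness is needed.  Exact solvability comes from
    mu = - gamma Laplace phi + f(phi), whose gradient is computed by the chain rule.

    The perturbation bound needs |u|_oo <= C |u|_{H^3} on the torus and the
    W^{1,oo} bound for H^2(-1,1).  The first is obtained by testing u against products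
    of one-dimensional Poisson kernels: each kernel is 1 plus the derivative of a
    function bounded uniformly in the radius, so every integration by parts costs one
    weak derivative.  The second is obtained by testing against C^1 and C^2 functions
    whose highest derivative is a combination of approximate point masses.
    Uniqueness of weak derivatives and density of trigonometric polynomials rest on
    a monotone-class argument separating L^2 functions by algebras of test functions. *)
Require Import Defs.
From HB Require Import structures.
From mathcomp Require Import all_boot all_order all_algebra.
From mathcomp Require Import all_classical all_reals all_analysis.
From mathcomp Require Import measurable_realfun ring lra.

Set Implicit Arguments.
Unset Strict Implicit.
Unset Printing Implicit Defensive.
Import Order.TTheory GRing.Theory Num.Theory.
Import numFieldNormedType.Exports.
Local Open Scope classical_set_scope.
Local Open Scope ring_scope.

(** * Quadratic forms and L^2 *)

(** Weak derivatives are picked by choice, so the derivative of a linear combination is the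
    combination of the derivatives only almost everywhere, and no space is formed as a quotient.
    Hilbert space arguments are therefore run on vector spaces of plain functions, with a domain
    predicate [H] and a semidefinite [N] that expands quadratically on [H]; limits are limits of
    [N (u n - l)]. The same abstract lemmas then serve L^2, H^k of the torus, H^2(-1,1) and its
    square. Coefficients have a meaning on [-1,1] only, while the exact state is merely a limit of
    states with values in (-1,1). The sup bound on the torus is what confines it to [-1,1], and the
    estimates in H^2(-1,1) have to hold up to the endpoints. The difference beta(phi) -
    beta(phi^delta) is then at most a Lipschitz constant times the sup of phi - phi^delta, which
    makes the perturbation linear both in delta and in |z|, with a constant that depends on the
    exact state and not on the data. Sharp embeddings are not sought: the sup bound spends one
    derivative per coordinate, and d <= 3 is exactly what H^3 can pay. *)

Lemma eq_leW d (T : porderType d) (x y : T) : x = y -> (x <= y)%O.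
Proof. by move=> ->. Qed.

(** Convergence is expressed through the squared seminorm on a bare [lmodType]: the function spaces
    carry no topology matching it, and limits are determined only up to [N]-null differences. *)
Definition cauchy_sq (R : realType) (V : lmodType R) (N : V -> R) (u : nat -> V) :=
  forall e : R, 0 < e -> exists n0, forall n m,
    (n0 <= n)%N -> (n0 <= m)%N -> N (u n - u m) <= e.

Definition cvg_sq (R : realType) (V : lmodType R) (N : V -> R) (u : nat -> V) l :=
  forall e : R, 0 < e -> exists n0, forall n, (n0 <= n)%N -> N (u n - l) <= e.

Section QuadraticForm.
Context {R : realType} {V : lmodType R}.
Variables (H : V -> Prop) (N : V -> R) (B : V -> V -> R).
Hypothesis H_lin : forall a u v, H u -> H v -> H (a *: u + v).
Hypothesis N_ge0 : forall u, 0 <= N u.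
Hypothesis NE : forall a u v, H u -> H v ->
  N (a *: u + v) = a ^+ 2 * N u + 2 * a * B u v + N v.

Lemma quad_sub u v : H u -> H v -> H (u - v).
Proof. by move=> hu hv; rewrite addrC -scaleN1r; exact: H_lin. Qed.

Lemma quad_add u v : H u -> H v -> H (u + v).
Proof. by move=> hu hv; rewrite -[u]scale1r; exact: H_lin. Qed.

Lemma quad0 u : H u -> H 0.
Proof. by move=> hu; rewrite -(subrr u); exact: quad_sub. Qed.

Lemma quad_scale a u : H u -> H (a *: u).
Proof. by move=> hu; rewrite -[X in H X]addr0; apply: H_lin => //; exact: (quad0 hu). Qed.

Lemma quadN0 : H 0 -> N 0 = 0.
Proof.
move=> h0; have := NE 1 h0 h0; have := NE (-1) h0 h0; have := NE 2 h0 h0.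
rewrite !scaler0 !addr0; lra.
Qed.

(** [B] is assumed neither bilinear nor symmetric. The expansion [NE] alone forces [B u 0 = 0],
    hence homogeneity of [N]; symmetry and right homogeneity of [B] are extracted from it below. *)
Lemma quadZ a u : H u -> N (a *: u) = a ^+ 2 * N u.
Proof.
move=> hu; have h0 := quad0 hu.
have E b := NE b hu h0.
have := E 1; have := E (-1); rewrite !addr0 scale1r scaleN1r => E1 E2.
have N0 := quadN0 h0.
have EN := NE (-1) (quad_scale (-1) hu) h0.
have := E a; rewrite addr0 => ->.
have := NE 0 hu h0; rewrite scale0r addr0 N0 => E0.
have /eqP : B u 0 = 0.
  have E3 := E 2.
  have := NE 1 hu hu; rewrite scale1r => E4.
  have := NE (-1) hu hu; rewrite scaleN1r addNr N0 => E5.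
  move: E3; rewrite addr0 N0 => E3.
  have F : N (u + u) = N (2%:R *: u) by rewrite scaler_nat.
  move: F; rewrite E3 E4; lra.
by move=> /eqP ->; ring.
Qed.

Lemma quadD u v : H u -> H v -> N (u + v) = N u + 2 * B u v + N v.
Proof. by move=> hu hv; have := NE 1 hu hv; rewrite scale1r => ->; ring. Qed.

Lemma quadB u v : H u -> H v -> N (u - v) = N u - 2 * B u v + N v.
Proof.
move=> hu hv; have -> : u - v = -1 *: (v - u) by rewrite scaleN1r opprB.
rewrite quadZ; last exact: quad_sub.
have := NE (-1) hu hv; rewrite scaleN1r addrC => ->; ring.
Qed.

Lemma quad_subC u v : H u -> H v -> N (u - v) = N (v - u).
Proof.
move=> hu hv; have -> : u - v = -1 *: (v - u) by rewrite scaleN1r opprB.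
by rewrite quadZ ?sqrrN ?expr1n ?mul1r//; exact: quad_sub.
Qed.

Lemma quad_CS u v : H u -> H v -> `|B u v| <= Num.sqrt (N u) * Num.sqrt (N v).
Proof.
move=> hu hv; rewrite -sqrtrM// -sqrtr_sqr ler_sqrt; last exact: mulr_ge0.
have [Nu0|Nu0] := eqVneq (N u) 0.
  have /eqP -> : B u v == 0.
    apply/negP => /negP b0.
    (* For [N u = 0] the expansion is affine in the coefficient, and this value would bring it down
       to -1. *)
    have := N_ge0 (- ((N v + 1) / (2 * B u v)) *: u + v).
    rewrite NE// Nu0 mulr0 add0r.
    have -> : 2 * - ((N v + 1) / (2 * B u v)) * B u v = - (N v + 1) by field.
    lra.
  by rewrite Nu0 expr0n/= mul0r.
(* The coefficient minimizing the quadratic. *)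
have := N_ge0 (- (B u v / N u) *: u + v); rewrite NE//.
have -> : (- (B u v / N u)) ^+ 2 * N u + 2 * - (B u v / N u) * B u v + N v
  = (N u * N v - B u v ^+ 2) / N u by field.
by rewrite pmulr_lge0 ?invr_gt0 ?subr_ge0// lt_def Nu0/=.
Qed.

Lemma quad_triangle u v : H u -> H v ->
  Num.sqrt (N (u + v)) <= Num.sqrt (N u) + Num.sqrt (N v).
Proof.
move=> hu hv; rewrite -(@ger0_norm _ (Num.sqrt (N u) + _)) ?addr_ge0 ?sqrtr_ge0//.
rewrite -sqrtr_sqr ler_sqrt ?sqr_ge0//.
rewrite quadD// sqrrD !sqr_sqrtr//.
have := quad_CS hu hv; have := ler_norm (B u v).
set x := Num.sqrt _; set y := Num.sqrt _; lra.
Qed.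

Lemma quad_mid u v : H u -> H v ->
  N (2^-1 *: (u + v)) = (N u + N v) / 2 - N (u - v) / 4.
Proof. by move=> hu hv; rewrite quadZ ?quadB ?quadD//; [field | exact: quad_add]. Qed.

Lemma quad_sqD u v : H u -> H v -> N (u + v) <= 2 * N u + 2 * N v.
Proof. by move=> hu hv; have := N_ge0 (u - v); rewrite quadB// quadD//; lra. Qed.

Lemma quad_sq_trans u v w : H u -> H v -> H w ->
  N (u - w) <= 2 * N (u - v) + 2 * N (v - w).
Proof.
move=> hu hv hw; rewrite -(subrKA v).
by apply: quad_sqD; exact: quad_sub.
Qed.

(* An approximate minimizer over a midpoint-convex set is unique up to the
   defect: this replaces weak compactness throughout. *)
Lemma uniformly_convex_cauchy (S : V -> Prop) (J : V -> R) (c : R) :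
  0 < c ->
  (forall u, S u -> H u) -> (forall u v, S u -> S v -> S (2^-1 *: (u + v))) ->
  (exists u, S u) -> (forall u, S u -> 0 <= J u) ->
  (forall u v, S u -> S v ->
     J (2^-1 *: (u + v)) <= (J u + J v) / 2 - c * N (u - v)) ->
  exists m, [/\ 0 <= m, (forall u, S u -> m <= J u) & exists u : nat -> V,
    [/\ (forall n, S (u n)), (forall n, J (u n) <= m + n.+1%:R^-1) &
        cauchy_sq N u]].
Proof.
move=> c0 SH Smid [u0 Su0] J0 Jmid.
pose m := inf [set J u | u in S].
have hI : has_inf [set J u | u in S].
  split; first by exists (J u0); exists u0.
  by exists 0 => _ [u Su <-]; exact: J0.
have mJ u : S u -> m <= J u.
  by move=> Su; apply: (ge_inf hI.2); exists u.
have [u uP] : {u : nat -> V & forall n, S (u n) /\ J (u n) <= m + n.+1%:R^-1}.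
  apply: (@choice _ _ (fun n v => S v /\ J v <= m + n.+1%:R^-1)) => n.
  have n0 : 0 < n.+1%:R^-1 :> R by rewrite invr_gt0.
  by have [_ [v Sv <-] /ltW h] := inf_adherent n0 hI; exists v.
exists m; split => //.
  by apply: lb_le_inf; [exact: hI.1|move=> _ [v Sv <-]; exact: J0].
exists u; split; [by move=> n; case: (uP n)|by move=> n; case: (uP n)|].
move=> e e0.
have [n0 hn0] : exists n0 : nat, n0.+1%:R^-1 <= c * e.
  exists (Num.truncn (c * e)^-1).
  rewrite invf_ple ?posrE ?mulr_gt0//; apply: ltW.
  exact: truncnS_gt.
exists n0 => i j ni nj.
have [Si Ji] := uP i; have [Sj Jj] := uP j.
have := Jmid _ _ Si Sj; have := mJ _ (Smid _ _ Si Sj).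
have inv_le k : (n0 <= k)%N -> k.+1%:R^-1 <= n0.+1%:R^-1 :> R.
  by move=> h; rewrite lef_pV2 ?posrE// ler_nat ltnS.
have := inv_le _ ni; have := inv_le _ nj => h1 h2 h3 h4.
rewrite -(ler_pM2l c0); clearbody m.
move: Ji Jj hn0 h1 h2 h3 h4; set a := i.+1%:R^-1; set b := j.+1%:R^-1; set d := n0.+1%:R^-1.
lra.
Qed.

Lemma quad_BC u v : H u -> H v -> B u v = B v u.
Proof.
by move=> hu hv; have := quadD hu hv; have := quadD hv hu; rewrite addrC => ->; lra.
Qed.

Lemma quad_BZr a u v : H u -> H v -> B u (a *: v) = a * B u v.
Proof.
move=> hu hv; have := quadD hu (quad_scale a hv); rewrite addrC NE// quadZ//.
by rewrite (quad_BC hv hu); lra.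
Qed.

Lemma quad_cvgN u l : (forall n, H (u n)) -> H l -> cvg_sq N u l ->
  forall e, 0 < e -> exists n0, forall n, (n0 <= n)%N -> `|N (u n) - N l| <= e.
Proof.
move=> hu hl ul e e0.
set s := Num.sqrt (N l); have s0 : 0 <= s by exact: sqrtr_ge0.
(* The difference [N (u n) - N l] equals [N (u n - l) + 2 * B (u n - l) l], at most
   [d ^+ 2 + 2 * d * s]; with [d <= 1] this is below [d * (2 * s + 1)]. *)
pose d := Num.min 1 (e / (2 * s + 1)).
have d0 : 0 < d by rewrite lt_min ltr01 divr_gt0//; lra.
have d1 : d <= 1 by rewrite ge_min lexx.
have de : d * (2 * s + 1) <= e.
  by rewrite -ler_pdivlMr; [rewrite ge_min lexx orbT|lra].
have [n0 h] := ul _ (exprn_gt0 2 d0); exists n0 => n /h Nd.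
have hd : H (u n - l) by exact: quad_sub.
have sd : Num.sqrt (N (u n - l)) <= d.
  by rewrite -(ger0_norm (ltW d0)) -sqrtr_sqr ler_sqrt ?sqr_ge0.
have E : N (u n) = N (u n - l) + 2 * B (u n - l) l + N l by rewrite -quadD ?subrK.
have := quad_CS hd hl; rewrite -/s => CS.
have CS' : `|B (u n - l) l| <= d * s.
  by apply: le_trans CS _; rewrite ler_wpM2r.
have Nd0 := N_ge0 (u n - l).
have -> : N (u n) - N l = N (u n - l) + 2 * B (u n - l) l by rewrite E; ring.
move: CS' Nd; rewrite !ler_norml => /andP[b1 b2] Nd; apply/andP; split; nra.
Qed.

(** The subspace [S] need not be closed, so the projection of [v] is only approached: minimizing [N]
    over the affine set of all [v - a] gives a Cauchy sequence, and its limit [r] is orthogonal to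
    [S]. Whenever [r] can be shown to be null, [v] lies in the closure of [S]. *)
Lemma quad_projection (S : V -> Prop) (v : V) :
  (forall u : nat -> V, (forall n, H (u n)) -> cauchy_sq N u ->
     exists l, H l /\ cvg_sq N u l) ->
  (forall a, S a -> H a) -> (exists a, S a) ->
  (forall c a b, S a -> S b -> S (c *: a + b)) -> H v ->
  exists (u : nat -> V) (r : V), [/\ forall n, S (u n), H r,
    cvg_sq N (fun n => v - u n) r & forall a, S a -> B a r = 0].
Proof.
move=> Hcomplete SH [a0 Sa0] Slin hv.
have Sadd a b : S a -> S b -> S (a + b).
  by move=> ha hb; rewrite -[a]scale1r; exact: Slin.
have SN a : S a -> S (- a).
  by move=> ha; have := Slin (-2) _ _ ha ha; rewrite scaleNr scaler_nat mulr2n opprD addrNK.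
pose Sv w := S (v - w).
have SvH w : Sv w -> H w.
  by move=> /SH h; rewrite -[w](subKr v); exact: quad_sub.
have Smid a b : Sv a -> Sv b -> Sv (2^-1 *: (a + b)).
  rewrite /Sv => ha hb.
  have -> : v - 2^-1 *: (a + b) = 2^-1 *: (v - a) + 2^-1 *: (v - b).
    rewrite -scalerDr addrACA -opprD scalerBr -[v + v]mulr2n -[v *+ 2]scaler_nat scalerA.
    by rewrite mulVf ?scale1r.
  have S0 : S 0 by rewrite -(subrr a0); apply: Sadd => //; exact: SN.
  apply: Sadd; rewrite -[X in S X]addr0; exact: Slin.
have [||a Sa|a b Sa Sb|m [m0 hm [w [Sw Nw cw]]]] :=
  @uniformly_convex_cauchy Sv N 4^-1 _ SvH Smid.
- by rewrite invr_gt0.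
- by exists (v - a0); rewrite /Sv subKr.
- exact: N_ge0.
- by rewrite quad_mid; [lra|exact: SvH|exact: SvH].
have [r [hr wr]] := Hcomplete w (fun n => SvH _ (Sw n)) cw.
have Hw n : H (w n) by exact: SvH.
have invS n k : (n <= k)%N -> k.+1%:R^-1 <= n.+1%:R^-1 :> R.
  by move=> nk; rewrite lef_pV2 ?posrE// ler_nat ltnS.
have Nr : N r <= m.
  apply/ler_addgt0Pr => e e0; have e2 : 0 < e / 2 by rewrite divr_gt0.
  have [n1 h1] := quad_cvgN Hw hr wr e2.
  have [n2 h2] : exists n2 : nat, n2.+1%:R^-1 <= e / 2.
    exists (Num.truncn (e / 2)^-1); rewrite invf_ple ?posrE//; apply: ltW; exact: truncnS_gt.
  have := h1 (maxn n1 n2) (leq_maxl _ _); have := Nw (maxn n1 n2).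
  have := invS n2 _ (leq_maxr n1 n2).
  move: h2; move: (n2.+1%:R^-1) ((maxn n1 n2).+1%:R^-1) => x y.
  by rewrite ler_norml => + + + /andP[]; move: e0; lra.
have mle a : S a -> m <= N (a + r).
  move=> Sa; apply/ler_addgt0Pr => e e0.
  have [n h] : exists n, `|N (a + w n) - N (a + r)| <= e.
    have Haw n : H (a + w n) by apply: quad_add => //; exact: SH.
    have Har : H (a + r) by apply: quad_add => //; exact: SH.
    have caw : cvg_sq N (fun n => a + w n) (a + r).
      move=> e' /wr[n1 h1]; exists n1 => n /h1.
      by rewrite opprD addrACA subrr add0r.
    by have [n1 h1] := quad_cvgN Haw Har caw e0; exists n1; exact: h1.
  have := hm (a + w n); rewrite /Sv => Hm.
  have : m <= N (a + w n).
    by apply: Hm; rewrite opprD addrCA; apply: Sadd; [exact: SN|exact: (Sw n)].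
  by move: h; rewrite ler_norml => /andP[]; lra.
exists (fun n => v - w n), r; split => //.
- by move=> e /wr[n0 h]; exists n0 => n /h; rewrite subKr.
move=> a Sa; have ha := SH _ Sa.
have S0 : S 0 by rewrite -(subrr a0); apply: Sadd => //; exact: SN.
have St t : S (t *: a) by rewrite -[_ *: a]addr0; exact: Slin.
(* The optimal coefficient up to the added 1, which spares the case [N a = 0]. *)
pose t := - (B a r / (N a + 1)).
have := mle _ (St t); rewrite NE// => h.
have Na := N_ge0 a.
have Na1 : 0 < N a + 1 by lra.
have h' : 0 <= t ^+ 2 * N a + 2 * t * B a r by lra.
have E : t ^+ 2 * N a + 2 * t * B a r = - (B a r ^+ 2 * (N a + 2)) / (N a + 1) ^+ 2.
  by rewrite /t; field; rewrite gt_eqF.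
have : B a r ^+ 2 * (N a + 2) <= 0.
  move: h'; rewrite E mulNr oppr_ge0 pmulr_lle0// invr_gt0 exprn_gt0//.
rewrite pmulr_lle0; last lra.
by move=> h2; apply/eqP; rewrite -sqrf_eq0 eq_le h2 sqr_ge0.
Qed.

End QuadraticForm.

(** * The space L^2 and its completeness over a finite measure *)

Section L2.
Context {disp : measure_display} {T : measurableType disp} {R : realType}.
Variable mu : {measure set T -> \bar R}.
Implicit Types u v w : T -> R.

Local Notation L2 u := (u \in Lfun mu 2%:E).
Local Notation itg f := (mu.-integrable setT (EFin \o f)).

Lemma L2_measurable u : L2 u -> measurable_fun setT u.
Proof. by move=> /sub_Lfun_mfun; rewrite inE. Qed.

Lemma L2_sqr u : L2 u -> itg (fun x => u x ^+ 2).
Proof. exact: Lfun2_integrable_sqr. Qed.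

Lemma L2P u : measurable_fun setT u -> itg (fun x => u x ^+ 2) -> L2 u.
Proof.
move=> mu_ /integrableP[_ iu]; rewrite inE; apply/andP; split; rewrite inE//=.
rewrite /finite_norm unlock /Lnorm poweR_lty//.
apply: le_lt_trans iu; apply: ge0_le_integral => //.
- by move=> x _; rewrite /= lee_fin powR_ge0.
- apply/measurable_EFinP.
  apply/(@measurableT_comp _ _ _ _ _ _ (fun x : R => x `^ 2)%R) => //.
  exact/measurableT_comp.
- apply: measurableT_comp => //; apply/measurable_EFinP; exact: measurable_funX.
- by move=> x _ /=; rewrite lee_fin normrX powR_mulrn.
Qed.

Lemma L2_prod u v : L2 u -> L2 v -> itg (fun x => u x * v x).
Proof. by move=> hu hv; apply/Lfun1_integrable; exact: Lfun2_mul_Lfun1. Qed.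

Lemma integrable_lin a (f g : T -> R) : itg f -> itg g -> itg (fun x => a * f x + g x).
Proof.
move=> hf hg; have := integrableD measurableT (integrableZl measurableT a hf) hg.
by apply: eq_integrable.
Qed.

Lemma Rintegral_lin a (f g : T -> R) : itg f -> itg g ->
  \int[mu]_x (a * f x + g x) = a * \int[mu]_x f x + \int[mu]_x g x.
Proof.
move=> hf hg; rewrite RintegralD ?RintegralZl//.
by have := integrableZl measurableT a hf; apply: eq_integrable.
Qed.

Lemma L2_lin a u v : L2 u -> L2 v -> L2 (fun x => a * u x + v x).
Proof.
move=> hu hv; apply: L2P.
  apply: measurable_funD; last exact: L2_measurable.
  by apply: measurable_funM => //; exact: L2_measurable.
have h1 := integrable_lin (2 * a) (L2_prod hu hv) (L2_sqr hv).
have := integrable_lin (a ^+ 2) (L2_sqr hu) h1.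
by apply: eq_integrable => // x _ /=; congr EFin; ring.
Qed.

Lemma ae_measurable_sq u v : (\forall x \ae mu, u x = v x) ->
  \forall x \ae mu, u x ^+ 2 = v x ^+ 2.
Proof. by apply: filterS => x ->. Qed.

Lemma Rintegral_ae_eq (f g : T -> R) : measurable_fun setT f ->
  measurable_fun setT g -> (\forall x \ae mu, f x = g x) ->
  \int[mu]_x f x = \int[mu]_x g x.
Proof.
move=> mf mg fg; rewrite /Rintegral; congr fine; apply: ae_eq_integral => //.
- exact/measurable_EFinP.
- exact/measurable_EFinP.
- by apply: filterS fg => x -> _.
Qed.

Lemma integrable_ae_eq (f g : T -> R) : itg f ->
  measurable_fun setT g -> (\forall x \ae mu, f x = g x) -> itg g.
Proof.
move=> /integrableP[mf If] mg fg; apply/integrableP; split.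
  exact/measurable_EFinP.
apply: le_lt_trans If; rewrite le_eqVlt; apply/orP; left; apply/eqP.
apply: ae_eq_integral => //.
- by apply: measurableT_comp => //; exact/measurable_EFinP.
- exact: measurableT_comp.
- by apply: filterS fg => x /= -> _.
Qed.

Lemma L2_ae u v : L2 u -> measurable_fun setT v -> (\forall x \ae mu, u x = v x) -> L2 v.
Proof.
move=> hu mv uv; apply: L2P => //.
apply: (integrable_ae_eq (L2_sqr hu)); first exact: measurable_funX.
exact: ae_measurable_sq.
Qed.

Lemma integrable_bounded_mul c (h f : T -> R) : measurable_fun setT h ->
  (forall x, `|h x| <= c) -> itg f -> itg (fun x => h x * f x).
Proof.
move=> mh hc If; have [/measurable_EFinP mf _] := integrableP _ _ _ If.
have := integrableZl measurableT c If.
apply: le_integrable => //.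
  by apply/measurable_EFinP; exact: measurable_funM.
move=> x _ /=; rewrite lee_fin !normrM ler_wpM2r//.
exact: le_trans (hc x) (ler_norm c).
Qed.

Lemma L2_bounded_mul c (h u : T -> R) : measurable_fun setT h ->
  (forall x, `|h x| <= c) -> L2 u -> L2 (fun x => h x * u x).
Proof.
move=> mh hc hu; apply: L2P.
  by apply: measurable_funM => //; exact: L2_measurable.
have := @integrable_bounded_mul (c ^+ 2) (fun x => h x ^+ 2) _ _ _ (L2_sqr hu).
have -> : (fun x => h x ^+ 2 * u x ^+ 2) = (fun x => (h x * u x) ^+ 2).
  by apply/funext => x; rewrite exprMn.
apply; first exact: measurable_funX.
by move=> x; rewrite normrX lerXn2r ?nnegrE// (le_trans _ (hc x)).
Qed.

Definition sqnormL2 u : R := \int[mu]_x (u x ^+ 2).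
Definition ipL2 u v : R := \int[mu]_x (u x * v x).

Lemma sqnormL2_ge0 u : 0 <= sqnormL2 u.
Proof. by apply: Rintegral_ge0 => x _; exact: sqr_ge0. Qed.

Lemma sqnormL2_lin a u v : L2 u -> L2 v ->
  sqnormL2 (fun x => a * u x + v x) =
  a ^+ 2 * sqnormL2 u + 2 * a * ipL2 u v + sqnormL2 v.
Proof.
move=> hu hv; rewrite /sqnormL2 /ipL2 -addrA.
rewrite -Rintegral_lin; [|exact: L2_prod|exact: L2_sqr].
rewrite -Rintegral_lin; [|exact: L2_sqr|]; last first.
  by apply: integrable_lin; [exact: L2_prod|exact: L2_sqr].
by apply: eq_Rintegral => x _; ring.
Qed.

Lemma ipL2_lin a u v w : L2 u -> L2 v -> L2 w ->
  ipL2 (fun x => a * u x + v x) w = a * ipL2 u w + ipL2 v w.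
Proof.
move=> hu hv hw; rewrite /ipL2 -Rintegral_lin; [|exact: L2_prod|exact: L2_prod].
by apply: eq_Rintegral => x _; ring.
Qed.

Lemma ipL2C u v : ipL2 u v = ipL2 v u.
Proof. by apply: eq_Rintegral => x _; rewrite mulrC. Qed.

Definition isL2 (u : T -> R^o) : Prop := L2 (u : T -> R).

Lemma isL2_lin a (u v : T -> R^o) : isL2 u -> isL2 v -> isL2 (a *: u + v).
Proof. exact: L2_lin. Qed.

Lemma isL2_NE a (u v : T -> R^o) : isL2 u -> isL2 v ->
  sqnormL2 (a *: u + v) = a ^+ 2 * sqnormL2 u + 2 * a * ipL2 u v + sqnormL2 v.
Proof. exact: sqnormL2_lin. Qed.

Lemma ipL2_CS u v : L2 u -> L2 v ->
  `|ipL2 u v| <= Num.sqrt (sqnormL2 u) * Num.sqrt (sqnormL2 v).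
Proof.
move=> hu hv.
exact: (@quad_CS R (T -> R^o) isL2 (fun w => sqnormL2 w) (fun w w' => ipL2 w w')
  sqnormL2_ge0 isL2_NE).
Qed.

Lemma sqnormL2_ae0 u : L2 u -> sqnormL2 u = 0 -> \forall x \ae mu, u x = 0.
Proof.
move=> hu u0.
have iu := L2_sqr hu.
have E : (\int[mu]_x `|(u x ^+ 2)%:E| = 0)%E.
  have -> : (\int[mu]_x `|(u x ^+ 2)%:E| = \int[mu]_x (u x ^+ 2)%:E)%E.
    by apply: eq_integral => x _; rewrite gee0_abs// lee_fin sqr_ge0.
  have := u0; rewrite /sqnormL2 /Rintegral => E.
  by rewrite -[LHS]fineK ?E//; exact: integrable_fin_num.
move/ae_eq_integral_abs : E => /(_ measurableT) E.
have : ae_eq mu setT (EFin \o (fun x => u x ^+ 2)) (cst 0%E).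
  by apply/E; exact: measurable_int iu.
by apply: filterS => x /(_ I) /= [/eqP]; rewrite sqrf_eq0 => /eqP.
Qed.

Lemma sqnormL2_ae u v : L2 u -> L2 v -> (\forall x \ae mu, u x = v x) ->
  sqnormL2 u = sqnormL2 v.
Proof.
move=> hu hv uv; apply: Rintegral_ae_eq.
- by apply: measurable_funX; exact: L2_measurable.
- by apply: measurable_funX; exact: L2_measurable.
- exact: ae_measurable_sq.
Qed.

Lemma ipL2_ae u v w : L2 u -> L2 v -> L2 w -> (\forall x \ae mu, u x = v x) ->
  ipL2 u w = ipL2 v w.
Proof.
move=> hu hv hw uv; apply: Rintegral_ae_eq.
- by apply: measurable_funM; exact: L2_measurable.
- by apply: measurable_funM; exact: L2_measurable.
- by apply: filterS uv => x ->.
Qed.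

Lemma measurable_fun_limn_einf (f : (T -> \bar R)^nat) :
  (forall n, measurable_fun setT (f n)) ->
  measurable_fun setT (fun x => limn_einf (f ^~ x)).
Proof.
move=> mf.
have -> : (fun x => limn_einf (f ^~ x)) =
          (fun x => - limn_esup ((fun n y => - f n y) ^~ x))%E.
  apply/funext => x; rewrite -limn_einfN; congr limn_einf.
  by apply/funext => n /=; rewrite oppeK.
apply: measurableT_comp => //; apply: measurable_fun_limn_esup => n.
exact: measurableT_comp.
Qed.

Hypothesis mu_fin : (mu setT < +oo)%E.

Lemma L2_bounded c (h : T -> R) : measurable_fun setT h ->
  (forall x, `|h x| <= c) -> L2 h.
Proof.
move=> mh hc; apply: L2P => //.
have ic : itg (fun=> c ^+ 2).
  apply/integrableP; split; first exact: measurable_cst.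
  rewrite integral_cst//=.
  by rewrite lte_mul_pinfty.
apply: le_integrable ic => //; first by apply/measurable_EFinP; exact: measurable_funX.
move=> x _ /=; rewrite lee_fin !normrX ler_sqr ?nnegrE//.
exact: le_trans (hc x) (ler_norm c).
Qed.

Lemma L2_integrable u : L2 u -> itg u.
Proof.
move=> hu; have h1 : L2 (fun=> 1) by apply: (@L2_bounded 1) => // x; rewrite normr1.
have := L2_prod hu h1; apply: eq_integrable => // x _ /=.
by rewrite mulr1.
Qed.

Lemma L2_normL1 u : L2 u ->
  \int[mu]_x `|u x| <= Num.sqrt (fine (mu setT)) * Num.sqrt (sqnormL2 u).
Proof.
move=> hu; have h1 : L2 (fun=> 1) by apply: (@L2_bounded 1) => // x; rewrite normr1.
have hn : L2 (fun x => `|u x|).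
  apply: L2P; first by apply: measurableT_comp => //; exact: L2_measurable.
  have := L2_sqr hu; apply: eq_integrable => // x _ /=.
  by rewrite real_normK ?num_real.
have := ipL2_CS h1 hn; rewrite /ipL2 /sqnormL2.
have -> : \int[mu]_x (`|u x| ^+ 2) = \int[mu]_x (u x ^+ 2).
  by apply: eq_Rintegral => x _; rewrite real_normK ?num_real.
have -> : \int[mu]_x (1 ^+ 2 : R) = fine (mu setT).
  by rewrite Rintegral_cst ?expr1n ?mul1r.
apply: le_trans; rewrite ger0_norm; last first.
  by apply: Rintegral_ge0 => x _; rewrite mul1r.
by apply/eq_leW/eq_Rintegral => x _; rewrite mul1r.
Qed.

Lemma abs_series_cvg (v : nat -> R) (M : R) :
  (forall n, \sum_(0 <= k < n) `|v k.+1 - v k| <= M) -> cvgn v.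
Proof.
move=> hM.
have c1 : cvgn (series (fun k => v k.+1 - v k)).
  apply: normed_cvg; apply: nondecreasing_is_cvgn.
    by apply: nondecreasing_series => n _ _; exact: normr_ge0.
  by exists M => _ [n _ <-] /=; exact: hM.
have -> : v = (fun n => v 0%N + series (fun k => v k.+1 - v k) n).
  apply/funext => n; rewrite /series /= telescope_sumr//.
  by rewrite addrC subrK.
by apply: is_cvgD => //; exact: is_cvg_cst.
Qed.

(** The Riesz-Fischer argument. Along a subsequence with squared increments at most 4^-k, the L^1
    norms of the increments are summable because the measure is finite, so the increments are
    absolutely summable almost everywhere. Fatou's lemma then turns the pointwise limit into an L^2
    limit. *)
Lemma L2_complete (u : nat -> T -> R^o) : (forall n, isL2 (u n)) ->
  cauchy_sq (fun w : T -> R^o => sqnormL2 w) u ->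
  exists l : T -> R^o, isL2 l /\ cvg_sq (fun w : T -> R^o => sqnormL2 w) u l.
Proof.
move=> hu cu.
have [f fP] : {f : nat -> nat & forall k n m, (f k <= n)%N -> (f k <= m)%N ->
    sqnormL2 (u n - u m) <= 4^-1 ^+ k}.
  apply: (@choice _ _ (fun k n0 => forall n m, (n0 <= n)%N -> (n0 <= m)%N ->
    sqnormL2 (u n - u m) <= 4^-1 ^+ k)) => k.
  by apply: cu; apply: exprn_gt0; rewrite invr_gt0.
(* A running maximum, so that every later index of the subsequence also clears the threshold
   [f k]. *)
pose g k := (\max_(i < k.+1) f i)%N.
have fg k j : (k <= j)%N -> (f k <= g j)%N.
  by move=> kj; apply: (leq_bigmax (Ordinal (_ : (k < j.+1)%N))).
pose v k := u (g k).
have hv k : isL2 (v k) by exact: hu.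
have vN k j : (k <= j)%N -> sqnormL2 (v j - v k) <= 4^-1 ^+ k.
  by move=> kj; apply: fP; exact: fg.
have mv k : measurable_fun setT (v k : T -> R) by exact: L2_measurable (hv k).
have hB a b : isL2 a -> isL2 b -> isL2 (a - b).
  exact: (quad_sub isL2_lin).
pose h x := (\sum_(0 <= k <oo) `|v k.+1 x - v k x|%:E)%E.
pose C := Num.sqrt (fine (mu setT)).
have C0 : 0 <= C by exact: sqrtr_ge0.
have md k : measurable_fun setT (fun x => `|v k.+1 x - v k x|%:E).
  apply/measurable_EFinP; apply: measurableT_comp => //.
  exact: measurable_funB.
have Ih : (\int[mu]_x h x < +oo)%E.
  rewrite /h integral_nneseries//.
  apply: (@le_lt_trans _ _ (2 * C)%:E); last exact: ltry.
  apply: lime_le; first by apply: is_cvg_nneseries => *; exact: integral_ge0.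
  apply: nearW => n.
  apply: (@le_trans _ _ (\sum_(0 <= k < n) (C * 2^-1 ^+ k)%:E)%E).
    apply: lee_sum => k _.
    have hk : isL2 (v k.+1 - v k) by exact: hB.
    have h0 := L2_normL1 hk.
    have hi : itg (fun x => `|(v k.+1 - v k) x|).
      by have := integrable_norm (L2_integrable hk); apply: eq_integrable.
    rewrite -[leLHS]fineK; last exact: integrable_fin_num hi.
    rewrite lee_fin; apply: le_trans h0 _; rewrite ler_wpM2l//.
    have -> : (2^-1 : R) ^+ k = Num.sqrt (4^-1 ^+ k).
      rewrite (_ : 4^-1 = 2^-1 ^+ 2 :> R); last by field.
      by rewrite -exprM mulnC exprM sqrtr_sqr ger0_norm// exprn_ge0.
    by rewrite ler_sqrt ?vN// exprn_ge0.
  rewrite sumEFin lee_fin -mulr_sumr mulrC ler_wpM2r//.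
  have := subrX1 (2^-1 : R) n; rewrite -(big_mkord xpredT (fun i => (2^-1 : R) ^+ i)).
  have : 0 <= (2^-1 : R) ^+ n by apply: exprn_ge0.
  by move=> h1 h2; move: h1 h2; set a := (_ ^+ n); set b := \sum_(0 <= i < n) _; lra.
have mh : measurable_fun setT h by apply: ge0_emeasurable_sum.
have aeh : \forall x \ae mu, h x \is a fin_num.
  have ih : mu.-integrable setT h.
    apply/integrableP; split => //.
    apply: le_lt_trans Ih; apply/eq_leW/eq_integral => x _.
    by rewrite gee0_abs// nneseries_ge0.
  by have := integrable_ae measurableT ih; apply: filterS => x; exact.
have cv x : h x \is a fin_num -> cvgn (fun k => v k x : R).
  move=> hx; apply: (@abs_series_cvg _ (fine (h x))) => n.
  rewrite -lee_fin fineK// -sumEFin.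
  exact: nneseries_lim_ge.
(* An upper limit is measurable without knowing where the sequence converges, and it is the limit
   wherever [h] is finite. *)
pose l x := fine (limn_esup (fun k => (v k x)%:E)).
have lE x : h x \is a fin_num -> (fun k => v k x) @ \oo --> l x.
  move=> /cv cx; set w := fun k => v k x : R; have [L cL] : exists L : R, w @ \oo --> L by exists (limn w).
  have cE : (fun k => (w k)%:E) @ \oo --> L%:E by apply: cvg_EFin; [exact: nearW|].
  have -> : l x = L.
    rewrite /l is_cvg_limn_esupE; last by apply/cvg_ex; exists L%:E.
    by move/cvg_lim : cE => ->.
  exact: cL.
have ml : measurable_fun setT (l : T -> R).
  apply: measurableT_comp => //; apply: measurable_fun_limn_esup => n.
  exact/measurable_EFinP.
have key k : (\int[mu]_x ((l x - v k x) ^+ 2)%:E <= (4^-1 ^+ k)%:E)%E.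
  pose F j x := (((v (j + k)%N x - v k x) ^+ 2)%:E).
  have mF j : measurable_fun setT (F j).
    by apply/measurable_EFinP; apply: measurable_funX; exact: measurable_funB.
  have -> : (\int[mu]_x ((l x - v k x) ^+ 2)%:E = \int[mu]_x limn_einf (F ^~ x))%E.
    apply: ae_eq_integral => //.
    - by apply/measurable_EFinP; apply: measurable_funX; exact: measurable_funB.
    - exact: measurable_fun_limn_einf.
    - apply: filterS aeh => x hx _.
      have cF : F ^~ x @ \oo --> ((l x - v k x) ^+ 2)%:E.
        apply: cvg_EFin; first exact: nearW.
        rewrite /comp /=; apply: cvgM.
        + apply: cvgB; last exact: cvg_cst.
          by rewrite (cvg_shiftn k (fun j => v j x)); exact: lE.
        + apply: cvgB; last exact: cvg_cst.
          by rewrite (cvg_shiftn k (fun j => v j x)); exact: lE.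
      rewrite is_cvg_limn_einfE; last by apply/cvg_ex; eexists; exact: cF.
      by move/cvg_lim : cF => ->.
  apply: (le_trans (fatou _ _ _ _)) => //.
    by move=> j x _; rewrite lee_fin sqr_ge0.
  rewrite limn_einf_lim; apply: lime_le; first exact: is_cvg_einfs.
  apply: nearW => n; apply: ereal_inf_le.
  exists (\int[mu]_x F n x)%E; first by exists n => //=; exact: leqnn.
  have hk : isL2 (v (n + k)%N - v k) by exact: hB.
  rewrite -[leLHS]fineK; last exact: integrable_fin_num (L2_sqr hk).
  by rewrite lee_fin; apply: vN; exact: leq_addl.
have lv k : isL2 (fun x => l x - v k x).
  apply: L2P; first exact: measurable_funB.
  apply/integrableP; split.
    by apply/measurable_EFinP; apply: measurable_funX; exact: measurable_funB.
  apply: le_lt_trans (ltry (4^-1 ^+ k)); apply: le_trans (key k).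
  by apply/eq_leW/eq_integral => x _; rewrite gee0_abs// lee_fin sqr_ge0.
have hl : isL2 l.
  have := isL2_lin 1 (lv 0%N) (hv 0%N).
  have -> : 1 *: (fun x => l x - v 0%N x) + v 0%N = l.
    by apply/funext => x; rewrite scale1r /= subrK.
  by [].
exists l; split => // e e0.
have [k hk] : exists k, 4^-1 ^+ k <= e / 4.
  have : (fun k => (4^-1 : R) ^+ k) @ \oo --> 0.
    by apply: cvg_expr; rewrite ger0_norm// invf_lt1// ltr1n.
  move/cvgrPdist_le => /(_ (e / 4)) [|N _ hN]; first by rewrite divr_gt0.
  exists N; have := hN N (leqnn _); rewrite sub0r normrN ger0_norm//.
exists (g k) => n gn.
apply: le_trans (quad_sq_trans isL2_lin sqnormL2_ge0 isL2_NE (hu n) (hv k) hl) _.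
have h1 : sqnormL2 (u n - v k) <= 4^-1 ^+ k.
  by apply: fP; [exact: leq_trans (fg _ _ (leqnn _)) gn|exact: fg].
have h2 : sqnormL2 (v k - l) <= 4^-1 ^+ k.
  rewrite -lee_fin; apply: le_trans (key k); rewrite fineK.
    by apply/eq_leW/eq_integral => x _; rewrite -sqrrN opprB.
  exact: integrable_fin_num (L2_sqr (hB _ _ (hv k) hl)).
lra.
Qed.

End L2.

(** * Abstract Sobolev spaces *)

Lemma fct_subE (T : Type) (R : realType) (a b : T -> R^o) :
  a - b = (fun x => -1 * b x + a x).
Proof.
apply/funext => x; change (a x - b x = -1 * (b x : R) + (a x : R)).
by rewrite mulN1r addrC.
Qed.

Lemma ipL2_cvg d (T : measurableType d) (R : realType)
    (mu : {measure set T -> \bar R}) (w : nat -> T -> R^o) (w0 : T -> R^o) (p : T -> R) :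
  (forall n, isL2 mu (w n)) -> isL2 mu w0 -> p \in Lfun mu 2%:E ->
  cvg_sq (fun w : T -> R^o => sqnormL2 mu w) w w0 ->
  forall e : R, 0 < e -> exists n0, forall n, (n0 <= n)%N ->
    `|ipL2 mu (w n) p - ipL2 mu w0 p| <= e.
Proof.
move=> hw hw0 hp cw e e0.
have a0 : 0 < (e / (Num.sqrt (sqnormL2 mu p) + 1)) ^+ 2.
  by rewrite exprn_gt0// divr_gt0// ltr_wpDl// sqrtr_ge0.
have [n0 h] := cw _ a0; exists n0 => n /h {}h.
have hB : isL2 mu (w n - w0) by exact: (quad_sub (@isL2_lin _ _ _ mu)).
have -> : ipL2 mu (w n) p - ipL2 mu w0 p = ipL2 mu (w n - w0) p.
  have := ipL2_lin (-1) hw0 (hw n) hp.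
  by rewrite -fct_subE => ->; ring.
apply: le_trans (ipL2_CS hB hp) _.
move: h; rewrite -ler_sqrt; last exact: ltW.
rewrite sqrtr_sqr ger0_norm; last by rewrite divr_ge0 ?addr_ge0 ?sqrtr_ge0 ?ltW.
rewrite ler_pdivlMr ?ltr_wpDl ?sqrtr_ge0//; apply: le_trans.
by rewrite ler_wpM2l ?sqrtr_ge0// lerDl.
Qed.

(* [tst i p q] reads "q is a test function and p its i-th derivative". *)
Record weak_derivation d (T : measurableType d) (R : realType)
    (mu : {measure set T -> \bar R}) (I : finType)
    (wd : I -> (T -> R) -> (T -> R) -> Prop)
    (tst : I -> (T -> R) -> (T -> R) -> Prop) : Prop := WeakDerivation {
  wd_finite : (mu setT < +oo)%E;
  wd_testL2 : forall i p q, tst i p q ->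
    p \in Lfun mu 2%:E /\ q \in Lfun mu 2%:E;
  wd_def : forall i u g, wd i u g <->
    forall p q, tst i p q -> ipL2 mu u p = - ipL2 mu g q;
  wd_separating : forall i g, g \in Lfun mu 2%:E ->
    (forall p q, tst i p q -> ipL2 mu g q = 0) -> \forall x \ae mu, g x = 0 }.

Section SobolevTheory.
Context {disp : measure_display} {T : measurableType disp} {R : realType}.
Context {mu : {measure set T -> \bar R}} {I : finType}.
Context {wd : I -> (T -> R) -> (T -> R) -> Prop}.
Context {tst : I -> (T -> R) -> (T -> R) -> Prop}.
Hypothesis W : weak_derivation mu wd tst.
Implicit Types u v g : T -> R.

Local Notation L2 u := (u \in Lfun mu 2%:E).
Local Notation D i u := (wpartial mu wd i u).
Local Notation has := (has_wpartial mu wd).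
Local Notation Sob := (sobolev mu wd).
Local Notation sqn := (sobolev_sqnorm mu wd).
Local Notation "u =ae v" := (\forall x \ae mu, u x = v x) (at level 70).

Lemma has_wpartialP i u : (exists g, has i u g) -> has i u (D i u).
Proof. by move=> /(@xgetPex _ (cst 0 : T -> R)). Qed.

Lemma has_wpartial_lin i a u v g h : L2 u -> L2 v -> has i u g -> has i v h ->
  has i (fun x => a * u x + v x) (fun x => a * g x + h x).
Proof.
move=> hu hv [hg /(wd_def W) ug] [hh /(wd_def W) vh]; split; first exact: L2_lin.
apply/(wd_def W) => p q pq; have [hp hq] := wd_testL2 W pq.
rewrite !ipL2_lin// (ug _ _ pq) (vh _ _ pq); ring.
Qed.

Lemma has_wpartial_ae i u v g : L2 u -> L2 v -> u =ae v -> has i u g -> has i v g.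
Proof.
move=> hu hv uv [hg /(wd_def W) ug]; split=> //; apply/(wd_def W) => p q pq.
have [hp hq] := wd_testL2 W pq.
rewrite -(ug _ _ pq); apply: ipL2_ae => //.
by apply: filterS uv => x ->.
Qed.

Lemma has_wpartial_ae_r i u g h : L2 h -> g =ae h -> has i u g -> has i u h.
Proof.
move=> hh gh [hg /(wd_def W) ug]; split=> //; apply/(wd_def W) => p q pq.
have [hp hq] := wd_testL2 W pq.
by rewrite (ug _ _ pq); congr (- _); apply: ipL2_ae.
Qed.

Lemma ae_eq_subr0 g h : (fun x => -1 * g x + h x) =ae (fun=> 0) -> h =ae g.
Proof. by apply: filterS => x /= E; apply/eqP; rewrite -subr_eq0; apply/eqP; lra. Qed.

Lemma has_wpartial_unique i u g h : has i u g -> has i u h -> g =ae h.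
Proof.
move=> [hg /(wd_def W) ug] [hh /(wd_def W) uh]; apply: ae_eq_subr0.
apply: (wd_separating W (i := i)); first exact: L2_lin.
move=> p q pq; have [hp hq] := wd_testL2 W pq.
rewrite ipL2_lin//; have := ug _ _ pq; have := uh _ _ pq; lra.
Qed.

Lemma wpartial_unique i u g : has i u g -> D i u =ae g.
Proof. move=> ug; have uD : has i u (D i u) by apply: has_wpartialP; exists g.
exact: has_wpartial_unique uD ug. Qed.

(** Functions that agree almost everywhere have the same set of weak derivatives, so the choice
    operator returns the same element. The conclusion is a genuine equality, which is what lets null
    sets be ignored under iterated derivatives. *)
Lemma wpartial_ae i u v : L2 u -> L2 v -> u =ae v -> D i u = D i v.
Proof.
move=> hu hv uv; rewrite /wpartial; congr xget; apply/seteqP; split => g /=.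
  exact: has_wpartial_ae.
by apply: has_wpartial_ae => //; apply: filterS uv => x ->.
Qed.

Lemma sobolev_L2 k u : Sob k u -> L2 u.
Proof. by case: k => [|k] []. Qed.

Lemma sobolev_has k u i : Sob k.+1 u -> has i u (D i u).
Proof. by case=> _ /(_ i)[/has_wpartialP]. Qed.

Lemma sobolev_wpartial k u i : Sob k.+1 u -> Sob k (D i u).
Proof. by case=> _ /(_ i)[]. Qed.

Lemma wpartial_L2 k u i : Sob k.+1 u -> L2 (D i u).
Proof. by move=> /sobolev_wpartial - /(_ i)/sobolev_L2. Qed.

Lemma sobolevW k u : Sob k.+1 u -> Sob k u.
Proof.
elim: k u => [|k IH] u hu; first by split=> //; exact: sobolev_L2 hu.
split; first exact: sobolev_L2 hu.
move=> i; split; first by exists (D i u); exact: sobolev_has hu.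
by apply: IH; exact: sobolev_wpartial hu.
Qed.

Lemma sobolev_ae k u v : Sob k u -> L2 v -> u =ae v -> Sob k v.
Proof.
case: k => [|k] hu hv uv; split=> // i.
rewrite -(wpartial_ae i (sobolev_L2 hu) hv uv); split; last exact: sobolev_wpartial.
exists (D i u); apply: has_wpartial_ae (sobolev_has i hu) => //.
exact: sobolev_L2 hu.
Qed.

Lemma sobolev_sqnorm_ae k u v : L2 u -> L2 v -> u =ae v -> sqn k u = sqn k v.
Proof.
move=> hu hv uv; case: k => [|k] /=; rewrite -!/(sqnormL2 mu _);
  rewrite (sqnormL2_ae hu hv uv)//.
by congr (_ + _); apply: eq_bigr => i _; rewrite (wpartial_ae i hu hv uv).
Qed.

Lemma wpartial_lin k i a u v : Sob k.+1 u -> Sob k.+1 v ->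
  D i (fun x => a * u x + v x) =ae (fun x => a * D i u x + D i v x).
Proof.
move=> hu hv; apply: wpartial_unique; apply: has_wpartial_lin.
- exact: sobolev_L2 hu.
- exact: sobolev_L2 hv.
- exact: sobolev_has hu.
- exact: sobolev_has hv.
Qed.

(** For a fixed test function both sides of the integration by parts identity are continuous in L^2,
    so weak differentiation has a closed graph. This identifies limits of derivatives in the
    completeness proof and in the chain rule. *)
Lemma has_wpartial_closed i (u_ g_ : nat -> T -> R^o) (u g : T -> R^o) :
  (forall n, isL2 mu (u_ n)) -> isL2 mu u -> isL2 mu g ->
  (forall n, has i (u_ n) (g_ n)) ->
  cvg_sq (fun w : T -> R^o => sqnormL2 mu w) u_ u ->
  cvg_sq (fun w : T -> R^o => sqnormL2 mu w) g_ g -> has i u g.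
Proof.
move=> hu_ hu hg ug cu cg; split=> //; apply/(wd_def W) => p q pq.
have [hp hq] := wd_testL2 W pq.
apply/eqP; rewrite -subr_eq0 opprK -normr_le0; apply/ler_addgt0Pr => e e0; rewrite add0r.
have e2 : 0 < e / 2 by rewrite divr_gt0.
have [n1 h1] := ipL2_cvg hu_ hu hp cu e2.
have hg_ n : isL2 mu (g_ n) by case: (ug n).
have [n2 h2] := ipL2_cvg hg_ hg hq cg e2.
have := h1 (maxn n1 n2) (leq_maxl _ _); have := h2 (maxn n1 n2) (leq_maxr _ _).
have [_ /(wd_def W) /(_ _ _ pq) ->] := ug (maxn n1 n2).
set a := ipL2 _ _ q; set b := ipL2 _ u p; set c := ipL2 _ _ _.
by rewrite !ler_norml => /andP[? ?] /andP[? ?]; apply/andP; split; lra.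
Qed.

Lemma has_sobolev k u (g : I -> T -> R) : L2 u -> (forall i, has i u (g i)) ->
  (forall i, Sob k (g i)) -> Sob k.+1 u.
Proof.
move=> hu ug hg; split=> // i; split; first by exists (g i).
have ui : has i u (D i u) by apply: has_wpartialP; exists (g i).
apply: sobolev_ae (hg i) _ _; first by case: ui.
exact: has_wpartial_unique (ug i) ui.
Qed.

Lemma sobolev_lin k a u v : Sob k u -> Sob k v -> Sob k (fun x => a * u x + v x).
Proof.
elim: k u v => [|k IH] u v hu hv.
  by split=> //; apply: L2_lin; [case: hu|case: hv].
have Lu := sobolev_L2 hu; have Lv := sobolev_L2 hv.
apply: (@has_sobolev _ _ (fun i x => a * D i u x + D i v x)).
- exact: L2_lin.
- move=> i; apply: has_wpartial_lin => //; [exact: sobolev_has hu|exact: sobolev_has hv].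
- by move=> i; apply: IH; exact: sobolev_wpartial.
Qed.

Fixpoint sobolev_ip (k : nat) u v : R :=
  ipL2 mu u v +
  if k is k'.+1 then \sum_(i : I) sobolev_ip k' (D i u) (D i v) else 0.

Lemma sobolev_sqnorm_ge0 k u : 0 <= sqn k u.
Proof.
elim: k u => [|k IH] u /=; rewrite -/(sqnormL2 mu u); first by rewrite addr0 sqnormL2_ge0.
by rewrite addr_ge0 ?sqnormL2_ge0// sumr_ge0.
Qed.

Lemma sobolev_NE k a u v : Sob k u -> Sob k v ->
  sqn k (fun x => a * u x + v x) =
  a ^+ 2 * sqn k u + 2 * a * sobolev_ip k u v + sqn k v.
Proof.
elim: k u v => [|k IH] u v hu hv /=; rewrite -!/(sqnormL2 mu _).
  by rewrite (sqnormL2_lin a (sobolev_L2 hu) (sobolev_L2 hv)); ring.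
rewrite (sqnormL2_lin a (sobolev_L2 hu) (sobolev_L2 hv)).
have -> : \sum_i sqn k (D i (fun x => a * u x + v x)) =
  a ^+ 2 * (\sum_i sqn k (D i u)) + 2 * a * (\sum_i sobolev_ip k (D i u) (D i v)) +
  \sum_i sqn k (D i v).
  rewrite !mulr_sumr -!big_split /=; apply: eq_bigr => i _.
  rewrite -IH; [|exact: sobolev_wpartial|exact: sobolev_wpartial].
  apply: sobolev_sqnorm_ae.
  - exact: wpartial_L2 i (sobolev_lin a hu hv).
  - by apply: L2_lin; [exact: wpartial_L2 hu|exact: wpartial_L2 hv].
  - exact: wpartial_lin hu hv.
ring.
Qed.

Definition isSob k (u : T -> R^o) : Prop := Sob k (u : T -> R).

Lemma isSob_lin k a (u v : T -> R^o) : isSob k u -> isSob k v -> isSob k (a *: u + v).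
Proof. exact: sobolev_lin. Qed.

Lemma isSob_NE k a (u v : T -> R^o) : isSob k u -> isSob k v ->
  sqn k (a *: u + v) = a ^+ 2 * sqn k u + 2 * a * sobolev_ip k u v + sqn k v.
Proof. exact: sobolev_NE. Qed.

(** Polarization recovers the inner product from the squared norm, which is already known to ignore
    null sets. *)
Lemma sobolev_ip_ae k u u' v v' : Sob k u -> Sob k u' -> Sob k v -> Sob k v' ->
  u =ae u' -> v =ae v' -> sobolev_ip k u v = sobolev_ip k u' v'.
Proof.
move=> hu hu' hv hv' uu' vv'.
have L := @sobolev_L2 k.
have := sobolev_NE 1 hu hv; have := sobolev_NE 1 hu' hv'.
have E1 : sqn k u = sqn k u' by apply: sobolev_sqnorm_ae => //; exact: L.
have E2 : sqn k v = sqn k v' by apply: sobolev_sqnorm_ae => //; exact: L.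
have E3 : sqn k (fun x => 1 * u x + v x) = sqn k (fun x => 1 * u' x + v' x).
  apply: sobolev_sqnorm_ae.
  - exact: L2_lin (L _ hu) (L _ hv).
  - exact: L2_lin (L _ hu') (L _ hv').
  - by apply: filterS2 uu' vv' => x -> ->.
by rewrite E3 E1 E2; lra.
Qed.

Lemma sqnormL2_le_sobolev k u : sqnormL2 mu u <= sqn k u.
Proof.
case: k => [|k] /=; rewrite -!/(sqnormL2 mu _) ?addr0// lerDl.
by apply: sumr_ge0 => i _; exact: sobolev_sqnorm_ge0.
Qed.

Lemma sqn_wpartial_le k u i : sqn k (D i u) <= sqn k.+1 u.
Proof.
rewrite /= -!/(sqnormL2 mu _) (bigD1 i)//= addrA addrAC lerDr.
rewrite addr_ge0 ?sqnormL2_ge0//.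
by apply: sumr_ge0 => j _; exact: sobolev_sqnorm_ge0.
Qed.

Lemma sobolev_sqnormW k u : sqn k u <= sqn k.+1 u.
Proof.
elim: k u => [|k IH] u.
  by apply: le_trans (sqnormL2_le_sobolev 1 u); rewrite /= addr0.
change (sqnormL2 mu u + \sum_i sqn k (D i u) <=
        sqnormL2 mu u + \sum_i sqn k.+1 (D i u)).
by rewrite lerD2l; apply: ler_sum => i _; exact: IH.
Qed.

(** Induction on the order: each family of first derivatives is Cauchy one order below, and
    closedness shows that its limit is the derivative of the L^2 limit. *)
Lemma sobolev_complete k (u : nat -> T -> R^o) : (forall n, isSob k (u n)) ->
  cauchy_sq (fun w : T -> R^o => sqn k w) u ->
  exists l : T -> R^o, isSob k l /\ cvg_sq (fun w : T -> R^o => sqn k w) u l.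
Proof.
elim: k u => [|k IH] u hu cu.
  have [l [hl ul]] : exists l : T -> R^o, isL2 mu l /\
      cvg_sq (fun w : T -> R^o => sqnormL2 mu w) u l.
    apply: L2_complete; first exact: (wd_finite W).
      by move=> n; exact: sobolev_L2 (hu n).
    move=> e /cu[n0 h]; exists n0 => n m nn nm.
    by apply: le_trans (h n m nn nm); exact: (sqnormL2_le_sobolev 0).
  exists l; split; first by split.
  move=> e /ul[n0 h]; exists n0 => n /h.
  by rewrite /= -!/(sqnormL2 mu _) addr0.
have L2u n : isL2 mu (u n) by exact: sobolev_L2 (hu n).
have [l [hl ul]] : exists l : T -> R^o, isL2 mu l /\
    cvg_sq (fun w : T -> R^o => sqnormL2 mu w) u l.
  apply: L2_complete => //; first exact: (wd_finite W).
  move=> e /cu[n0 h]; exists n0 => n m nn nm.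
  by apply: le_trans (h n m nn nm); exact: (sqnormL2_le_sobolev k.+1).
have DB i (a b : T -> R^o) : isSob k.+1 a -> isSob k.+1 b ->
    D i (a - b) =ae ((D i a : T -> R^o) - (D i b : T -> R^o)).
  by move=> ha hb; rewrite !fct_subE; have := wpartial_lin i (-1) hb ha; apply: filterS => x ->.
have [g gP] : {g : I -> T -> R^o & forall i, isSob k (g i) /\
    cvg_sq (fun w : T -> R^o => sqn k w) (fun n => (D i (u n) : T -> R^o)) (g i)}.
  apply: (@choice _ _ (fun i (gi : T -> R^o) => isSob k gi /\
    cvg_sq (fun w : T -> R^o => sqn k w) (fun n => (D i (u n) : T -> R^o)) gi)) => i.
  apply: IH; first by move=> n; exact: sobolev_wpartial (hu n).
  move=> e /cu[n0 h]; exists n0 => n m nn nm.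
  apply: le_trans (h n m nn nm); apply: le_trans (sqn_wpartial_le k _ i).
  apply/eq_leW/sobolev_sqnorm_ae.
  - have := isSob_lin (-1) (sobolev_wpartial i (hu m)) (sobolev_wpartial i (hu n)).
    by rewrite scaleN1r addrC => /sobolev_L2.
  - have := isSob_lin (-1) (hu m) (hu n).
    by rewrite scaleN1r addrC => /wpartial_L2; exact.
  - by apply: filterS (DB i _ _ (hu n) (hu m)) => x ->.
have lg i : has i l (g i).
  have [gi ci] := gP i.
  apply: (has_wpartial_closed L2u hl (sobolev_L2 gi) (fun n => sobolev_has i (hu n)) ul).
  move=> e' /ci[n0 h]; exists n0 => n /h; apply: le_trans.
  exact: sqnormL2_le_sobolev.
have hlS : isSob k.+1 l.
  by apply: (@has_sobolev _ _ (fun i => g i : T -> R)) => // i; case: (gP i).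
exists l; split => // e e0.
(* One share for the function itself and one for each of its [#|I|] derivatives. *)
have e1 : 0 < e / (#|I|%:R + 1) by rewrite divr_gt0// ltr_wpDl.
have [n1 h1] := ul _ e1.
have [f fP] : {f : I -> nat & forall i n, (f i <= n)%N ->
    sqn k ((D i (u n) : T -> R^o) - g i) <= e / (#|I|%:R + 1)}.
  apply: (@choice _ _ (fun i n0 => forall n, (n0 <= n)%N ->
    sqn k ((D i (u n) : T -> R^o) - g i) <= e / (#|I|%:R + 1))) => i.
  by have [_ ci] := gP i; exact: ci.
exists (maxn n1 (\max_i f i)) => n; rewrite geq_max => /andP[nn1 nf].
change (sqnormL2 mu (u n - l) + \sum_i sqn k (D i (u n - l)) <= e).
apply: (@le_trans _ _ (e / (#|I|%:R + 1) + \sum_(i : I) (e / (#|I|%:R + 1)))).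
  apply: lerD; first exact: h1.
  apply: ler_sum => i _; apply: le_trans (fP i n (leq_trans (leq_bigmax i) nf)).
  have [gi _] := gP i.
  apply/eq_leW/sobolev_sqnorm_ae.
  - have := isSob_lin (-1) hlS (hu n).
    by rewrite scaleN1r addrC => /wpartial_L2; exact.
  - have := isSob_lin (-1) gi (sobolev_wpartial i (hu n)).
    by rewrite scaleN1r addrC => /sobolev_L2.
  - apply: filterS2 (DB i _ _ (hu n) hlS) (wpartial_unique (lg i)) => x -> E.
    by rewrite !fctE E.
rewrite sumr_const; set X := e / _.
rewrite (_ : X + X *+ _ = X * (#|I|%:R + 1)); last first.
  by rewrite mulrDr mulr1 mulr_natr addrC.
by rewrite divfK// gt_eqF// ltr_wpDl.
Qed.

End SobolevTheory.
Arguments sobolev_ip {disp T R} mu {I} wd.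
Arguments isSob {disp T R} mu {I} wd.

(** * Lebesgue measure on the torus *)

Section TorusMeasureTheory.
Variables (R : realType) (d : nat).
Local Notation mu := (torus_measure R d).
Local Notation U := (uniform_prob (@ltr01 R)).

Lemma measurable_row_coor (i : 'I_d) :
  measurable_fun [set: 'rV[R]_d] (fun x : 'rV[R]_d => x ord0 i).
Proof.
move=> _ Y mY; rewrite setTI; apply: sub_sigma_algebra => /=.
rewrite -bigcup_seq/=; exists i => /=; first by rewrite mem_index_enum.
by exists Y => //; rewrite setTI.
Qed.

Lemma measurable_fun_row disp (T : measurableType disp) (f : T -> 'rV[R]_d) :
  (forall i, measurable_fun setT (fun t => f t ord0 i)) -> measurable_fun setT f.
Proof.
move=> mf.
have E := @g_sigma_preimage_comp _ R d _ (fun i (x : 'rV[R]_d) => x ord0 i) _ f.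
have sub : g_sigma_preimage (fun i => (fun x : 'rV[R]_d => x ord0 i) \o f)
    `<=` measurable.
  apply: smallest_sub; first exact: sigma_algebra_measurable.
  move=> A; rewrite -bigcup_seq/= => -[i _ [B mB <-]].
  exact: mf.
by move=> _ A mA; apply: sub; rewrite E; exists A.
Qed.

Definition row_box (A : 'I_d -> set R) : set 'rV[R]_d :=
  [set x | forall i, A i (x ord0 i)].

Lemma measurable_row_box A : (forall i, measurable (A i)) -> measurable (row_box A).
Proof.
move=> mA; have -> : row_box A = \bigcap_(i in setT) ((fun x : 'rV[R]_d => x ord0 i) @^-1` A i).
  by apply/seteqP; split=> x /= h i; [move=> _; exact: h|exact: (h i I)].
apply: fin_bigcap_measurable => // i _.
by rewrite -[X in measurable X]setTI; exact: measurable_row_coor.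
Qed.

Lemma cube_prob_box n (A : 'I_n -> set R) : (forall i, measurable (A i)) ->
  cube_prob R n [set t | forall i, A i (tnth t i)] = (\prod_(i < n) U (A i))%E.
Proof.
elim: n A => [|n IH] A mA.
  rewrite big_ord0 (_ : [set t | _] = setT) ?probability_setT//.
  by apply/seteqP; split => // t _ [].
rewrite big_ord_recl -(IH (fun i => A (lift ord0 i)))//.
have mB : measurable [set t : n.-tuple R | forall i, A (lift ord0 i) (tnth t i)].
  rewrite (_ : [set t | _] = \bigcap_(i in [set: 'I_n])
      ((fun t : n.-tuple R => tnth t i) @^-1` A (lift ord0 i))); last first.
    by apply/seteqP; split=> x /= h i; [move=> _; exact: h|exact: (h i I)].
  apply: fin_bigcap_measurable => // i _.
  by rewrite -[X in measurable X]setTI; exact: measurable_tnth.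
transitivity ((U \x cube_prob R n)%E (@Defs.cons_tuple R n @^-1` [set t | forall i, A i (tnth t i)])).
  by [].
rewrite (_ : _ @^-1` _ = A ord0 `*` [set t : n.-tuple R | forall i, A (lift ord0 i) (tnth t i)]).
  by apply: product_measure1E => //; exact: mA.
apply/seteqP; split => [[a t]|[a t]] /=.
  move=> h; split; first by have := h ord0; rewrite tnth0.
  by move=> i; have := h (lift ord0 i); rewrite tnthS.
move=> [h0 h] i; have [j ->|->] := unliftP ord0 i; last by rewrite tnth0.
by rewrite tnthS; exact: h.
Qed.

Lemma torus_measure_box A : (forall i, measurable (A i)) ->
  mu (row_box A) = (\prod_(i < d) U (A i))%E.
Proof.
move=> mA; rewrite -cube_prob_box// /torus_measure /distribution /pushforward.
congr (cube_prob R d _); apply/seteqP; split => t /= h i; have := h i.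
  by rewrite mxE.
by rewrite /= mxE.
Qed.

Definition row_upd (i : 'I_d) (p : measurableTypeR R * 'rV[R]_d) : 'rV[R]_d :=
  p.2 + (p.1 - p.2 ord0 i) *: delta_mx 0 i.

Lemma row_updE i s x j :
  row_upd i (s, x) ord0 j = if j == i then s else x ord0 j.
Proof.
rewrite /row_upd !mxE eqxx /=; have [->|ji] := eqVneq j i.
  by rewrite mulr1 subrKC.
by rewrite mulr0 addr0.
Qed.

Lemma measurable_row_upd i : measurable_fun setT (row_upd i).
Proof.
apply: measurable_fun_row => j.
rewrite (_ : (fun t => _) = fun p : measurableTypeR R * 'rV[R]_d =>
    if j == i then p.1 else p.2 ord0 j); last first.
  by apply/funext => -[s x]; rewrite row_updE.
case: eqP => _; first exact: measurable_fst.
exact: measurableT_comp (measurable_row_coor j) measurable_snd.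
Qed.

HB.instance Definition _ (i : 'I_d) :=
  @isMeasurableFun.Build _ _ _ _ (row_upd i) (@measurable_row_upd i).

(** Redrawing one coordinate independently and uniformly preserves the measure of boxes, and boxes
    form a generating pi-system. With Tonelli this isolates integration in the variable [i], and so
    takes the place of an iterated integral over the cell. *)
Lemma torus_measure_resample i (A : set 'rV[R]_d) : measurable A ->
  distribution (U \x mu)%E (row_upd i) A = mu A.
Proof.
move=> mA.
pose G := [set row_box B | B in [set B | forall i, measurable (B i)]].
have GT : G setT.
  by exists (fun=> setT) => [j /=|]; [exact: measurableT|apply/seteqP; split].
apply: (@g_sigma_algebra_measure_unique _ R _ G _ (fun=> setT)).
- by move=> _ [B mB <-]; exact: measurable_row_box.
- by [].
- by rewrite bigcup_const.
- move=> _ _ [B mB <-] [C mC <-]; exists (fun i => B i `&` C i).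
    by move=> j /=; exact: measurableI.
  by apply/seteqP; split => [x h|x [h1 h2] j] /=; [split => j; case: (h j)|split].
- move=> _ [B mB <-]; rewrite [RHS](torus_measure_box mB).
  transitivity ((U \x mu)%E (row_upd i @^-1` row_box B)); first by [].
  have -> : row_upd i @^-1` row_box B =
      B i `*` row_box (fun j => if j == i then setT else B j).
    apply/seteqP; split => [[s x] /= h|[s x] [/= hs h] j].
      split; first by have := h i; rewrite row_updE eqxx.
      by move=> j; have := h j; rewrite row_updE; case: eqP.
    by rewrite row_updE; have := h j; case: eqP => [->|].
  have mB' j : measurable (if j == i then setT else B j) by case: eqP.
  rewrite product_measure1E; [|exact: (mB i)|exact: measurable_row_box].
  rewrite (bigD1 i)//=; congr (_ * _)%E; apply: eq_trans (torus_measure_box mB') _.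
  rewrite (bigD1 i)//= eqxx (_ : U setT = 1%E) ?mul1e; last exact: probability_setT.
  by apply: eq_bigr => j /negbTE ->.
- by move=> k; apply: fin_num_fun_lty; exact: fin_num_measure.
- move: mA; apply: sub_smallest2r => [|C].
    exact: smallest_sigma_algebra.
  rewrite -bigcup_seq/= => -[j _ [B mB <-]].
  exists (fun k => if k == j then B else setT).
    by move=> k /=; case: eqP.
  apply/seteqP; split => x /=; first by move=> /(_ j); rewrite eqxx.
  by move=> [_ Bx] k; case: eqP => // ->.
Qed.

Lemma torus_resample_ge0 i (F : 'rV[R]_d -> \bar R) : measurable_fun setT F ->
  (forall x, 0 <= F x)%E ->
  (\int[mu]_x F x =
   \int[mu]_x \int[lebesgue_measure]_(s in `[0%R, 1%R]) F (row_upd i (s, x)))%E.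
Proof.
move=> mF F0.
rewrite (eq_measure_integral (distribution (U \x mu)%E (row_upd i))); last first.
  by move=> A mA _; exact/esym/torus_measure_resample.
have mFu : measurable_fun setT (F \o row_upd i).
  by apply: measurableT_comp => //; exact: measurable_row_upd.
rewrite ge0_integral_distribution//.
rewrite fubini_tonelli2; [|exact: mFu|by move=> p; exact: F0].
apply: eq_integral => x _; rewrite /fubini_G integral_uniform//=.
- by rewrite subr0 invr1 mul1e.
- by apply: (measurableT_comp mFu); exact: pair2_measurable.
Qed.

Lemma torus_measure_hyperplane i (c : R) :
  mu ((fun x : 'rV[R]_d => x ord0 i) @^-1` [set c]) = 0%E.
Proof.
have -> : (fun x : 'rV[R]_d => x ord0 i) @^-1` [set c] =
    row_box (fun j => if j == i then [set c] else setT).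
  apply/seteqP; split => x /=; first by move=> <- j; case: eqP => // ->.
  by move=> /(_ i); rewrite eqxx.
rewrite torus_measure_box; last by move=> j; case: eqP.
rewrite (bigD1 i)//= eqxx.
have -> : U [set c] = 0%E.
  rewrite /uniform_prob integral_uniform_pdf.
  have/null_set_integral -> // : lebesgue_measure ([set c] `&` `[0%R, 1%R]) = 0%E :> \bar R.
    apply/eqP; rewrite eq_le measure_ge0 andbT.
    rewrite -(lebesgue_measure_set1 c); apply: le_measure; rewrite ?inE//.
    exact: measurableI.
  - exact: measurableI.
  - apply: measurable_funTS; apply/measurable_EFinP; exact: measurable_uniform_pdf.
by rewrite mul0e.
Qed.

Lemma torus_measure_cell : \forall x \ae mu, forall i : 'I_d, 0 < (x : 'rV[R]_d) ord0 i < 1.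
Proof.
have cl : mu (~` row_box (fun=> `[0, 1]%classic)) = 0%E.
  rewrite probability_setC; last exact: measurable_row_box.
  rewrite torus_measure_box// big1 ?subee// => i _.
  by rewrite /uniform_prob integral_uniform_pdf1.
have h1 : \forall x \ae mu, row_box (fun=> `[0, 1]%classic) x.
  by exists (~` row_box (fun=> `[0, 1]%classic)); split => //; apply: measurableC; exact: measurable_row_box.
have hc c i : \forall x \ae mu, (x : 'rV[R]_d) ord0 i <> c.
  exists ((fun x : 'rV[R]_d => x ord0 i) @^-1` [set c]); split.
  - rewrite -[X in measurable X]setTI.
    exact: (measurable_row_coor i measurableT (measurable_set1 c)).
  - exact: torus_measure_hyperplane.
  - by move=> x /=; apply: contrapT.
have hall c : \forall x \ae mu, forall i, (x : 'rV[R]_d) ord0 i <> c.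
  exact: filter_forall.
apply: filterS3 h1 (hall 0) (hall 1) => x h h0' h1' i.
have := h i; rewrite /= in_itv/= => /andP[x0 x1].
rewrite !lt_neqAle x0 x1 !andbT; apply/andP; split; apply/eqP.
  by move=> e; exact: (h0' i).
exact: h1'.
Qed.

Lemma torus_measure_fin : (mu setT < +oo)%E.
Proof. by rewrite probability_setT ltry. Qed.

Lemma torus_bounded_integrable (G : 'rV[R]_d -> R) c : measurable_fun setT G ->
  (forall x, `|G x| <= c) -> mu.-integrable setT (EFin \o G).
Proof.
by move=> mG Gc; apply: (L2_integrable torus_measure_fin); exact: (L2_bounded torus_measure_fin mG Gc).
Qed.

Lemma torus_integral_cst (c : R) : (\int[mu]_x c%:E = c%:E)%E.
Proof.
rewrite integral_cst//; transitivity (c%:E * 1)%E; last by rewrite mule1.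
by congr (_ * _)%E; exact: probability_setT.
Qed.

(** Adding the bound [c] makes the integrand nonnegative, so that the resampling formula for
    nonnegative functions applies; the constant is subtracted afterwards. *)
Lemma torus_resample_eq0 i (G : 'rV[R]_d -> R) c : measurable_fun setT G ->
  (forall x, `|G x| <= c) ->
  (forall x, (\int[lebesgue_measure]_(s in `[0%R, 1%R]) (G (row_upd i (s, x)))%:E = 0)%E) ->
  \int[mu]_x G x = 0.
Proof.
move=> mG Gc G0.
have iG := torus_bounded_integrable mG Gc.
have ic : mu.-integrable setT (EFin \o (fun=> c)).
  by apply: (@torus_bounded_integrable _ `|c|).
have c0 x : 0 <= G x + c by have := Gc x; rewrite ler_norml; lra.
have mGu x : measurable_fun setT (fun s => G (row_upd i (s, x))).
  apply: (measurableT_comp mG); apply: (measurableT_comp (measurable_row_upd i)).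
  exact: pair2_measurable.
have E : (\int[mu]_x (G x + c)%:E = c%:E)%E.
  rewrite (torus_resample_ge0 i); last 2 first.
  - by apply/measurable_EFinP; exact: measurable_funD.
  - by move=> x; rewrite lee_fin.
  rewrite (eq_integral (fun=> c%:E)).
    exact: torus_integral_cst.
  move=> x _; under eq_integral do rewrite EFinD.
  rewrite integralD//=.
  - by rewrite G0 add0e integral_cst//= lebesgue_measure_itv/= lte_fin ltr01 oppr0 adde0 mule1.
  - apply: measurable_bounded_integrable => //.
    + by rewrite /= lebesgue_measure_itv/= lte_fin ltr01 -EFinB ltry.
    + exact: measurable_funTS (mGu x).
    + exists c; split; rewrite ?num_real// => M cM s _ /=.
      exact: le_trans (Gc _) (ltW cM).
  - apply: measurable_bounded_integrable => //.
    + by rewrite /= lebesgue_measure_itv/= lte_fin ltr01 -EFinB ltry.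
    + exact: bounded_cst.
have iE : (\int[mu]_x (G x + c)%:E = \int[mu]_x (G x)%:E + c%:E)%E.
  under eq_integral do rewrite EFinD.
  rewrite integralD//=; congr (_ + _)%E.
  exact: torus_integral_cst.
move: E; rewrite iE /Rintegral.
have : (\int[mu]_x (G x)%:E)%E \is a fin_num by exact: integrable_fin_num iG.
by case: (\int[mu]_x (G x)%:E)%E => // r _ /= [] => E; lra.
Qed.

End TorusMeasureTheory.

Lemma dominated_cvg_Rintegral d (T : measurableType d) (R : realType)
    (mu : {measure set T -> \bar R}) (f_ : nat -> T -> R) (f h : T -> R) :
  (forall n, measurable_fun setT (f_ n)) -> measurable_fun setT f ->
  mu.-integrable setT (EFin \o h) -> (forall n x, `|f_ n x| <= h x) ->
  (\forall x \ae mu, (fun n => f_ n x) @ \oo --> (f x : R)) ->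
  (fun n => \int[mu]_x f_ n x) @ \oo --> \int[mu]_x f x.
Proof.
move=> mf_ mf ih fh cf.
have [|||||i_f _ cv] := @dominated_convergence _ _ _ mu setT measurableT
  (fun n x => (f_ n x)%:E) (fun x => (f x)%:E) (EFin \o h).
- by move=> n; apply/measurable_EFinP.
- exact/measurable_EFinP.
- by apply: filterS cf => x cx _; apply: cvg_EFin; [exact: nearW|exact: cx].
- exact: ih.
- by apply: aeW => x n _ /=; rewrite lee_fin.
rewrite /Rintegral; apply: fine_cvg.
by rewrite fineK//; exact: integrable_fin_num i_f.
Qed.

(** * A monotone-class theorem for functions orthogonal to an algebra of tests *)

Section Separation.
Context {disp : measure_display} {T : measurableType disp} {R : realType}.
Variable mu : {measure set T -> \bar R}.
Variables (g : T -> R) (tests mult : (T -> R) -> Prop) (G : set (set T)).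
Hypothesis ig : mu.-integrable setT (EFin \o g).
Hypothesis tests_bounded : forall t, tests t ->
  measurable_fun setT t /\ exists c : R, forall x, `|t x| <= c.
Hypothesis mult_bounded : forall q, mult q ->
  measurable_fun setT q /\ exists c : R, forall x, `|q x| <= c.
Hypothesis tests_mult : forall q t, mult q -> tests t -> tests (fun x => q x * t x).
Hypothesis G_measurable : G `<=` measurable.
Hypothesis G_generates : (@measurable _ T) `<=` <<s G >>.
Hypothesis G_approx : forall A, G A -> exists (q : nat -> T -> R) (c : R),
  [/\ forall n, mult (q n), forall n x, `|q n x| <= c &
      \forall x \ae mu, (fun n => q n x) @ \oo --> (\1_A x : R)].
Hypothesis g_tests : forall t, tests t -> \int[mu]_x (g x * t x) = 0.

Definition annihilates (h : T -> R) : Prop :=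
  [/\ measurable_fun setT h, (exists c : R, forall x, `|h x| <= c) &
      forall t, tests t -> \int[mu]_x (g x * (h x * t x)) = 0].

Let mg : measurable_fun setT g.
Proof. by have [/measurable_EFinP] := integrableP _ _ _ ig. Qed.

Lemma annihilates_lim (h : T -> R) (h_ : nat -> T -> R) (c c' : R) :
  measurable_fun setT h -> (forall x, `|h x| <= c') ->
  (forall n, annihilates (h_ n)) -> (forall n x, `|h_ n x| <= c) ->
  (\forall x \ae mu, (fun n => h_ n x) @ \oo --> (h x : R)) -> annihilates h.
Proof.
move=> mh bh ah hc cvh; split=> //; first by exists c'.
move=> t ht; have [mt [ct tc]] := tests_bounded ht.
have E : (fun n => \int[mu]_x (g x * (h_ n x * t x))) = (fun=> 0).
  by apply/funext => n; have [_ _ ->] := ah n.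
apply/esym; apply: (@cvg_unique _ _ ((fun=> 0 : R) @ \oo)) => //.
  exact: cvg_cst.
rewrite -E; apply: (@dominated_cvg_Rintegral _ _ _ _ _ _ (fun x => `|g x| * (c * ct))).
- move=> n; have [mhn _ _] := ah n.
  by apply: measurable_funM => //; exact: measurable_funM.
- by apply: measurable_funM => //; exact: measurable_funM.
- have := integrableZr measurableT (c * ct) (integrable_norm ig).
  by apply: eq_integrable.
- by move=> n x; rewrite !normrM ler_wpM2l//; apply: ler_pM.
- apply: filterS cvh => x cx.
  apply: cvgM; first exact: cvg_cst.
  by apply: cvgM; [exact: cx|exact: cvg_cst].
Qed.

Lemma annihilates_integrable h t : annihilates h -> tests t ->
  mu.-integrable setT (EFin \o (fun x => g x * (h x * t x))).
Proof.
move=> [mh [c hc] _] /tests_bounded[mt [ct tc]].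
have := @integrable_bounded_mul _ _ _ mu (c * ct) (fun x => h x * t x) g _ _ ig.
have -> : (fun x => h x * t x * g x) = (fun x => g x * (h x * t x)).
  by apply/funext => x; rewrite mulrC.
apply; first exact: measurable_funM.
by move=> x; rewrite normrM; apply: ler_pM.
Qed.

Lemma annihilates_mult q h : mult q -> annihilates h -> annihilates (fun x => q x * h x).
Proof.
move=> hq [mh [c hc] h0]; have [mq [cq qc]] := mult_bounded hq; split.
- exact: measurable_funM.
- by exists (cq * c) => x; rewrite normrM; apply: ler_pM.
- move=> t ht; rewrite -[RHS](h0 _ (tests_mult hq ht)).
  by apply: eq_Rintegral => x _; ring.
Qed.

Lemma annihilates_sub h h' : annihilates h -> annihilates h' ->
  annihilates (fun x => h x - h' x).
Proof.
move=> ah ah'; have [mh [c hc] h0] := ah; have [mh' [c' hc'] h0'] := ah'; split.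
- exact: measurable_funB.
- by exists (c + c') => x; apply: le_trans (ler_normB _ _) _; apply: lerD.
- move=> t ht.
  have := Rintegral_lin (-1) (annihilates_integrable ah' ht) (annihilates_integrable ah ht).
  rewrite h0// h0'// mulr0 addr0 => <-.
  by apply: eq_Rintegral => x _; ring.
Qed.

(** Asking that [\1_A] preserve all annihilating functions, and not merely that it be one, makes the
    property stable under intersection and therefore under the operations of a sigma-algebra. *)
Definition localizing (A : set T) : Prop :=
  measurable A /\ forall h, annihilates h -> annihilates (fun x => \1_A x * h x).

Lemma annihilates_indic_measurable A (h : T -> R) : measurable A ->
  measurable_fun setT h -> measurable_fun setT (fun x => \1_A x * h x).
Proof. by move=> mA mh; apply: measurable_funM. Qed.

Lemma indic_mul_le A (h : T -> R) c x : (forall x, `|h x| <= c) -> `|\1_A x * h x| <= c.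
Proof.
move=> hc; rewrite indicE; case: (x \in A); rewrite ?mul1r//.
by rewrite mul0r normr0; exact: le_trans (hc x).
Qed.

Lemma localizing_setC A : localizing A -> localizing (~` A).
Proof.
move=> [mA hA]; split; first exact: measurableC.
move=> h ah; have := annihilates_sub ah (hA h ah).
congr annihilates; apply/funext => x; rewrite !indicE in_setC.
by case: (x \in A); rewrite /= ?mul1r ?mul0r ?subrr ?subr0.
Qed.

Lemma localizing_setI A B : localizing A -> localizing B -> localizing (A `&` B).
Proof.
move=> [mA hA] [mB hB]; split; first exact: measurableI.
move=> h ah; have := hA _ (hB h ah).
congr annihilates; apply/funext => x; rewrite !indicE in_setI.
by case: (x \in A); rewrite /= ?mul1r ?mul0r.
Qed.

Lemma localizing_setU A B : localizing A -> localizing B -> localizing (A `|` B).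
Proof.
move=> hA hB; rewrite -[_ `|` _]setCK setCU.
by apply/localizing_setC/localizing_setI; exact: localizing_setC.
Qed.

Lemma localizing_bigcup (F : (set T)^nat) : (forall n, localizing (F n)) ->
  localizing (\bigcup_n F n).
Proof.
move=> hF.
have l0 : localizing set0.
  have : localizing (F 0%N `&` ~` F 0%N).
    by apply: localizing_setI => //; exact: localizing_setC.
  by rewrite setICr.
pose E n := \big[setU/set0]_(i < n) F i.
have hE n : localizing (E n).
  rewrite /E; elim: n => [|n IH]; first by rewrite big_ord0.
  by rewrite big_ord_recr /=; exact: localizing_setU.
have mF : measurable (\bigcup_n F n).
  by apply: bigcupT_measurable => n; case: (hF n).
split=> // h ah; have [mh [c hc] _] := ah.
apply: (@annihilates_lim _ (fun n x => \1_(E n) x * h x) c c).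
- exact: annihilates_indic_measurable.
- by move=> x; exact: indic_mul_le.
- by move=> n; have [_] := hE n; apply.
- by move=> n x; exact: indic_mul_le.
- apply: aeW => x.
  have [Fx|Fx] := boolP (x \in \bigcup_n F n).
    move: (Fx); rewrite inE => -[m _ Fmx].
    apply: cvg_near_cst; exists m.+1 => // n /= mn.
    rewrite !indicE Fx mem_set// /E -bigcup_mkord.
    by exists m.
  apply: cvg_near_cst; apply: nearW => n.
  rewrite !indicE (negbTE Fx) (_ : x \in E n = false)//.
  apply/negP; rewrite inE /E -bigcup_mkord => -[m /= _ Fmx].
  by move/negP: Fx; apply; rewrite inE; exists m.
Qed.

Lemma localizing_measurable A : measurable A -> localizing A.
Proof.
move=> /G_generates; apply: smallest_sub; last first.
  move=> B GB; have mB : measurable B.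
    exact: G_measurable.
  split=> // h ah; have [mh [c hc] _] := ah.
  have [q [cq [mq qc cvq]]] := G_approx GB.
  apply: (@annihilates_lim _ (fun n x => q n x * h x) (cq * c) c).
  - exact: annihilates_indic_measurable.
  - by move=> x; exact: indic_mul_le.
  - by move=> n; exact: annihilates_mult.
  - by move=> n x; rewrite normrM; apply: ler_pM.
  - by apply: filterS cvq => x cx; apply: cvgM; [exact: cx|exact: cvg_cst].
split.
- split=> // h ah.
  have ->: (fun x => \1_set0 x * h x) = (fun x => h x - h x).
    by apply/funext => x; rewrite indicE in_set0 mul0r subrr.
  exact: annihilates_sub.
- by move=> B hB; rewrite setTD; exact: localizing_setC.
- exact: localizing_bigcup.
Qed.

(** The constant 1 annihilates, hence so does the indicator of every measurable set, and [g * t] has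
    zero integral over each of them. Tests and multipliers are kept apart since on an interval the
    tests have compact support while the multipliers approximating a half-line do not. *)
Lemma separation t : tests t -> \forall x \ae mu, g x * t x = 0.
Proof.
move=> ht; have a1 : annihilates (fun=> 1).
  split; first exact: measurable_cst.
    by exists 1 => x; rewrite normr1.
  move=> t' ht'; rewrite -[RHS](g_tests ht').
  by apply: eq_Rintegral => x _; rewrite mul1r.
have igt : mu.-integrable setT (EFin \o (fun x => g x * t x)).
  have := annihilates_integrable a1 ht.
  by apply: eq_integrable => // x _ /=; rewrite mul1r.
have : ae_eq mu setT (EFin \o (fun x => g x * t x)) (cst 0%E).
  apply: integral_ae_eq => //.
  move=> E _ mE; rewrite integral_cst// mul0e.
  have [_ /(_ _ a1)[_ _ /(_ t ht) h0]] := localizing_measurable mE.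
  rewrite integral_mkcond.
  have iE : mu.-integrable setT (EFin \o (fun x => \1_E x * (g x * t x))).
    apply: (@integrable_bounded_mul _ _ _ mu 1) => //.
    by move=> x; rewrite indicE; case: (x \in E); rewrite ?normr1 ?normr0.
  transitivity (\int[mu]_x (\1_E x * (g x * t x))%:E)%E.
    apply: eq_integral => x _; rewrite patchE indicE.
    by case: ifPn => _; rewrite ?mul1r ?mul0r.
  rewrite -[LHS]fineK; last exact: integrable_fin_num iE.
  congr EFin; rewrite -[RHS]h0; apply: eq_Rintegral => x _.
  by rewrite mulr1; ring.
by apply: filterS => x /(_ I) /= [].
Qed.

End Separation.

Lemma FTC_everywhere (R : realType) (F f : R -> R) (a b : R) : a < b ->
  (forall x : R, is_derive x (1 : R) F (f x)) -> continuous f ->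
  (\int[lebesgue_measure]_(x in `[a, b]) (f x)%:E = (F b)%:E - (F a)%:E)%E.
Proof.
move=> ab dF cf; apply: continuous_FTC2 => //.
- exact: continuous_subspaceT.
- have cF : continuous F.
    move=> x; apply: differentiable_continuous; apply/derivable1_diffP.
    by have := dF x; exact: @ex_derive.
  split.
  + by move=> x _; have := dF x; exact: @ex_derive.
  + by apply: cvg_at_right_filter; exact: cF.
  + by apply: cvg_at_left_filter; exact: cF.
- by move=> x _; rewrite derive1E; have := dF x; exact: @derive_val.
Qed.

Lemma near_natSinv_le (R : realType) (e : R) : 0 < e ->
  \forall n \near \oo, n.+1%:R^-1 <= e.
Proof.
move=> e0; exists (Num.truncn e^-1) => // n /= hn.
rewrite invf_ple ?posrE//; apply: le_trans (ltW (truncnS_gt _)) _.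
by rewrite ler_nat ltnS.
Qed.

Section DirectionalDerivative.
Context {R : realType} {d : nat}.
Implicit Types (u : 'rV[R]_d -> R) (x v : 'rV[R]_d).

(** The two difference quotients coincide as functions of [h], so directional derivatives reduce to
    one real variable without any differentiability assumption. *)
Lemma line_quotient u x v t :
  (fun h : R => h^-1 *: (u (h *: v + (t *: v + x)) - u (t *: v + x))) =
  (fun h : R => h^-1 *: ((fun s => u (s *: v + x)) (h *: (1 : R) + t) - u (t *: v + x))).
Proof. by apply/funext => h; rewrite /= addrA -scalerDl /GRing.scale /= mulr1. Qed.

Lemma derivable_line u x v t :
  derivable u (t *: v + x) v <-> derivable (fun s : R => u (s *: v + x)) t 1.
Proof. by rewrite /derivable (line_quotient u x v t). Qed.

Lemma derive_line u x v t :
  'D_v u (t *: v + x) = 'D_1 (fun s : R => u (s *: v + x)) t.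
Proof. by rewrite /derive (line_quotient u x v t). Qed.

Lemma is_derive_line u x v (f : R) :
  is_derive (0 : R) (1 : R) (fun s : R => u (s *: v + x)) f -> is_derive x v u f.
Proof.
move=> h; have E : x = 0 *: v + x by rewrite scale0r add0r.
rewrite E; apply: DeriveDef.
  by apply/derivable_line; exact: @ex_derive.
by rewrite derive_line; exact: @derive_val.
Qed.

End DirectionalDerivative.

(** * Test functions and trigonometric polynomials on the torus *)

Section PeriodicFunctions.
Context {R : realType} {d : nat}.
Local Notation mu := (torus_measure R d).
Implicit Types (u v : 'rV[R]_d -> R) (x : 'rV[R]_d).

Lemma cvg_rowP (x_ : nat -> 'rV[R]_d) x :
  (forall i, (fun n => x_ n ord0 i) @ \oo --> (x ord0 i : R)) -> x_ @ \oo --> x.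
Proof.
move=> h; apply/cvg_ballP => e e0.
have : \forall n \near \oo, forall i, ball (x ord0 i) e (x_ n ord0 i).
  by apply: filter_forall => i; have /cvg_ballP := h i; apply.
by apply: filterS => n hn; split => // i j; rewrite ord1.
Qed.

(** The sigma-algebra is generated by the coordinates rather than by open sets. A continuous
    function is the pointwise limit of its samples on grids of mesh 1/(n+1), each of which is
    constant on countably many half-open boxes. *)
Lemma measurable_continuous_row u : continuous u -> measurable_fun setT u.
Proof.
move=> cu.
pose grid n (k : 'rV[int]_d) : 'rV[R]_d := \row_j ((k ord0 j)%:~R / n.+1%:R).
pose idx n x : 'rV[int]_d := \row_j Num.floor (n.+1%:R * x ord0 j).
apply: (@measurable_fun_cvg _ _ _ _ (fun n x => u (grid n (idx n x)))).
  move=> n _ B mB; rewrite setTI.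
  rewrite (_ : _ @^-1` B = \bigcup_(k in [set: 'rV[int]_d])
      (idx n @^-1` [set k] `&` [set _ | B (u (grid n k))])); last first.
    apply/seteqP; split => x /=; first by move=> h; exists (idx n x).
    by move=> [k _ [/= <-]].
  apply: countable_bigcupT_measurable => // k.
  apply: measurableI; last first.
    have [h|h] := pselect (B (u (grid n k))).
      by rewrite (_ : [set _ | _] = setT)//; apply/seteqP; split.
    by rewrite (_ : [set _ | _] = set0)//; apply/seteqP; split.
  rewrite (_ : _ @^-1` _ = row_box (fun j =>
      `[(k ord0 j)%:~R / n.+1%:R, (k ord0 j + 1)%:~R / n.+1%:R[%classic)).
    by apply: measurable_row_box => j; exact: measurable_itv.
  apply/seteqP; split => x /=.
    move=> <- j; rewrite /= in_itv/= /idx mxE.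
    have /andP[h1 h2] := real_floor_itv (num_real (n.+1%:R * x ord0 j)).
    by rewrite ler_pdivrMr// ltr_pdivlMr// [x ord0 j * _]mulrC h1 h2.
  move=> h; apply/rowP => j; rewrite mxE; have := h j; rewrite /= in_itv/=.
  rewrite ler_pdivrMr// ltr_pdivlMr// [x ord0 j * _]mulrC => /andP[h1 h2].
  by apply/eqP; rewrite real_floor_eq ?num_real// h1 h2.
move=> x _; apply: (@cvg_comp _ _ _ (fun n => grid n (idx n x)) u _ (nbhs x)); last exact: cu.
apply: cvg_rowP => i; rewrite /grid /idx.
apply/cvgrPdist_le => e e0; near=> n; rewrite !mxE.
have /andP[h1 h2] := real_floor_itv (num_real (n.+1%:R * x ord0 i)).
set k := Num.floor _ in h1 h2 *.
have n0 : 0 < n.+1%:R :> R by [].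
have ne : n.+1%:R^-1 <= e by near: n; exact: near_natSinv_le.
have := h2; rewrite intrD => {}h2.
rewrite (_ : x ord0 i - _ = (n.+1%:R * x ord0 i - k%:~R) / n.+1%:R); last first.
  by rewrite mulrBl mulrAC divff ?gt_eqF// mul1r.
rewrite normrM [X in _ * X]ger0_norm ?invr_ge0// ger0_norm ?subr_ge0//.
apply: le_trans ne; rewrite ler_pdivrMr// mulVf ?gt_eqF//; lra.
Unshelve. all: by end_near. Qed.

Lemma torus_periodic_int u (k : 'rV[int]_d) x : torus_periodic u ->
  u (x + map_mx intr k) = u x.
Proof.
move=> pu.
have nat_shift i (n : nat) y : u (y + n%:R *: delta_mx 0 i) = u y.
  elim: n y => [|n IH] y; first by rewrite scale0r addr0.
  by rewrite -natr1 scalerDl scale1r addrA pu IH.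
have int_shift i (n : int) y : u (y + n%:~R *: delta_mx 0 i) = u y.
  case: n => n; first exact: nat_shift.
  rewrite NegzE mulrNz scaleNr -[LHS](nat_shift i n.+1).
  by rewrite subrK.
have -> : map_mx intr k = \sum_(i < d) (k ord0 i)%:~R *: delta_mx 0 i :> 'rV[R]_d.
  rewrite [LHS]row_sum_delta; apply: eq_bigr => i _.
  by rewrite mxE.
suff : forall s : seq 'I_d, u (x + \sum_(i <- s) (k ord0 i)%:~R *: delta_mx 0 i) = u x.
  exact.
elim=> [|i s IH]; first by rewrite big_nil addr0.
by rewrite big_cons addrCA addrC int_shift.
Qed.

Lemma torus_periodic_cell u x : torus_periodic u ->
  exists2 y : 'rV[R]_d, (forall i, 0 <= y ord0 i <= 1) & u x = u y.
Proof.
move=> pu; pose k : 'rV[int]_d := \row_j - Num.floor (x ord0 j).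
exists (x + map_mx intr k); last by rewrite torus_periodic_int.
move=> i; rewrite !mxE mulrNz.
have /andP[h1 h2] := real_floor_itv (num_real (x ord0 i)).
by move: h2; rewrite intrD subr_ge0 h1 => h2 /=; lra.
Qed.

Lemma torus_bounded u : torus_periodic u -> continuous u ->
  exists c : R, forall x, `|u x| <= c.
Proof.
move=> pu cu; pose K := [set v : 'rV[R]_d | forall i, `[0, 1]%classic (v ord0 i)].
have cK : compact K by apply: (@rV_compact R d (fun=> `[0, 1]%classic)) => i; exact: segment_compact.
have : bounded_set (u @` K).
  by apply: compact_bounded; apply: continuous_compact => //; exact: continuous_subspaceT.
move=> [M [_ hM]]; exists (M + 1) => x.
have [y hy ->] := torus_periodic_cell x pu.
apply: (hM (M + 1)); first by rewrite ltrDl.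
by exists y => // i; rewrite /= in_itv/=.
Qed.

Lemma torus_test_derive_periodic i u : torus_periodic u ->
  torus_periodic (fun x => 'D_(delta_mx 0 i) u x).
Proof.
move=> pu j x; rewrite /derive; apply: (f_equal (fun f => lim (f @ 0^'))).
by apply/funext => h; rewrite /= addrA !pu.
Qed.

Lemma torus_test_continuous u : torus_test u -> continuous u.
Proof. by case=> _ du _ x; exact/differentiable_continuous/du. Qed.

Lemma torus_test_bounded u : torus_test u ->
  measurable_fun setT u /\ exists c : R, forall x, `|u x| <= c.
Proof.
move=> tu; have cu := torus_test_continuous tu; case: tu => pu _ _.
by split; [exact: measurable_continuous_row|exact: torus_bounded].
Qed.

Lemma torus_test_derive_bounded i u : torus_test u ->
  measurable_fun setT (fun x => 'D_(delta_mx 0 i) u x) /\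
  exists c : R, forall x, `|'D_(delta_mx 0 i) u x| <= c.
Proof.
move=> [pu _ cu]; split; first exact: measurable_continuous_row (cu i).
exact: torus_bounded (torus_test_derive_periodic i pu) (cu i).
Qed.

Lemma torus_integral_derive i u : torus_test u ->
  \int[mu]_x ('D_(delta_mx 0 i) u x) = 0.
Proof.
move=> tu; have [mD [c Dc]] := torus_test_derive_bounded i tu.
case: tu => pu du cu.
apply: (torus_resample_eq0 (i := i) mD Dc) => x.
(* The point [x] with its coordinate [i] set to 0: resampling walks along the segment from [y] to
   its translate by one period, over which the derivative integrates to 0. *)
pose y := x - x ord0 i *: delta_mx 0 i.
have E s : row_upd i (s, x) = s *: delta_mx 0 i + y.
  by rewrite /row_upd /= scalerBl addrCA.
transitivity (\int[lebesgue_measure]_(s in `[0%R, 1%R])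
    ('D_(delta_mx 0 i) u (s *: delta_mx 0 i + y))%:E)%E.
  by apply: eq_integral => s _; rewrite E.
pose F (s : R) := u (s *: delta_mx 0 i + y).
pose f (s : R) := 'D_(delta_mx 0 i) u (s *: delta_mx 0 i + y).
have dF (s : R) : is_derive s (1 : R) F (f s).
  apply: DeriveDef; last by rewrite /f derive_line.
  by apply/derivable_line; apply: diff_derivable.
have cf : continuous f.
  move=> s; apply: (@continuous_comp _ _ _ (fun s : R => s *: delta_mx 0 i + y)
    (fun z => 'D_(delta_mx 0 i) u z)); last exact: cu.
  by apply: cvgD; [apply: cvgZr_tmp; exact: cvg_id|exact: cvg_cst].
apply: eq_trans (FTC_everywhere ltr01 dF cf) _.
by rewrite /F scale1r scale0r add0r [delta_mx 0 i + y]addrC pu -EFinB subrr.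
Qed.

Lemma derive_torus_testM i u v x : torus_test u -> torus_test v ->
  'D_(delta_mx 0 i) (fun x => u x * v x) x =
  u x * 'D_(delta_mx 0 i) v x + v x * 'D_(delta_mx 0 i) u x.
Proof.
move=> [_ du _] [_ dv _].
exact: (deriveM (diff_derivable (du x)) (diff_derivable (dv x))).
Qed.

Lemma derive_torus_test_lin i a u v x : torus_test u -> torus_test v ->
  'D_(delta_mx 0 i) (fun x => a * u x + v x) x =
  a * 'D_(delta_mx 0 i) u x + 'D_(delta_mx 0 i) v x.
Proof.
move=> [_ du _] [_ dv _].
have du' := @diff_derivable _ _ _ u x (delta_mx 0 i) (du x).
have := deriveD (derivableZ (k := a) du') (@diff_derivable _ _ _ v x (delta_mx 0 i) (dv x)).
by rewrite deriveZ.
Qed.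

Lemma torus_testM u v : torus_test u -> torus_test v -> torus_test (fun x => u x * v x).
Proof.
move=> tu tv; have cu := torus_test_continuous tu; have cv := torus_test_continuous tv.
have DM i x := derive_torus_testM i x tu tv; case: tu tv => pu du Du [pv dv Dv]; split.
- by move=> i x; rewrite pu pv.
- by move=> x; exact: differentiableM.
- move=> i; rewrite (_ : 'D_(delta_mx 0 i) (fun x => u x * v x) = (fun x =>
      u x * 'D_(delta_mx 0 i) v x + v x * 'D_(delta_mx 0 i) u x)); last first.
    by apply/funext => x; rewrite DM.
  by move=> x; exact: cvgD (cvgM (cu x) (Dv i x)) (cvgM (cv x) (Du i x)).
Qed.

Lemma torus_test_lin a u v : torus_test u -> torus_test v ->
  torus_test (fun x => a * u x + v x).
Proof.
move=> tu tv; have DL i x := derive_torus_test_lin i a x tu tv; move: tu tv => [pu du Du] [pv dv Dv]; split.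
- by move=> i x; rewrite pu pv.
- by move=> x; apply: differentiableD => //; exact: differentiableZ.
- move=> i; rewrite (_ : 'D_(delta_mx 0 i) (fun x => a * u x + v x) = (fun x =>
      a * 'D_(delta_mx 0 i) u x + 'D_(delta_mx 0 i) v x)); last first.
    by apply/funext => x; rewrite DL.
  by move=> x; exact: cvgD (cvgM (cvg_cst a) (Du i x)) (Dv i x).
Qed.

Lemma torus_integration_by_parts i u v : torus_test u -> torus_test v ->
  ipL2 mu u (fun x => 'D_(delta_mx 0 i) v x) =
  - ipL2 mu (fun x => 'D_(delta_mx 0 i) u x) v.
Proof.
move=> tu tv; have := torus_integral_derive i (torus_testM tu tv).
have [mu_ [cu hu]] := torus_test_bounded tu; have [mv [cv hv]] := torus_test_bounded tv.
have [mDu [cDu hDu]] := torus_test_derive_bounded i tu.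
have [mDv [cDv hDv]] := torus_test_derive_bounded i tv.
have L2b (f : 'rV[R]_d -> R) (c : R) : measurable_fun setT f -> (forall x, `|f x| <= c) -> f \in Lfun mu 2%:E.
  by move=> mf fc; exact: (L2_bounded (torus_measure_fin R d) mf fc).
rewrite (_ : \int[mu]_x _ = \int[mu]_x (1 * (u x * 'D_(delta_mx 0 i) v x) +
    'D_(delta_mx 0 i) u x * v x)); last first.
  by apply: eq_Rintegral => x _; rewrite derive_torus_testM// mul1r [X in _ + X]mulrC.
rewrite Rintegral_lin; [rewrite /ipL2; lra| |].
- exact: L2_prod (L2b _ _ mu_ hu) (L2b _ _ mDv hDv).
- exact: L2_prod (L2b _ _ mDu hDu) (L2b _ _ mv hv).
Qed.

End PeriodicFunctions.

Section SmoothStep.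
Context {R : realType}.

(** A cubic fixing 0, 1/2 and 1 and repelling from 1/2: its iterates sharpen a threshold at 1/2
    while staying polynomial, so that trigonometric polynomials are closed under them. *)
Definition smoothstep (y : R) : R := 3 * y ^+ 2 - 2 * y ^+ 3.

Lemma smoothstep_itv y : 0 <= y <= 1 -> 0 <= smoothstep y <= 1.
Proof.
move=> /andP[y0 y1].
have E : smoothstep y = y ^+ 2 * (3 - 2 * y) by rewrite /smoothstep; ring.
have E' : 1 - smoothstep y = (1 - y) ^+ 2 * (1 + 2 * y) by rewrite /smoothstep; ring.
rewrite -[X in _ && X]subr_ge0 E' E.
by apply/andP; split; rewrite mulr_ge0 ?sqr_ge0//; lra.
Qed.

Lemma iter_smoothstep_itv n y : 0 <= y <= 1 -> 0 <= iter n smoothstep y <= 1.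
Proof. by move=> h; elim: n => [//|n IH]; exact: smoothstep_itv. Qed.

Lemma smoothstep_onem y : smoothstep (1 - y) = 1 - smoothstep y.
Proof. by rewrite /smoothstep; ring. Qed.

Lemma iter_smoothstep_onem n y : iter n smoothstep (1 - y) = 1 - iter n smoothstep y.
Proof. by elim: n => [//|n IH]; rewrite !iterS IH smoothstep_onem. Qed.

(* [1 - smoothstep y = (1 - y) ((1 - y) (1 + 2 y))], and the last factor
   is below 1 for [y > 1/2]. *)
Lemma iter_smoothstep_cvg1 y : 1 / 2 < y -> y <= 1 ->
  (fun n => iter n smoothstep y) @ \oo --> (1 : R).
Proof.
move=> y2 y1; pose r := 1 + y - 2 * y ^+ 2.
have r0 : 0 <= r by rewrite /r; nra.
have r1 : r < 1 by rewrite /r; nra.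
have H n : y <= iter n smoothstep y <= 1 /\ 1 - iter n smoothstep y <= r ^+ n.
  elim: n => [|n [/andP[h1 h2] h3]]; first by rewrite /= expr0 lexx y1; split=> //; lra.
  rewrite iterS; set z := iter n _ _ in h1 h2 h3 *.
  have E : 1 - smoothstep z = (1 - z) * (1 + z - 2 * z ^+ 2) by rewrite /smoothstep; ring.
  have zr : 1 + z - 2 * z ^+ 2 <= r by rewrite /r; nra.
  have z0 : 0 <= 1 + z - 2 * z ^+ 2 by nra.
  split.
    apply/andP; split.
      have : 1 - smoothstep z <= 1 - z by rewrite E; apply: ler_piMr; lra.
      lra.
    have : 0 <= 1 - smoothstep z by rewrite E; apply: mulr_ge0; lra.
    lra.
  by rewrite E [r ^+ n.+1]exprSr; apply: ler_pM => //; lra.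
apply/cvgrPdist_le => e e0.
have cr : (fun n => r ^+ n) @ \oo --> (0 : R) by apply: cvg_expr; rewrite ger0_norm.
near=> n; have [/andP[h1 h2] h3] := H n.
rewrite ger0_norm ?subr_ge0//; apply: le_trans h3 _.
have : `|0 - r ^+ n| <= e by near: n; move/cvgrPdist_le : cr; apply.
by rewrite sub0r normrN ger0_norm// exprn_ge0.
Unshelve. all: by end_near. Qed.

Lemma iter_smoothstep_cvg0 y : 0 <= y -> y < 1 / 2 ->
  (fun n => iter n smoothstep y) @ \oo --> (0 : R).
Proof.
move=> y0 y2; have h : (fun n => iter n smoothstep (1 - y)) @ \oo --> (1 : R).
  by apply: iter_smoothstep_cvg1; lra.
have -> : (fun n => iter n smoothstep y) = (fun n => 1 - iter n smoothstep (1 - y)).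
  by apply/funext => n; rewrite iter_smoothstep_onem; ring.
by rewrite -[X in _ --> X](subrr 1); exact: cvgB (cvg_cst (1 : R)) h.
Qed.

End SmoothStep.

Section TrigonometricPolynomials.
Variables (R : realType) (d : nat).
Local Notation mu := (torus_measure R d).
Implicit Types (u v : 'rV[R]_d -> R) (x : 'rV[R]_d) (k : 'I_d -> int).

Definition phase k x : R := pi *+ 2 * \sum_j (k j)%:~R * x ord0 j.

Definition cosw k (th : R) x : R := cos (phase k x + th).

(* Allowing a phase shift [th] covers the sines and makes products and
   derivatives of waves again combinations of waves. *)
Inductive trig_poly : ('rV[R]_d -> R) -> Prop :=
| trig_cosw k th : trig_poly (cosw k th)
| trig_lin a u v : trig_poly u -> trig_poly v -> trig_poly (fun x => a * u x + v x).

Lemma phaseD k x y : phase k (x + y) = phase k x + phase k y.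
Proof.
rewrite /phase -mulrDr -big_split /=; congr (_ * _).
by apply: eq_bigr => j _; rewrite mxE mulrDr.
Qed.

Lemma phase_delta k i (h : R) : phase k (h *: delta_mx 0 i) = pi *+ 2 * (k i)%:~R * h.
Proof.
rewrite /phase (bigD1 i)//= big1 ?addr0; last first.
  by move=> j ji; rewrite !mxE (negbTE ji) andbF mulr0 mulr0.
by rewrite !mxE !eqxx /= mulr1 mulrA.
Qed.

Lemma phase_addk k k' x : phase (fun j => k j + k' j) x = phase k x + phase k' x.
Proof.
rewrite /phase -mulrDr -big_split /=; congr (_ * _).
by apply: eq_bigr => j _; rewrite intrD mulrDl.
Qed.

Lemma phase_oppk k x : phase (fun j => - k j) x = - phase k x.
Proof.
rewrite /phase -mulrN -sumrN; congr (_ * _).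
by apply: eq_bigr => j _; rewrite mulrNz mulNr.
Qed.

Lemma cos_period (z : R) (n : int) : cos (z + pi *+ 2 * n%:~R) = cos z.
Proof.
have nat_period (m : nat) y : cos (y + pi *+ 2 * m%:R) = cos y :> R.
  elim: m => [|m IH]; first by rewrite mulr0 addr0.
  by rewrite -natr1 mulrDr mulr1 addrA cosD2pi.
case: n => n; first exact: nat_period.
rewrite NegzE mulrNz mulrN -[LHS](nat_period n.+1).
by rewrite subrK.
Qed.

Lemma differentiable_cosw k th x : differentiable (cosw k th) x.
Proof.
apply: (@differentiable_comp _ _ _ _ (fun x => phase k x + th) (@cos R)); last first.
  by apply/derivable1_diffP; exact: derivable_cos.
apply: differentiableD => //; rewrite /phase.
apply: (@differentiableZ _ _ _ (fun x : 'rV[R]_d => \sum_j (k j)%:~R * x ord0 j) (pi *+ 2)).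
rewrite (_ : (fun x => _) = \sum_j (fun x : 'rV[R]_d => (k j)%:~R * x ord0 j)); last first.
  by apply/funext => z; rewrite fct_sumE.
apply: differentiable_sum => j.
apply: (@differentiableZ _ _ _ (fun x : 'rV[R]_d => x ord0 j) (k j)%:~R).
exact: differentiable_coord.
Qed.

Lemma derive_cosw k th i x : 'D_(delta_mx 0 i) (cosw k th) x =
  pi *+ 2 * (k i)%:~R * cosw k (th + pi / 2) x.
Proof.
have h : is_derive x (delta_mx 0 i) (cosw k th)
    (pi *+ 2 * (k i)%:~R * cosw k (th + pi / 2) x).
  apply: is_derive_line.
  have -> : (fun s : R => cosw k th (s *: delta_mx 0 i + x)) =
      (fun s : R => cos (pi *+ 2 * (k i)%:~R * s + (phase k x + th))).
    by apply/funext => s; rewrite /cosw phaseD phase_delta addrA.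
  set c := pi *+ 2 * _; set b := phase k x + th.
  apply: is_derive_eq.
  rewrite /cosw [phase k x + _]addrA cosDpihalf -/b mulr0 add0r /GRing.scale /=.
  ring.
exact: @derive_val.
Qed.

Lemma torus_test_cosw k th : torus_test (cosw k th).
Proof.
split.
- move=> i x; rewrite /cosw phaseD -[delta_mx 0 i]scale1r phase_delta mulr1.
  by rewrite addrAC cos_period.
- exact: differentiable_cosw.
- move=> i; rewrite (_ : 'D_(delta_mx 0 i) _ =
      (fun x => pi *+ 2 * (k i)%:~R * cosw k (th + pi / 2) x)); last first.
    by apply/funext => x; rewrite derive_cosw.
  move=> x; exact: cvgM (cvg_cst (pi *+ 2 * (k i)%:~R))
    (differentiable_continuous (differentiable_cosw k (th + pi / 2) x)).
Qed.

Lemma torus_test_trig u : trig_poly u -> torus_test u.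
Proof.
elim=> [k th|a v w _ tv _ tw]; first exact: torus_test_cosw.
exact: torus_test_lin.
Qed.

Lemma trig_poly0 : trig_poly (fun=> 0).
Proof.
have := trig_lin (-1) (trig_cosw (fun=> 0) 0) (trig_cosw (fun=> 0) 0).
by congr trig_poly; apply/funext => x; rewrite mulN1r addNr.
Qed.

Lemma trig_scale a u : trig_poly u -> trig_poly (fun x => a * u x).
Proof.
move=> tu; have := trig_lin a tu trig_poly0.
by congr trig_poly; apply/funext => x; rewrite addr0.
Qed.

Lemma trig_cst c : trig_poly (fun=> c).
Proof.
have := trig_scale c (trig_cosw (fun=> 0) 0).
congr trig_poly; apply/funext => x; rewrite /cosw /phase big1 ?mulr0 ?addr0 ?cos0 ?mulr1//.
by move=> j _; rewrite mul0r.
Qed.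

Lemma cosw_mul k th k' th' x : cosw k th x * cosw k' th' x =
  2^-1 * cosw (fun j => k j + k' j) (th + th') x +
  2^-1 * cosw (fun j => k j + - k' j) (th - th') x.
Proof.
rewrite /cosw !phase_addk phase_oppk.
set a := phase k x; set b := phase k' x.
rewrite (_ : a + b + (th + th') = (a + th) + (b + th')); last by ring.
rewrite (_ : a - b + (th - th') = (a + th) - (b + th')); last by ring.
by move: (a + th) (b + th') => A B; rewrite cosD cosB; field.
Qed.

Lemma trig_mul u v : trig_poly u -> trig_poly v -> trig_poly (fun x => u x * v x).
Proof.
move=> + tv; elim=> [k th|a w w' _ tw _ tw']; last first.
  have := trig_lin a tw tw'.
  by congr trig_poly; apply/funext => x; rewrite mulrDl mulrA.
elim: tv => [k' th'|a w w' _ tw _ tw']; last first.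
  have := trig_lin a tw tw'.
  by congr trig_poly; apply/funext => x; rewrite mulrDr mulrCA.
rewrite (_ : (fun x => _) = (fun x => 2^-1 * cosw (fun j => k j + k' j) (th + th') x +
  2^-1 * cosw (fun j => k j + - k' j) (th - th') x)).
  by apply: trig_lin; [exact: trig_cosw|apply: trig_scale; exact: trig_cosw].
by apply/funext => x; rewrite cosw_mul.
Qed.

Lemma trig_smoothstep u : trig_poly u -> trig_poly (fun x => smoothstep (u x)).
Proof.
move=> tu; have tu2 := trig_mul tu tu.
have := trig_lin 3 tu2 (trig_scale (-2) (trig_mul tu tu2)).
by congr trig_poly; apply/funext => x; rewrite /smoothstep; ring.
Qed.

Lemma trig_iter_smoothstep n u : trig_poly u ->
  trig_poly (fun x => iter n smoothstep (u x)).
Proof. by move=> tu; elim: n => [//|n IH]; exact: trig_smoothstep IH. Qed.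

Definition half_spaces : set (set 'rV[R]_d) :=
  [set A | exists i c, A = (fun x : 'rV[R]_d => x ord0 i) @^-1` `]c, +oo[%classic].

Lemma half_spaces_measurable : half_spaces `<=` measurable.
Proof.
move=> _ [i [c ->]]; rewrite -[X in measurable X]setTI.
exact: (measurable_row_coor i measurableT (measurable_itv _)).
Qed.

Lemma half_spaces_generate : (@measurable _ 'rV[R]_d) `<=` <<s half_spaces >>.
Proof.
apply: smallest_sub; first exact: smallest_sigma_algebra.
move=> A; rewrite -bigcup_seq/= => -[i _ [B mB <-]].
rewrite setTI; move: B mB.
suff : @measurable _ (measurableTypeR R) `<=`
    [set B | <<s half_spaces >> ((fun x : 'rV[R]_d => x ord0 i) @^-1` B)] by [].
rewrite [X in X `<=` _](RGenOInfty.measurableE R).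
apply: smallest_sub; last first.
  by move=> _ [c ->]; apply: sub_sigma_algebra; exists i, c.
split.
- by rewrite /= preimage_set0; exact: sigma_algebra0.
- by move=> B hB; rewrite /= setTD preimage_setC; exact: sigma_algebraC.
- by move=> F hF; rewrite /= preimage_bigcup; exact: sigma_algebra_bigcup.
Qed.

(* The half space [x_i > c] is, up to a null set, [{p > 0}] for the
   trigonometric polynomial [p = sin (pi (x_i - c)) sin (pi x_i)]. *)
Lemma half_spaces_approx A : half_spaces A -> exists (q : nat -> 'rV[R]_d -> R) (c : R),
  [/\ forall n, trig_poly (q n), forall n x, `|q n x| <= c &
      \forall x \ae mu, (fun n => q n x) @ \oo --> (\1_A x : R)].
Proof.
move=> [i [c ->]].
have [c0|c0] := leP c 0.
  exists (fun=> fun=> 1), 1; split=> [_|n x|]; first exact: trig_cst.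
    by rewrite normr1.
  apply: filterS (torus_measure_cell R d) => x /(_ i)/andP[x0 x1].
  rewrite indicE mem_set; first exact: cvg_cst.
  by rewrite /= in_itv/= andbT; exact: le_lt_trans x0.
have [c1|c1] := leP 1 c.
  exists (fun=> fun=> 0), 1; split=> [_|n x|]; first exact: trig_cst.
    by rewrite normr0.
  apply: filterS (torus_measure_cell R d) => x /(_ i)/andP[x0 x1].
  rewrite indicE memNset; first exact: cvg_cst.
  by rewrite /= in_itv/= andbT => cx; have := lt_trans cx x1; lra.
(* The factor [sin (pi (x_i - c))] has the right sign change but is antiperiodic. The factor
   [sin (pi x_i)], positive on the open cell, repairs the period without altering the sign; the
   product formula displays the result as a wave plus a constant. *)
pose p x : R := 2^-1 * cos (pi * c) + (-2^-1) * cos (pi *+ 2 * x ord0 i - pi * c).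
have pE x : p x = sin (pi * (x ord0 i - c)) * sin (pi * x ord0 i).
  rewrite /p (_ : pi *+ 2 * x ord0 i - pi * c = pi * (x ord0 i - c) + pi * x ord0 i); last by ring.
  rewrite [in LHS](_ : pi * c = pi * x ord0 i - pi * (x ord0 i - c)); last by ring.
  by rewrite cosB cosD; field.
have tp : trig_poly (fun x => (1 + p x) / 2).
  have h1 : trig_poly (fun x => cos (pi *+ 2 * x ord0 i - pi * c)).
    have := trig_cosw (fun j => (j == i)%:Z) (- (pi * c)).
    congr trig_poly; apply/funext => z; rewrite /cosw /phase (bigD1 i)//= eqxx mul1r.
    by rewrite big1 ?addr0// => j ji; rewrite (negbTE ji) mul0r.
  have := trig_lin (- 4^-1) h1 (trig_cst (2^-1 + 4^-1 * cos (pi * c))).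
  by congr trig_poly; apply/funext => x; rewrite /p; field.
(* The affine map sends the range [-1,1] of [p] to [0,1] and its sign change to the threshold
   1/2. *)
exists (fun n x => iter n smoothstep ((1 + p x) / 2)), 1; split.
- by move=> n; exact: trig_iter_smoothstep.
- move=> n x; have p1 : `|p x| <= 1.
    rewrite pE normrM -[1]mulr1; apply: ler_pM => //; exact: sin_max.
  have /(iter_smoothstep_itv n)/andP[h1 h2] : 0 <= (1 + p x) / 2 <= 1.
    by move: p1; rewrite ler_norml => /andP[a b]; apply/andP; split; lra.
  by rewrite ger0_norm.
- have hc : \forall x \ae mu, (x : 'rV[R]_d) ord0 i <> c.
    exists ((fun x : 'rV[R]_d => x ord0 i) @^-1` [set c]); split.
    + rewrite -[X in measurable X]setTI.
      exact: (measurable_row_coor i measurableT (measurable_set1 c)).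
    + exact: torus_measure_hyperplane.
    + by move=> x /=; apply: contrapT.
  apply: filterS2 (torus_measure_cell R d) hc => x /(_ i)/andP[x0 x1] /eqP xc.
  have p1 : `|p x| <= 1.
    rewrite pE normrM -[1]mulr1; apply: ler_pM => //; exact: sin_max.
  have pi0 := pi_gt0 R.
  have s1 : 0 < sin (pi * x ord0 i).
    by apply: sin_gt0_pi; apply/andP; split; nra.
  move: xc; rewrite neq_lt => /orP[xc|xc].
    rewrite indicE memNset; last by rewrite /= in_itv/= andbT => cx; have := lt_trans cx xc; rewrite ltxx.
    have s2 : sin (pi * (x ord0 i - c)) < 0.
      rewrite (_ : pi * (x ord0 i - c) = - (pi * (c - x ord0 i))); last by ring.
      rewrite sinN oppr_lt0; apply: sin_gt0_pi; apply/andP; split; nra.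
    have p0 : p x < 0 by rewrite pE; nra.
    by apply: iter_smoothstep_cvg0; move: p1; rewrite ler_norml => /andP[]; lra.
  rewrite indicE mem_set; last by rewrite /= in_itv/= andbT.
  have s2 : 0 < sin (pi * (x ord0 i - c)).
    by apply: sin_gt0_pi; apply/andP; split; nra.
  have p0 : 0 < p x by rewrite pE mulr_gt0.
  by apply: iter_smoothstep_cvg1; move: p1; rewrite ler_norml => /andP[]; lra.
Qed.

(** Trigonometric polynomials form an algebra, so they serve both as tests and as multipliers; the
    conclusion is read off at the test 1. *)
Lemma trig_separation (g : 'rV[R]_d -> R) : g \in Lfun mu 2%:E ->
  (forall u, trig_poly u -> ipL2 mu g u = 0) -> \forall x \ae mu, g x = 0.
Proof.
move=> hg h.
have tb t : trig_poly t -> measurable_fun setT t /\ exists c : R, forall x, `|t x| <= c.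
  by move=> /torus_test_trig/torus_test_bounded.
have := @separation _ _ _ mu g trig_poly trig_poly half_spaces
  (L2_integrable (torus_measure_fin R d) hg) tb tb (fun q t hq ht => trig_mul hq ht)
  half_spaces_measurable half_spaces_generate half_spaces_approx h _ (trig_cst 1).
by apply: filterS => x; rewrite mulr1.
Qed.

Definition torus_tests (i : 'I_d) (p q : 'rV[R]_d -> R) : Prop :=
  torus_test q /\ p = 'D_(delta_mx 0 i) q.

Lemma torus_test_L2 u : torus_test u -> u \in Lfun mu 2%:E.
Proof.
by move=> /torus_test_bounded[mu_ [c uc]]; exact: (L2_bounded (torus_measure_fin R d) mu_ uc).
Qed.

Lemma torus_test_derive_L2 i u : torus_test u -> 'D_(delta_mx 0 i) u \in Lfun mu 2%:E.
Proof.
by move=> /(torus_test_derive_bounded i)[mu_ [c uc]]; exact: (L2_bounded (torus_measure_fin R d) mu_ uc).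
Qed.

Lemma torus_weak_derivation : weak_derivation mu (@torus_wd R d) torus_tests.
Proof.
split.
- exact: torus_measure_fin.
- by move=> i _ q [tq ->]; split; [exact: torus_test_derive_L2|exact: torus_test_L2].
- move=> i u g; split; first by move=> h _ q [tq ->]; exact: h.
  by move=> h psi tpsi; exact: (h _ psi (conj tpsi erefl)).
- move=> i g hg h; apply: trig_separation => // u tu.
  by apply: (h ('D_(delta_mx 0 i) u)); split => //; exact: torus_test_trig.
Qed.

Lemma torus_test_has_wpartial i u : torus_test u ->
  has_wpartial mu (@torus_wd R d) i u ('D_(delta_mx 0 i) u).
Proof.
move=> tu; split; first exact: torus_test_derive_L2.
by move=> psi tpsi; exact: torus_integration_by_parts.
Qed.

End TrigonometricPolynomials.

(** * Density of trigonometric polynomials in H^m *)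

Section TrigDensity.
Variables (R : realType) (d : nat).
Local Notation mu := (torus_measure R d).
Local Notation W := (torus_weak_derivation R d).
Implicit Types (u v : 'rV[R]_d -> R) (x : 'rV[R]_d) (k : 'I_d -> int).

Lemma wpartial_torus_test i u : torus_test u ->
  \forall x \ae mu, pd i u x = 'D_(delta_mx 0 i) u x.
Proof. by move=> tu; apply: (wpartial_unique W); exact: torus_test_has_wpartial. Qed.

Lemma derive_trig i u : trig_poly u -> trig_poly ('D_(delta_mx 0 i) u).
Proof.
elim=> [k th|a v w tv IHv tw IHw].
  have := trig_scale (pi *+ 2 * (k i)%:~R) (trig_cosw k (th + pi / 2)).
  by congr trig_poly; apply/funext => x; rewrite derive_cosw.
have := trig_lin a IHv IHw; congr trig_poly; apply/funext => x.
by rewrite derive_torus_test_lin//; exact: torus_test_trig.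
Qed.

Lemma trig_Hk m u : trig_poly u -> Hk m u.
Proof.
elim: m u => [|m IH] u tu; first by split=> //; exact/torus_test_L2/torus_test_trig.
apply: (has_sobolev W (g := fun i => 'D_(delta_mx 0 i) u)).
- exact/torus_test_L2/torus_test_trig.
- by move=> i; exact/torus_test_has_wpartial/torus_test_trig.
- by move=> i; apply: IH; exact: derive_trig.
Qed.

(* The waves are common eigenfunctions of all the [H^m] inner products. *)
Lemma sobolev_ip_cosw m k : exists2 c : R, 0 < c & forall th u, Hk m u ->
  sobolev_ip mu (@torus_wd R d) m (cosw k th) u = c * ipL2 mu (cosw k th) u.
Proof.
elim: m => [|m [c c0 IH]].
  by exists 1 => // th u _; rewrite /= addr0 mul1r.
pose a i : R := pi *+ 2 * (k i)%:~R.
exists (1 + \sum_i a i ^+ 2 * c).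
  by rewrite ltr_pwDl// sumr_ge0// => i _; rewrite mulr_ge0 ?sqr_ge0// ltW.
move=> th u hu; rewrite /= mulrDl mul1r mulr_suml; congr (_ + _); apply: eq_bigr => i _.
have te := torus_test_cosw k th; have te' := torus_test_cosw k (th + pi / 2).
have hD := sobolev_wpartial i hu.
have he' : Hk m (cosw k (th + pi / 2)) by apply: trig_Hk; exact: trig_cosw.
have hae' : Hk m (fun x => a i * cosw k (th + pi / 2) x).
  by apply: trig_Hk; apply: trig_scale; exact: trig_cosw.
transitivity (sobolev_ip mu (@torus_wd R d) m
    (fun x => a i * cosw k (th + pi / 2) x) (pd i u)).
  apply: (sobolev_ip_ae W) => //.
  - by apply: sobolev_wpartial; exact/(trig_Hk m.+1)/trig_cosw.
  - by apply: filterS (wpartial_torus_test i te) => x; rewrite /pd => ->; rewrite derive_cosw.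
  - exact: aeW.
rewrite (quad_BC (@isSob_NE _ _ _ _ _ _ _ W m) hae' hD).
rewrite (quad_BZr (isSob_lin W (k := m)) (@isSob_NE _ _ _ _ _ _ _ W m) (a i) hD he').
rewrite (quad_BC (@isSob_NE _ _ _ _ _ _ _ W m) hD he') IH//.
(* The wave shifted by a quarter period is a test function whose derivative is [- a i] times the
   original wave, so the derivative on [u] is moved back onto the wave and each direction
   contributes a factor [a i ^+ 2]. *)
have [_ /(_ _ te') wu] := sobolev_has i hu.
have {}wu : ipL2 mu u ('D_(delta_mx 0 i) (cosw k (th + pi / 2))) =
  - ipL2 mu (pd i u) (cosw k (th + pi / 2)) := wu.
have E : 'D_(delta_mx 0 i) (cosw k (th + pi / 2)) = (fun x => - a i * cosw k th x).
  apply/funext => x; rewrite derive_cosw /cosw addrA cosDpihalf.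
  by rewrite addrA sinDpihalf -/(a i); ring.
have -> : ipL2 mu (cosw k (th + pi / 2)) (pd i u) = a i * ipL2 mu (cosw k th) u.
  rewrite ipL2C; apply: oppr_inj; rewrite -[LHS]wu E -[RHS]mulNr /ipL2 -RintegralZl//.
    by apply: eq_Rintegral => x _; ring.
  apply: L2_prod; [exact: torus_test_L2|exact: sobolev_L2 hu].
by ring.
Qed.

(** The remainder of the H^m projection onto trigonometric polynomials is H^m-orthogonal to every
    wave. Waves being eigenfunctions with positive factor, it is also L^2-orthogonal to them, hence
    zero almost everywhere. No Fourier series is summed. *)
Lemma trig_dense m (v : 'rV[R]_d -> R^o) : isSob mu (@torus_wd R d) m v ->
  exists u : nat -> 'rV[R]_d -> R^o, (forall n, trig_poly (u n)) /\
    cvg_sq (fun w : 'rV[R]_d -> R^o => sobolev_sqnorm mu (@torus_wd R d) m w) u v.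
Proof.
move=> hv; pose N (w : 'rV[R]_d -> R^o) := sobolev_sqnorm mu (@torus_wd R d) m w.
pose B (w w' : 'rV[R]_d -> R^o) := sobolev_ip mu (@torus_wd R d) m w w'.
pose H (w : 'rV[R]_d -> R^o) := isSob mu (@torus_wd R d) m w.
have Hlin : forall a u v, H u -> H v -> H (a *: u + v) by exact: (isSob_lin W).
have N0 u : 0 <= N u by exact: sobolev_sqnorm_ge0.
have NE : forall a u v, H u -> H v -> N (a *: u + v) = a ^+ 2 * N u + 2 * a * B u v + N v.
  exact: (isSob_NE W).
have [||||u [r [tu hr cr orth]]] := @quad_projection R _ H N B Hlin N0 NE
    (fun w => trig_poly w) v (@sobolev_complete _ _ _ _ _ _ _ W m).
- by move=> a /(trig_Hk m).
- by exists (fun=> 0); exact: trig_poly0.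
- by move=> c a b; exact: trig_lin.
- exact: hv.
exists u; split=> //.
have Lr := sobolev_L2 hr.
have r0 : \forall x \ae mu, r x = 0.
  apply: trig_separation => // w; elim=> [k th|a w1 w2 t1 h1 t2 h2].
    have [c c0 hc] := sobolev_ip_cosw m k.
    have := orth _ (trig_cosw k th); rewrite /B hc// => /eqP.
    by rewrite mulf_eq0 gt_eqF//= ipL2C => /eqP.
  by rewrite ipL2C ipL2_lin ?[ipL2 _ _ r]ipL2C ?h1 ?h2 ?mulr0 ?addr0//; exact/torus_test_L2/torus_test_trig.
have Nr : N r = 0.
  rewrite /N (@sobolev_sqnorm_ae _ _ _ _ _ _ _ W m r (fun=> 0)) //.
    by apply: (quadN0 NE); exact/(trig_Hk m)/trig_poly0.
  exact/torus_test_L2/torus_test_trig/trig_poly0.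
move=> e e0; have e2 : 0 < e / 2 by rewrite divr_gt0.
have [n0 h] := cr _ e2; exists n0 => n /h.
have hu : H (u n) by exact/(trig_Hk m)/tu.
have hvu : H (v - u n) by exact: (quad_sub Hlin).
have := quad_sqD Hlin N0 NE (quad_sub Hlin hvu hr) hr.
rewrite subrK Nr; change (N (v - u n) <= 2 * N (v - u n - r) + 2 * 0 ->
  N (v - u n - r) <= e / 2 -> N (u n - v) <= e).
by rewrite (quad_subC Hlin NE hu hv); lra.
Qed.

End TrigDensity.

(** * Sup bound by Poisson kernels *)

Section PoissonKernel.
Context {R : realType}.
Variable r : R.
Hypothesis r01 : 0 < r < 1.
Local Notation tau := (pi *+ 2 : R).

Lemma is_derive_div (f g : R -> R) (x df dg : R) : g x != 0 ->
  is_derive x (1 : R) f df -> is_derive x (1 : R) g dg ->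
  is_derive x (1 : R) (fun y => f y / g y) ((df * g x - f x * dg) / g x ^+ 2).
Proof.
move=> gx hf hg.
have hgV : is_derive x (1 : R) (fun y => (g y)^-1) (- (g x) ^- 2 *: dg).
  apply: DeriveDef; first by apply: derivableV => //; exact: @ex_derive.
  by rewrite deriveV// derive_val.
apply: (is_derive_eq (is_deriveM hf hgV)).
by rewrite /GRing.scale /=; field.
Qed.

Definition poisson_den (s : R) : R := 1 - 2 * r * cos (tau * s) + r ^+ 2.

Definition poisson (s : R) : R := (1 - r ^+ 2) / poisson_den s.

(* a periodic primitive of [poisson - 1], bounded uniformly in [r] *)
Definition poisson_prim (s : R) : R :=
  pi^-1 * atan (r * sin (tau * s) / (1 - r * cos (tau * s))).

Definition poisson_deriv (s : R) : R :=
  - (1 - r ^+ 2) * (2 * r * (tau * sin (tau * s))) / poisson_den s ^+ 2.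

Lemma is_derive_cos_tau (s : R) :
  is_derive s (1 : R) (fun s => cos (tau * s)) (- (tau * sin (tau * s))).
Proof. by apply: is_derive_eq; rewrite /GRing.scale /=; ring. Qed.

Lemma is_derive_sin_tau (s : R) :
  is_derive s (1 : R) (fun s => sin (tau * s)) (tau * cos (tau * s)).
Proof. by apply: is_derive_eq; rewrite /GRing.scale /=; ring. Qed.

Lemma poisson_den_gt0 s : 0 < poisson_den s.
Proof.
have := cos_max (tau * s); rewrite ler_norml => /andP[c1 c2].
by rewrite /poisson_den; case/andP: r01 => r0 r1; nra.
Qed.

Lemma poisson_gt0 s : 0 < poisson s.
Proof.
rewrite divr_gt0 ?poisson_den_gt0//; case/andP: r01 => r0 r1; nra.
Qed.

Lemma poisson_prim_le1 s : `|poisson_prim s| <= 1.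
Proof.
have pi0 := pi_gt0 R.
rewrite /poisson_prim normrM normfV (ger0_norm (ltW pi0)) mulrC ler_pdivrMr// mul1r.
set z := _ / _; have := atan_gtNpi2 z; have := atan_ltpi2 z.
by rewrite ler_norml => h1 h2; apply/andP; split; lra.
Qed.

Lemma one_sub_rcos_gt0 (z : R) : 0 < 1 - r * cos z.
Proof.
have := cos_max z; rewrite ler_norml => /andP[c1 c2].
by case/andP: r01 => r0 r1; nra.
Qed.

(** Up to the factor 1/pi, [poisson_prim] is the imaginary part of -log(1 - r e^(i tau s)), that is,
    the sum of r^n sin(n tau s) / n. Differentiating term by term gives twice the sum of r^n cos(n
    tau s), which is the Poisson kernel minus 1. The arctangent never changes branch because its
    denominator is positive. *)
Lemma is_derive_poisson_prim s :
  is_derive s (1 : R) poisson_prim (poisson s - 1).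
Proof.
pose g (s : R) := r * sin (tau * s) / (1 - r * cos (tau * s)).
have den0 : 1 - r * cos (tau * s) != 0 by rewrite gt_eqF// one_sub_rcos_gt0.
have dg : is_derive s (1 : R) g ((r * (tau * cos (tau * s)) * (1 - r * cos (tau * s)) -
    r * sin (tau * s) * (r * (tau * sin (tau * s)))) / (1 - r * cos (tau * s)) ^+ 2).
  apply: (@is_derive_div (fun s => r * sin (tau * s)) (fun s => 1 - r * cos (tau * s))) => //.
  - exact: (is_derive_eq (is_deriveZ r (is_derive_sin_tau s))).
  - apply: (is_derive_eq (is_deriveB (is_derive_cst (1 : R) s 1)
      (is_deriveZ r (is_derive_cos_tau s)))).
    by rewrite /GRing.scale /=; ring.
apply: (is_derive_eq (is_deriveZ (pi^-1) (is_derive1_comp (is_derive1_atan (g s)) dg))).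
rewrite /GRing.scale /= /poisson /poisson_den /g.
have pi0 : (pi : R) != 0 by rewrite gt_eqF// pi_gt0.
have D0 : 1 - 2 * r * cos (tau * s) + r ^+ 2 != 0.
  by rewrite gt_eqF//; exact: poisson_den_gt0.
have cs := cos2Dsin2 (tau * s).
set c := cos _ in den0 D0 cs *; set n := sin _ in cs *.
have E : 1 + (r * n / (1 - r * c)) ^+ 2 = (1 - 2 * r * c + r ^+ 2) / (1 - r * c) ^+ 2.
  apply: (mulIf (expf_neq0 2 den0)); rewrite divfK ?expf_neq0//.
  rewrite mulrDl mul1r expr_div_n divfK ?expf_neq0//.
  transitivity (1 - 2 * r * c + r ^+ 2 * (c ^+ 2 + n ^+ 2)); first by ring.
  by rewrite cs mulr1.
rewrite E.
have -> : r * (tau * c) * (1 - r * c) - r * n * (r * (tau * n)) = tau * (r * c - r ^+ 2).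
  transitivity (tau * (r * c - r ^+ 2 * (c ^+ 2 + n ^+ 2))); first by ring.
  by rewrite cs mulr1.
rewrite mulr2n; move: pi0; move: (pi : R) => P P0; field.
by rewrite D0 den0 P0.
Qed.

Lemma is_derive_poisson s : is_derive s (1 : R) poisson (poisson_deriv s).
Proof.
have den0 : poisson_den s != 0 by rewrite gt_eqF// poisson_den_gt0.
have dd : is_derive s (1 : R) poisson_den (2 * r * (tau * sin (tau * s))).
  apply: (is_derive_eq (is_deriveD (is_deriveB (is_derive_cst (1 : R) s 1)
    (is_deriveZ (2 * r) (is_derive_cos_tau s))) (is_derive_cst (r ^+ 2 : R) s 1))).
  by rewrite /GRing.scale /=; ring.
apply: (is_derive_eq (is_derive_div den0 (is_derive_cst (1 - r ^+ 2 : R) s 1) dd)).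
by rewrite /poisson_deriv mul0r sub0r mulNr.
Qed.

Lemma continuous_trig_tau :
  continuous (fun s : R => cos (tau * s)) /\ continuous (fun s : R => sin (tau * s)).
Proof.
split=> s; apply: differentiable_continuous; apply/derivable1_diffP.
  by have := is_derive_cos_tau s; exact: @ex_derive.
by have := is_derive_sin_tau s; exact: @ex_derive.
Qed.

Lemma continuous_poisson : continuous poisson.
Proof.
move=> s; apply: differentiable_continuous; apply/derivable1_diffP.
by have := is_derive_poisson s; exact: @ex_derive.
Qed.

Lemma continuous_poisson_deriv : continuous poisson_deriv.
Proof.
have [cc cs] := continuous_trig_tau => s.
have cd : poisson_den x @[x --> s] --> poisson_den s.
  by apply: cvgD; [apply: cvgB; [exact: cvg_cst|apply: cvgM; [exact: cvg_cst|exact: cc]]|exact: cvg_cst].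
apply: cvgM.
  apply: cvgM; first exact: cvg_cst.
  apply: cvgM; first exact: cvg_cst.
  by apply: cvgM; [exact: cvg_cst|exact: cs].
apply: cvgV; first by rewrite expf_neq0// gt_eqF// poisson_den_gt0.
exact: (cvgM cd cd).
Qed.

Lemma poisson_periodic s : poisson (s + 1) = poisson s.
Proof. by rewrite /poisson /poisson_den mulrDr mulr1 cosD2pi. Qed.

Lemma poisson_prim_periodic s : poisson_prim (s + 1) = poisson_prim s.
Proof. by rewrite /poisson_prim mulrDr mulr1 cosD2pi sinD2pi. Qed.

(** The denominator is (1 - r)^2 + 2 r (1 - cos(tau s)). Hence the kernel weighted by 1 - cos is
    uniformly small as r tends to 1; this is the weight used in the modulus of continuity below. *)
Lemma poisson_concentration s :
  (1 - cos (tau * s)) * poisson s <= (1 - r ^+ 2) / (2 * r).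
Proof.
have := poisson_den_gt0 s; have := cos_max (tau * s).
rewrite ler_norml /poisson /poisson_den => /andP[_ c1] d0.
case/andP: r01 => r0 r1; rewrite mulrA ler_pdivrMr// mulrAC ler_pdivlMr; last nra.
set c := cos _ in c1 d0 *.
have : 0 <= (1 - r ^+ 2) * (1 - r) ^+ 2 by apply: mulr_ge0; [nra|exact: sqr_ge0].
by nra.
Qed.

End PoissonKernel.

Section SobolevEmbedding.
Variables (R : realType) (d : nat).
Local Notation mu := (torus_measure R d).
Local Notation W := (torus_weak_derivation R d).
Local Notation sqn := (sobolev_sqnorm mu (@torus_wd R d)).
Implicit Types (u v g : 'rV[R]_d -> R) (x a : 'rV[R]_d).

Lemma derive_coord_fun (h h' : R -> R) c i j x :
  (forall s : R, is_derive s (1 : R) h (h' s)) ->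
  'D_(delta_mx 0 j) (fun x => h (x ord0 i - c)) x =
  if i == j then h' (x ord0 i - c) else 0.
Proof.
move=> hh.
have E : (fun s : R => h ((s *: delta_mx 0 j + x) ord0 i - c)) =
    (fun s : R => h ((i == j)%:R * s + (x ord0 i - c))).
  by apply/funext => s; rewrite !mxE eqxx /= mulrC addrA.
have : is_derive x (delta_mx 0 j) (fun x => h (x ord0 i - c))
    (if i == j then h' (x ord0 i - c) else 0).
  apply: is_derive_line; rewrite E; have [_|_] := eqVneq i j; last first.
    by under eq_fun do rewrite mul0r add0r; exact: is_derive_cst.
  pose g (s : R) : R := 1 * s + (x ord0 i - c).
  have d1 : is_derive (0 : R) (1 : R) g 1.
    by apply: is_derive_eq; rewrite /GRing.scale /=; ring.
  have hx : is_derive (g 0) (1 : R) h (h' (x ord0 i - c)).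
    by rewrite /g mulr0 add0r; exact: hh.
  have := is_derive1_comp hx d1; rewrite mulr1.
  by rewrite (_ : h \o g = (fun s : R => h (true%:R * s + (x ord0 i - c)))).
by move=> H; exact: @derive_val.
Qed.

Lemma torus_test_coord_fun (h h' : R -> R) c i :
  (forall s, h (s + 1) = h s) ->
  (forall s : R, is_derive s (1 : R) h (h' s)) -> continuous h' ->
  torus_test (fun x : 'rV[R]_d => h (x ord0 i - c)).
Proof.
move=> ph hh ch'; split.
- move=> j x; rewrite !mxE eqxx /=; case: (i == j); last by rewrite addr0.
  by rewrite addrAC ph.
- move=> x; apply: (@differentiable_comp _ _ _ _ (fun x : 'rV[R]_d => x ord0 i - c) h).
    by apply: differentiableB => //; exact: differentiable_coord.
  by apply/derivable1_diffP; have := hh (x ord0 i - c); exact: @ex_derive.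
- move=> j; rewrite (_ : 'D_(delta_mx 0 j) _ =
      fun x => if i == j then h' (x ord0 i - c) else 0); last first.
    by apply/funext => x; rewrite (derive_coord_fun _ _ _ _ hh).
  case: (i == j) => /=; last exact: cst_continuous.
  move=> x; apply: (@continuous_comp _ _ _ (fun x : 'rV[R]_d => x ord0 i - c) h'); last exact: ch'.
  exact: cvgB (@coord_continuous R 1 d ord0 i x) (cvg_cst c).
Qed.

Section FixedPoint.
Variables (r : R) (a : 'rV[R]_d).
Hypothesis r01 : 0 < r < 1.

Let rho i x : R := poisson r (x ord0 i - a ord0 i).
Let prim i x : R := poisson_prim r (x ord0 i - a ord0 i).

Definition poisson_prod (s : seq 'I_d) x : R := \prod_(i <- s) rho i x.

Lemma torus_test_poisson i : torus_test (rho i).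
Proof.
exact: torus_test_coord_fun (poisson_periodic r) (is_derive_poisson r01) (continuous_poisson_deriv r01).
Qed.

Lemma torus_test_poisson_prim i : torus_test (prim i).
Proof.
apply: torus_test_coord_fun (poisson_prim_periodic r) (is_derive_poisson_prim r01) _.
by move=> s; apply: cvgB; [exact: continuous_poisson|exact: cvg_cst].
Qed.

Lemma derive_poisson_prim i j x :
  'D_(delta_mx 0 j) (prim i) x = if i == j then rho i x - 1 else 0.
Proof. by rewrite (derive_coord_fun _ _ _ _ (is_derive_poisson_prim r01)). Qed.

Lemma torus_test1 : torus_test (fun _ : 'rV[R]_d => 1 : R).
Proof. exact/torus_test_trig/trig_cst. Qed.

Lemma torus_test_poisson_prod s : torus_test (poisson_prod s).
Proof.
rewrite /poisson_prod; elim: s => [|i s IH].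
  by rewrite (_ : (fun x => _) = fun=> 1); [exact: torus_test1|apply/funext => x; rewrite big_nil].
rewrite (_ : (fun x => _) = (fun x => rho i x * poisson_prod s x)).
  exact: torus_testM (torus_test_poisson i) IH.
by apply/funext => x; rewrite big_cons.
Qed.

Lemma poisson_prod_gt0 s x : 0 < poisson_prod s x.
Proof. by rewrite /poisson_prod prodr_gt0// => i _; exact: poisson_gt0. Qed.

Lemma derive_poisson_prod s j x : j \notin s ->
  'D_(delta_mx 0 j) (poisson_prod s) x = 0.
Proof.
elim: s => [_|i s IH].
  rewrite (_ : poisson_prod [::] = cst 1) ?derive_cst//.
  by apply/funext => z; rewrite /poisson_prod big_nil.
rewrite inE negb_or => /andP[ji js].
rewrite (_ : poisson_prod (i :: s) = (fun x => rho i x * poisson_prod s x)); last first.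
  by apply/funext => z; rewrite /poisson_prod big_cons.
rewrite (derive_torus_testM j x (torus_test_poisson i) (torus_test_poisson_prod s)).
rewrite IH// (derive_coord_fun _ _ _ _ (is_derive_poisson r01)) eq_sym (negbTE ji).
by rewrite !mulr0 addr0.
Qed.

(* Replacing one factor [rho i] by [1 + (prim i)'] and integrating by parts
   trades it for one weak derivative of [u]. *)
Lemma poisson_prod_split u g i s k : Hk k u -> torus_test g ->
  (forall x, 'D_(delta_mx 0 i) g x = 0) -> i \notin s ->
  ipL2 mu u (fun x => g x * poisson_prod (i :: s) x) =
  ipL2 mu u (fun x => g x * poisson_prod s x) +
  ipL2 mu u ('D_(delta_mx 0 i) (fun x => g x * prim i x * poisson_prod s x)).
Proof.
move=> hu tg Dg is_; have Lu := sobolev_L2 hu.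
have tgp := torus_testM tg (torus_test_poisson_prim i).
have ts := torus_test_poisson_prod s.
have := ipL2_lin 1 (torus_test_L2 (torus_testM tg ts))
  (torus_test_derive_L2 i (torus_testM tgp ts)) Lu.
rewrite mul1r ![ipL2 _ _ u]ipL2C => <-; congr ipL2; apply/funext => x.
rewrite (derive_torus_testM i x tgp ts) derive_poisson_prod//.
rewrite (derive_torus_testM i x tg (torus_test_poisson_prim i)) Dg.
by rewrite derive_poisson_prim eqxx /poisson_prod big_cons; ring.
Qed.

(** The splitting identity at [u = g = 1]: the term with a derivative integrates to zero, so factors
    can be removed one at a time. *)
Lemma integral_poisson_prod s : uniq s -> \int[mu]_x poisson_prod s x = 1.
Proof.
have h1 : Hk 0 (fun _ : 'rV[R]_d => 1 : R) by exact/trig_Hk/trig_cst.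
suff: uniq s -> ipL2 mu (fun=> 1) (fun x => 1 * poisson_prod s x) = 1.
  move=> H /H <-; apply: eq_Rintegral => x _; by rewrite !mul1r.
elim: s => [_|i s IH /= /andP[is_ us]].
  rewrite /ipL2 (_ : (fun x => _) = fun=> 1).
    by rewrite /Rintegral torus_integral_cst.
  by apply/funext => x; rewrite /poisson_prod big_nil !mul1r.
rewrite (poisson_prod_split h1 torus_test1)//; last first.
  by move=> x; rewrite (_ : (fun _ => 1) = cst 1)// derive_cst.
rewrite IH// /ipL2; under eq_Rintegral do rewrite mul1r.
rewrite torus_integral_derive ?addr0//.
exact: torus_testM (torus_testM torus_test1 (torus_test_poisson_prim i)) (torus_test_poisson_prod s).
Qed.

(** Each factor removed yields two terms, one with [u] and one with [pd i u] and an extra bounded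
    factor in [g]; hence the power of 2 and the requirement that [k] be at least the number of
    factors. The accumulated [g] depends only on coordinates already treated, so it is constant in
    the remaining ones. *)
Lemma poisson_prod_bound s k u g : uniq s -> (size s <= k)%N -> Hk k u ->
  torus_test g -> (forall x, `|g x| <= 1) ->
  (forall j, j \in s -> forall x, 'D_(delta_mx 0 j) g x = 0) ->
  `|ipL2 mu u (fun x => g x * poisson_prod s x)| <= 2 ^+ size s * Num.sqrt (sqn k u).
Proof.
elim: s k u g => [|i s IH] k u g.
  move=> _ _ hu tg g1 _; rewrite expr0 mul1r.
  rewrite (_ : (fun x => _) = g); last first.
    by apply/funext => x; rewrite /poisson_prod big_nil mulr1.
  have Lg := torus_test_L2 tg.
  apply: le_trans (ipL2_CS (sobolev_L2 hu) Lg) _.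
  rewrite -[leRHS]mulr1; apply: ler_pM => //; try exact: sqrtr_ge0.
    by rewrite ler_sqrt ?(sqnormL2_le_sobolev)// sobolev_sqnorm_ge0.
  rewrite -sqrtr1 ler_sqrt// /sqnormL2.
  rewrite (_ : 1 = Rintegral mu setT (fun=> 1)); last by rewrite /Rintegral torus_integral_cst.
  apply: le_Rintegral => //; first exact: L2_sqr.
    by apply: (@torus_bounded_integrable _ _ _ 1) => // x; rewrite normr1.
  by move=> x _; rewrite -real_normK ?num_real// expr_le1.
move=> /= /andP[is_ us] sk hu tg g1 Dg.
case: k sk hu => // k sk hu; rewrite ltnS in sk.
have Dgi : forall x, 'D_(delta_mx 0 i) g x = 0 by apply: Dg; rewrite mem_head.
rewrite (poisson_prod_split hu tg Dgi is_); apply: le_trans (ler_normD _ _) _.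
have tgp := torus_testM tg (torus_test_poisson_prim i).
have ts := torus_test_poisson_prod s.
have [_ /(_ _ (torus_testM tgp ts)) wu] := sobolev_has i hu.
rewrite [X in _ + `|X| <= _](_ : _ = - ipL2 mu (pd i u) (fun x => g x * prim i x * poisson_prod s x)); last exact: wu.
rewrite normrN exprS -mulrA mulr_natl mulr2n; apply: lerD.
- apply: IH => //; first exact: leqW.
  by move=> j js; apply: Dg; rewrite inE js orbT.
- apply: le_trans (IH k _ _ us sk (sobolev_wpartial i hu) tgp _ _) _.
  + move=> x; rewrite normrM -[1]mulr1; apply: ler_pM => //; exact: poisson_prim_le1.
  + move=> j js x; rewrite (derive_torus_testM j x tg (torus_test_poisson_prim i)).
    rewrite derive_poisson_prim (_ : i == j = false) ?mulr0 ?add0r.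
      by rewrite Dg ?mulr0// inE js orbT.
    by apply/negbTE; apply: contraNneq is_ => ->.
  + by rewrite ler_wpM2l ?exprn_ge0// ler_sqrt ?sobolev_sqnorm_ge0// sqn_wpartial_le.
Qed.

End FixedPoint.
End SobolevEmbedding.

Lemma Rintegral_seq_sum d (T : measurableType d) (R : realType)
    (mu : {measure set T -> \bar R}) (I : Type) (s : seq I) (f : I -> T -> R) :
  (forall i, mu.-integrable setT (EFin \o f i)) ->
  mu.-integrable setT (EFin \o (fun x => \sum_(i <- s) f i x)) /\
  \int[mu]_x (\sum_(i <- s) f i x) = \sum_(i <- s) \int[mu]_x f i x.
Proof.
move=> hf; elim: s => [|i s [IH1 IH2]].
  rewrite (_ : (fun x => _) = fun=> 0); last by apply/funext => x; rewrite big_nil.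
  by rewrite big_nil Rintegral_cst// mul0r; split => //; exact: integrable0.
rewrite (_ : (fun x => _) = fun x => 1 * f i x + \sum_(j <- s) f j x); last first.
  by apply/funext => x; rewrite big_cons mul1r.
split; first exact: integrable_lin.
by rewrite Rintegral_lin// mul1r IH2 big_cons.
Qed.

Section SupBound.
Variables (R : realType) (d : nat).
Local Notation mu := (torus_measure R d).
Local Notation W := (torus_weak_derivation R d).
Local Notation sqn := (sobolev_sqnorm mu (@torus_wd R d)).
Local Notation tau := (pi *+ 2 : R).
Implicit Types (u v : 'rV[R]_d -> R) (x a : 'rV[R]_d).

(** Near [a] modulo the lattice, continuity gives the error [e]. Otherwise some coordinate is at
    distance at least [eta] from that of [a] on the circle, where 1 - cos is bounded below, and the
    crude bound [2 * c] is absorbed into a multiple of it. *)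
Lemma periodic_modulus u a : torus_periodic u -> continuous u -> forall e : R, 0 < e ->
  exists2 M : R, 0 <= M & forall x,
    `|u x - u a| <= e + M * \sum_(j < d) (1 - cos (tau * (x ord0 j - a ord0 j))).
Proof.
move=> pu cu e e0; have [c hc] := torus_bounded pu cu.
have c0 : 0 <= c by exact: le_trans (hc a).
have := cu a => /cvgrPdist_le /(_ e e0).
move=> /nbhs_ballP[eta0 /= eta00 heta].
pose eta := Num.min (eta0 / 2) (1 / 4).
have eta_gt0 : 0 < eta by rewrite lt_min divr_gt0//=.
have eta_lt : eta < eta0 by rewrite gt_min; apply/orP; left; lra.
(* This keeps [tau * eta] within [0, pi], where the cosine decreases. *)
have eta4 : eta <= 1 / 4 by rewrite ge_min lexx orbT.
have pi0 := pi_gt0 R.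
have w0 : 0 < 1 - cos (tau * eta).
  have h1 : 0 < tau * eta by rewrite mulr_gt0// mulrn_wgt0.
  have h2 : tau * eta <= pi by rewrite mulr2n; nra.
  by rewrite subr_gt0 -[ltRHS]cos0 ltr_cos// in_itv/= ?lexx ?(ltW pi0) ?h2 ?(ltW h1).
exists (2 * c / (1 - cos (tau * eta))); first by rewrite divr_ge0 ?mulr_ge0// ltW.
(* Rounding to the nearest integer: the translate [y] of [x] has every coordinate within 1/2 of that
   of [a]. *)
move=> x; pose k : 'rV[int]_d := \row_j - Num.floor (x ord0 j - a ord0 j + 1 / 2).
pose y := x + map_mx intr k.
have uy : u y = u x by exact: torus_periodic_int.
have wE j : 1 - cos (tau * (x ord0 j - a ord0 j)) = 1 - cos (tau * (y ord0 j - a ord0 j)).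
  congr (1 - _); rewrite /y !mxE -(cos_period (tau * (x ord0 j - a ord0 j)) (k ord0 j)).
  by rewrite mxE; congr cos; ring.
have yj j : `|y ord0 j - a ord0 j| <= 1 / 2.
  have /andP[h1 h2] := real_floor_itv (num_real (x ord0 j - a ord0 j + 1 / 2)).
  move: h1 h2; rewrite /y !mxE mulrNz intrD ler_norml.
  set f : R := (Num.floor _)%:~R => h1 h2; apply/andP; split; lra.
have wge j : 0 <= 1 - cos (tau * (x ord0 j - a ord0 j)).
  by rewrite subr_ge0 cos_le1.
have S0 : 0 <= \sum_(j < d) (1 - cos (tau * (x ord0 j - a ord0 j))) by exact: sumr_ge0.
have M0 : 0 <= 2 * c / (1 - cos (tau * eta)) by rewrite divr_ge0 ?mulr_ge0// ltW.
have [|] := pselect (forall j, `|y ord0 j - a ord0 j| < eta).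
  move=> hy; apply: (@le_trans _ _ e); last by rewrite lerDl mulr_ge0.
  rewrite -uy distrC; apply: heta; split => // i j.
  rewrite [i]ord1 /ball /= distrC; exact: lt_trans (hy j) eta_lt.
move=> /existsNP[j /negP]; rewrite -leNgt => hj.
apply: (@le_trans _ _ (2 * c)).
  by apply: le_trans (ler_normB _ _) _; have := hc x; have := hc a; lra.
apply: (@le_trans _ _ (2 * c / (1 - cos (tau * eta)) * (1 - cos (tau * eta)))).
  by rewrite divfK// gt_eqF.
rewrite -[leLHS]add0r; apply: lerD; first exact: ltW.
rewrite ler_wpM2l//.
apply: (@le_trans _ _ (1 - cos (tau * (x ord0 j - a ord0 j)))); last first.
  by rewrite (bigD1 j)//= lerDl sumr_ge0.
rewrite wE lerD2l lerN2 -[leLHS]cos_norm normrM ger0_norm; last by rewrite mulrn_wge0 ?ltW.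
have yj2 := yj j.
rewrite le_eqVlt; move: hj; rewrite le_eqVlt => /orP[/eqP ->|hj]; first by rewrite eqxx.
apply/orP; right; rewrite ltr_cos ?in_itv/=.
- by rewrite ltr_pM2l// mulrn_wgt0.
- by apply/andP; split; rewrite mulr2n; nra.
- by apply/andP; split; rewrite mulr2n; nra.
Qed.

(** For a product [psi] of kernels centred at [a], the value [u a] is the integral of [u * psi]
    minus that of [(u - u a) * psi]. The first is bounded independently of [r]; the second is made
    smaller than [e] by letting [r] approach 1. *)
Theorem torus_sup_bound k u : (d <= k)%N -> torus_periodic u -> continuous u ->
  Hk k u -> forall a, `|u a| <= 2 ^+ d * Num.sqrt (sqn k u).
Proof.
move=> dk pu cu hu a; apply/ler_addgt0Pr => e e0.
have e2 : 0 < e / 2 by rewrite divr_gt0.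
have [M M0 hM] := periodic_modulus a pu cu e2.
have Md0 : 0 <= M * d%:R by rewrite mulr_ge0.
(* The bound 1/2 gives [kappa <= 2 * t]; the other one makes the [d] concentration errors, each at
   most [M * kappa], sum to at most [e / 2]. *)
pose t := Num.min (1 / 2) ((e / 2) / (2 * (M * d%:R + 1))).
have den0 : 0 < 2 * (M * d%:R + 1) by lra.
have t0 : 0 < t by rewrite lt_min divr_gt0//= divr_gt0.
have t2 : t <= 1 / 2 by rewrite ge_min lexx.
have te : t * (2 * (M * d%:R + 1)) <= e / 2.
  by rewrite -ler_pdivlMr// ge_min lexx orbT.
pose r := 1 - t.
have r01 : 0 < r < 1 by apply/andP; split; rewrite /r; lra.
pose kappa := (1 - r ^+ 2) / (2 * r).
have kt : kappa <= 2 * t.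
  by case/andP: r01 => r0 r1; rewrite ler_pdivrMr ?mulr_gt0// /r; nra.
pose s := enum 'I_d; pose psi := poisson_prod r a s.
have us : uniq s by exact: enum_uniq.
have tpsi s' : torus_test (poisson_prod r a s') by exact: torus_test_poisson_prod.
have ipsi s' : mu.-integrable setT (EFin \o poisson_prod r a s').
  exact: (L2_integrable (torus_measure_fin R d) (torus_test_L2 (tpsi s'))).
have Lu := sobolev_L2 hu.
have iupsi : mu.-integrable setT (EFin \o (fun x => u x * psi x)).
  exact: L2_prod Lu (torus_test_L2 (tpsi s)).
have Ipsi : \int[mu]_x psi x = 1 by exact: integral_poisson_prod.
have h1 : `|\int[mu]_x (u x * psi x)| <= 2 ^+ d * Num.sqrt (sqn k u).
  have := @poisson_prod_bound R d r a r01 s k u (fun=> 1) us _ hu (torus_test1 R d) _ _.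
  rewrite /ipL2 size_enum_ord => H.
  rewrite (_ : \int[mu]_x (u x * psi x) = \int[mu]_x (u x * (1 * poisson_prod r a s x))).
    by apply: H => // [x|j _ x]; [rewrite normr1|rewrite (_ : (fun _ => 1) = cst 1)// derive_cst].
  by apply: eq_Rintegral => x _; rewrite mul1r.
have iMk j : mu.-integrable setT (EFin \o (fun x => M * kappa * poisson_prod r a (rem j s) x)).
  exact: (integrableZl measurableT (M * kappa) (ipsi (rem j s))).
have [is_ sE] := Rintegral_seq_sum s iMk.
have ig := integrable_lin (e / 2) (ipsi s) is_.
(* In the summand [j] the weight 1 - cos is paired with the kernel of the same coordinate; the
   product of the other kernels still has integral 1. *)
have ud x : `|(- u a) * psi x + u x * psi x| <= e / 2 * psi x +
    \sum_(j <- s) M * kappa * poisson_prod r a (rem j s) x.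
  rewrite -mulrDl normrM [`|psi x|]ger0_norm; last exact: ltW (poisson_prod_gt0 _ r01 _ _).
  rewrite [- u a + _]addrC; apply: le_trans (ler_wpM2r _ (hM x)) _.
    exact: ltW (poisson_prod_gt0 _ r01 _ _).
  rewrite mulrDl lerD2l -mulrA mulr_suml mulr_sumr -big_enum /=.
  apply: ler_sum => j _; rewrite -mulrA ler_wpM2l//.
  rewrite /psi /poisson_prod (big_rem j) ?mem_enum//= mulrA ler_wpM2r//.
    exact: ltW (poisson_prod_gt0 _ r01 _ _).
  exact: poisson_concentration.
have L1 : \int[mu]_x (- u a * psi x + u x * psi x) = - u a + \int[mu]_x (u x * psi x).
  by apply: eq_trans (Rintegral_lin (- u a) (ipsi s) iupsi) _; congr (_ + _); rewrite -[RHS]mulr1; congr (_ * _).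
have h2 : `|\int[mu]_x (- u a * psi x + u x * psi x)| <= e.
  have iud := integrable_lin (- u a) (ipsi s) iupsi.
  apply: le_trans (le_normr_Rintegral measurableT iud) _.
  apply: (@le_trans _ _ (\int[mu]_x (e / 2 * psi x +
      \sum_(j <- s) M * kappa * poisson_prod r a (rem j s) x))).
    apply: le_Rintegral => //.
    by have := integrable_norm iud; apply: eq_integrable.
  apply: (@le_trans _ _ (e / 2 * 1 + \sum_(j <- s) \int[mu]_x (M * kappa * poisson_prod r a (rem j s) x))).
    by rewrite -sE; apply: eq_leW; apply: eq_trans (Rintegral_lin (e / 2) (ipsi s) is_) _; congr (_ * _ + _).
  rewrite mulr1.
  rewrite (eq_bigr (fun=> M * kappa)); last first.
    by move=> j _; rewrite RintegralZl// integral_poisson_prod ?mulr1 ?rem_uniq.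
  rewrite big_const_seq count_predT size_enum_ord iter_addr_0 -mulr_natr.
  have : M * kappa * d%:R <= M * d%:R * (2 * t).
    by rewrite mulrAC ler_wpM2l.
  by nra.
have -> : u a = \int[mu]_x (u x * psi x) - (- u a + \int[mu]_x (u x * psi x)) by ring.
apply: le_trans (ler_normB _ _) _; apply: lerD => //.
by rewrite -L1.
Qed.

End SupBound.

Lemma sqnormL2_le_mul d (T : measurableType d) (R : realType)
    (mu : {measure set T -> \bar R}) (c : R) (u v : T -> R) :
  u \in Lfun mu 2%:E -> v \in Lfun mu 2%:E -> (forall x, `|u x| <= c * `|v x|) ->
  sqnormL2 mu u <= c ^+ 2 * sqnormL2 mu v.
Proof.
move=> hu hv uv; rewrite /sqnormL2 -RintegralZl//; last exact: L2_sqr.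
apply: le_Rintegral => //.
- exact: L2_sqr.
- exact: (integrableZl measurableT (c ^+ 2) (L2_sqr hv)).
move=> x _; rewrite -(real_normK (num_real (u x))) -(real_normK (num_real (v x))) -exprMn.
by rewrite lerXn2r// ?nnegrE ?normr_ge0// (le_trans _ (uv x)).
Qed.

Lemma cvg_sq_le (R : realType) (V V' : lmodType R) (N : V -> R) (N' : V' -> R)
    (u : nat -> V) l (v : nat -> V') m (K : R) n1 :
  (forall n, (n1 <= n)%N -> N' (v n - m) <= K * N (u n - l)) ->
  (forall n, 0 <= N (u n - l)) -> cvg_sq N u l -> cvg_sq N' v m.
Proof.
move=> h N0 c e e0; have K0 : 0 < `|K| + 1 by rewrite ltr_wpDl.
have [n0 h0] := c _ (divr_gt0 e0 K0).
exists (maxn n0 n1) => n; rewrite geq_max => /andP[/h0 a /h b].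
apply: le_trans b _; move: a; rewrite ler_pdivlMr//.
apply: le_trans; rewrite mulrC ler_wpM2l//.
by apply: le_trans (ler_norm K) _; rewrite lerDl.
Qed.

Lemma continuous_bounded_itv (R : realType) (g : R -> R) (a b : R) :
  {within `[a, b], continuous g} ->
  exists c : R, 0 <= c /\ forall x, a <= x <= b -> `|g x| <= c.
Proof.
move=> cg; have [ab|ba] := leP a b; last first.
  exists 0; split=> // x /andP[ax xb]; move: (le_trans ax xb).
  by rewrite leNgt ba.
have cn : {within `[a, b], continuous (fun x => `|g x|)}.
  by move=> x; apply: (continuous_comp (cg x)); exact: norm_continuous.
have [c cab hc] := EVT_max ab cn.
exists `|g c|; split=> // x xab; apply: hc; by rewrite in_itv.
Qed.

Lemma derive_lipschitz (R : realType) (g g' : R -> R) (a b c : R) :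
  (forall x : R, is_derive x (1 : R) g (g' x)) ->
  (forall x, a <= x <= b -> `|g' x| <= c) ->
  forall x y, a <= x <= b -> a <= y <= b -> `|g x - g y| <= c * `|x - y|.
Proof.
move=> dg hc; suff H x y : a <= x -> x <= y -> y <= b -> `|g x - g y| <= c * `|x - y|.
  move=> x y /andP[ax xb] /andP[ay yb]; have [xy|/ltW yx] := leP x y; first exact: H.
  by rewrite distrC [`|x - y|]distrC; exact: H.
move=> ax xy yb.
have cg : {within `[x, y], continuous g}.
  apply: derivable_within_continuous => z _; have := dg z; exact: @ex_derive.
have [z + E] := MVT_segment xy (fun z _ => dg z) cg.
rewrite in_itv/= => /andP[xz zy].
rewrite distrC E normrM [`|y - x|]distrC ler_wpM2r// hc//.
by rewrite (le_trans ax xz) (le_trans zy yb).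
Qed.

Lemma is_derive_continuous (R : realType) (g g' : R -> R) :
  (forall x : R, is_derive x (1 : R) g (g' x)) -> continuous g.
Proof.
move=> dg x; apply: differentiable_continuous; apply/derivable1_diffP.
by have := dg x; exact: @ex_derive.
Qed.

(** * The weak chain rule on the torus *)

Section ChainRule.
Variables (R : realType) (d : nat).
Local Notation mu := (torus_measure R d).
Local Notation W := (torus_weak_derivation R d).
Local Notation sqn := (sobolev_sqnorm mu (@torus_wd R d)).
Implicit Types (u v : 'rV[R]_d -> R) (x a : 'rV[R]_d).

Lemma H3_bound u x : (d <= 3)%N -> H3 u -> `|u x| <= 2 ^+ 3 * Hk_norm 3 u.
Proof.
move=> d3 [pu cu hu]; apply: le_trans (torus_sup_bound d3 pu cu hu x) _.
by rewrite ler_wpM2r ?sqrtr_ge0// ler_weXn2l// ler1n.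
Qed.

Lemma continuous_rowB u v : continuous u -> continuous v -> continuous (fun x => u x - v x).
Proof. by move=> cu cv x; exact: (cvgB (cu x) (cv x)). Qed.

Lemma continuous_row_comp (f : R -> R) u :
  continuous f -> continuous u -> continuous (fun x => f (u x)).
Proof. by move=> cf cu x; exact: (continuous_comp (cu x) (cf (u x))). Qed.

Lemma pd_L2 k i u : Hk k.+1 u -> pd i u \in Lfun mu 2%:E.
Proof. by move=> hu; rewrite /pd; exact: (wpartial_L2 i hu). Qed.

Lemma pd_lin k i (a : R) u v : Hk k.+1 u -> Hk k.+1 v ->
  \forall x \ae mu, pd i (fun x => a * u x + v x) x = a * pd i u x + pd i v x.
Proof. by move=> hu hv; rewrite /pd; exact: (wpartial_lin W i a hu hv). Qed.

Lemma torus_test_comp (f f' : R -> R) u :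
  (forall s : R, is_derive s (1 : R) f (f' s)) -> continuous f' -> torus_test u ->
  torus_test (fun x => f (u x)) /\ forall i x,
    'D_(delta_mx 0 i) (fun x => f (u x)) x = f' (u x) * 'D_(delta_mx 0 i) u x.
Proof.
move=> df cf' tu; have cu := torus_test_continuous tu; case: tu => pu du Du.
have dfs s : differentiable f s.
  by apply/derivable1_diffP; have := df s; exact: @ex_derive.
have D i x : 'D_(delta_mx 0 i) (fun x => f (u x)) x = f' (u x) * 'D_(delta_mx 0 i) u x.
  rewrite deriveE; last exact: (differentiable_comp (du x) (dfs _)).
  rewrite (diff_comp (du x) (dfs (u x))) /= diff1E// [in RHS]deriveE//.
  rewrite derive1E; have -> : 'D_1 f (u x) = f' (u x) by have := df (u x); exact: @derive_val.
  by rewrite mulrC.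
split=> //; split.
- by move=> i x; rewrite pu.
- by move=> x; exact: (differentiable_comp (du x) (dfs _)).
move=> i; have -> : (fun x => 'D_(delta_mx 0 i) (fun x => f (u x)) x) =
    (fun x => f' (u x) * 'D_(delta_mx 0 i) u x) by apply/funext => x; exact: D.
by move=> x; exact: (cvgM (continuous_comp (cu x) (cf' (u x))) (Du i x)).
Qed.

(* d <= 3 makes the trigonometric approximations of u in H^3 converge
   uniformly, so that f and f' only matter on a bounded interval *)
Lemma has_wpartial_comp (f f' f'' : R -> R) u i : (d <= 3)%N -> H3 u ->
  (forall s : R, is_derive s (1 : R) f (f' s)) ->
  (forall s : R, is_derive s (1 : R) f' (f'' s)) -> continuous f'' ->
  has_wpartial mu (@torus_wd R d) i (fun x => f (u x)) (fun x => f' (u x) * pd i u x).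
Proof.
move=> d3 hu df df' cf''; have [pu cu su] := hu.
have [c hc] := torus_bounded pu cu.
have cf' := is_derive_continuous df'; have cf := is_derive_continuous df.
have [w [tw cw]] := trig_dense (su : isSob mu (@torus_wd R d) 3 (u : 'rV[R]_d -> R^o)).
have Tw n : torus_test (w n) by exact: torus_test_trig.
have Sw n : Hk 3 (w n) by exact: trig_Hk.
pose K : R := 2 ^+ d; have K0 : 0 <= K by rewrite exprn_ge0.
have Swu n : Hk 3 (w n - u) by exact: (quad_sub (isSob_lin W (k := 3)) (Sw n) su).
have wu n x : `|w n x - u x| <= K * Num.sqrt (sqn 3 (w n - u)).
  have pwu : torus_periodic (w n - u).
    by case: (Tw n) => pw _ _ j y; rewrite !fctE pu pw.
  have cwu : continuous (w n - u : 'rV[R]_d -> R).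
    exact: (continuous_rowB (torus_test_continuous (Tw n)) cu).
  exact: (torus_sup_bound d3 pwu cwu (Swu n) x).
have [n1 hn1] : exists n1, forall n, (n1 <= n)%N -> forall x, `|w n x - u x| <= 1.
  have [|n1 h] := cw ((K + 1) ^- 2); first by rewrite invr_gt0 exprn_gt0// ltr_wpDl.
  exists n1 => n /h {}h x; apply: le_trans (wu n x) _.
  apply: (@le_trans _ _ (K * (K + 1)^-1)); last first.
    by rewrite ler_pdivrMr ?mul1r ?lerDl// ltr_wpDl.
  rewrite ler_wpM2l//; move: h; rewrite -ler_sqrt; last by rewrite invr_ge0 exprn_ge0// addr_ge0.
  by rewrite -exprVn sqrtr_sqr ger0_norm// invr_ge0 addr_ge0.
(* Values of [u] stay in [-c, c] and those of late approximations in [-(c+1), c+1]; the bounds on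
   [f'] and [f''] are taken on the larger interval. *)
have cwithin (g : R -> R) : continuous g -> {within `[- (c + 1), c + 1], continuous g}.
  by move=> cg; exact: continuous_subspaceT.
have [C [C0 hC]] := continuous_bounded_itv (cwithin _ cf').
have [L [L0 hL]] := continuous_bounded_itv (cwithin _ cf'').
have hu1 x : - (c + 1) <= u x <= c + 1.
  by move: (hc x); rewrite ler_norml => /andP[h1 h2]; apply/andP; split; lra.
have hw1 n x : (n1 <= n)%N -> - (c + 1) <= w n x <= c + 1.
  move=> /hn1/(_ x); move: (hc x); rewrite !ler_norml => /andP[h1 h2] /andP[h3 h4].
  by apply/andP; split; lra.
have fin := torus_measure_fin R d.
have bnd (g : R -> R) : continuous g -> measurable_fun setT (fun x => g (u x)) /\
    exists k : R, forall x, `|g (u x)| <= k.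
  move=> cg; have [k [k0 hk]] := continuous_bounded_itv (cwithin _ cg).
  split; last by exists k => x; exact: hk.
  by apply: measurable_continuous_row => x; exact: (continuous_comp (cu x) (cg _)).
have Lu j : pd j u \in Lfun mu 2%:E by exact: pd_L2 su.
have Lwi n : pd i (w n) \in Lfun mu 2%:E by exact: pd_L2 (Sw n).
have Lfu : (fun x => f (u x)) \in Lfun mu 2%:E.
  by have [m [k hk]] := bnd _ cf; exact: (L2_bounded fin m hk).
have Lfdu : (fun x => f' (u x) * pd i u x) \in Lfun mu 2%:E.
  by have [m [k hk]] := bnd _ cf'; exact: (L2_bounded_mul m hk).
have Tfw n := (torus_test_comp df cf' (Tw n)).1.
have cfw n : continuous (fun x => f' (w n x)).
  exact: (continuous_row_comp cf' (torus_test_continuous (Tw n))).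
have hfw n : has_wpartial mu (@torus_wd R d) i (fun x => f (w n x))
    (fun x => f' (w n x) * pd i (w n) x).
  have := torus_test_has_wpartial i (Tfw n).
  apply: (has_wpartial_ae_r W).
    have [k hk] : exists k : R, forall x, `|f' (w n x)| <= k.
      by apply: torus_bounded (cfw n) => j y; case: (Tw n) => pw _ _; rewrite pw.
    exact: (L2_bounded_mul (measurable_continuous_row (cfw n)) hk).
  apply: filterS (wpartial_torus_test i (Tw n)) => x ->.
  by rewrite (torus_test_comp df cf' (Tw n)).2.
have fw n x : (n1 <= n)%N -> `|f (w n x) - f (u x)| <= C * `|w n x - u x|.
  by move=> nn; apply: derive_lipschitz df hC _ _ (hw1 _ _ nn) (hu1 _).
have f'w n x : (n1 <= n)%N -> `|f' (w n x) - f' (u x)| <= L * `|w n x - u x|.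
  by move=> nn; apply: derive_lipschitz df' hL _ _ (hw1 _ _ nn) (hu1 _).
have Lwu n : (w n - u : 'rV[R]_d -> R) \in Lfun mu 2%:E by exact: sobolev_L2 (Swu n).
have Lg n : (fun x => f' (w n x) * pd i (w n) x) \in Lfun mu 2%:E by case: (hfw n).
have Lf n : (fun x => f (w n x)) \in Lfun mu 2%:E by exact/torus_test_L2.
pose Nw (z : 'rV[R]_d -> R^o) := sqn 3 z.
apply: (has_wpartial_closed W (u_ := fun n x => f (w n x))
  (g_ := fun n x => f' (w n x) * pd i (w n) x)) => //.
- apply: (@cvg_sq_le _ _ _ Nw _ w u _ _ (C ^+ 2) n1) => // [n nn|n]; last exact: sobolev_sqnorm_ge0.
  apply: (@le_trans _ _ (C ^+ 2 * sqnormL2 mu (w n - u : 'rV[R]_d -> R))).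
    apply: sqnormL2_le_mul => //; first exact: (quad_sub (@isL2_lin _ _ _ mu) (Lf n) Lfu).
    by move=> x; exact: fw.
  by rewrite ler_wpM2l ?exprn_ge0// sqnormL2_le_sobolev.
pose P := sqnormL2 mu (pd i u).
apply: (@cvg_sq_le _ _ _ Nw _ w u _ _ (2 * C ^+ 2 + 2 * ((L * K) ^+ 2 * P)) n1) => // [n nn|n]; last exact: sobolev_sqnorm_ge0.
(* In [A] the factor [f' (w n x)] is bounded by [C] and the derivatives converge in L^2; in [B] the
   first factor is uniformly small and [pd i u] is a fixed L^2 function. They account for the two
   halves of the constant above. *)
pose A : 'rV[R]_d -> R^o := fun x => f' (w n x) * (pd i (w n) x - pd i u x).
pose B : 'rV[R]_d -> R^o := fun x => (f' (w n x) - f' (u x)) * pd i u x.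
have Ldiff : (fun x => pd i (w n) x - pd i u x) \in Lfun mu 2%:E.
  exact: (quad_sub (@isL2_lin _ _ _ mu) (Lwi n) (Lu i)).
have hA : isL2 mu A.
  apply: (@L2_bounded_mul _ _ _ mu C (fun x => f' (w n x))) => //.
    exact: measurable_continuous_row (cfw n).
  by move=> x; exact: hC (hw1 _ _ nn).
have sK : K * Num.sqrt (sqn 3 (w n - u)) >= 0 by rewrite mulr_ge0 ?sqrtr_ge0.
have bB x : `|f' (w n x) - f' (u x)| <= L * (K * Num.sqrt (sqn 3 (w n - u))).
  by apply: le_trans (f'w n x nn) _; rewrite ler_wpM2l.
have hB : isL2 mu B.
  apply: (L2_bounded_mul _ bB) => //; apply: measurable_funB.
    exact: measurable_continuous_row (cfw n).
  by case: (bnd _ cf').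
have -> : (fun x => f' (w n x) * pd i (w n) x) - (fun x => f' (u x) * pd i u x) = A + B.
  by apply/funext => x; rewrite /A /B !fctE; lra.
apply: le_trans (quad_sqD (@isL2_lin _ _ _ mu) (@sqnormL2_ge0 _ _ _ mu) (@isL2_NE _ _ _ mu) hA hB) _.
rewrite [leRHS]mulrDl; apply: lerD.
  rewrite -mulrA ler_wpM2l//.
  apply: (@le_trans _ _ (C ^+ 2 * sqnormL2 mu (fun x => pd i (w n) x - pd i u x))).
    apply: sqnormL2_le_mul => // x; rewrite normrM ler_wpM2r//.
    exact: hC (hw1 _ _ nn).
  rewrite ler_wpM2l ?exprn_ge0//; apply: le_trans (@sqn_wpartial_le _ _ _ mu _ (@torus_wd R d) 2 (w n - u) i).
  apply: le_trans (@sqnormL2_le_sobolev _ _ _ mu _ (@torus_wd R d) 2 _).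
  apply: eq_leW; apply: sqnormL2_ae => //; first exact: (pd_L2 i (Swu n)).
  have E := pd_lin i (-1) su (Sw n); rewrite fct_subE -/(pd i _).
  by apply: filterS E => x ->; lra.
rewrite -mulrA ler_wpM2l//.
apply: le_trans (sqnormL2_le_mul hB (Lu i) (c := L * (K * Num.sqrt (sqn 3 (w n - u)))) _) _.
  by move=> x; rewrite normrM ler_wpM2r.
rewrite mulrA exprMn sqr_sqrtr ?sobolev_sqnorm_ge0//.
by rewrite /Nw /P; apply: eq_leW; ring.
Qed.

End ChainRule.

(** * Sobolev spaces on an interval *)

Section RestrictedMeasure.
Context d (T : measurableType d) (R : realType).
Variables (mu : {measure set T -> \bar R}) (D : set T) (mD : measurable D).
Local Notation nu := (mrestr mu mD).
Local Open Scope ereal_scope.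

Lemma mrestr_ae (P : T -> Prop) : (\forall x \ae mu, D x -> P x) -> \forall x \ae nu, P x.
Proof.
move=> [N [mN N0 hN]]; exists (N `|` ~` D); split.
- by apply: measurableU => //; exact: measurableC.
- rewrite /= /mrestr setIUl setICl setU0; apply: subset_measure0 N0 => //.
    exact: measurableI.
- move=> x /= Px; have [Dx|] := pselect (D x); last by right.
  by left; apply: hN => /= /(_ Dx).
Qed.

Import HBNNSimple.

(** No measurability is assumed of [f], because the integration by parts identity on an interval is
    stated for arbitrary functions and must be matched with inner products as it stands. For
    nonnegative functions the integral is a supremum over simple functions, and each of these may be
    cut off outside [D]. *)
Lemma integral_mrestr (f : T -> \bar R) : \int[nu]_x f x = \int[mu]_(x in D) f x.
Proof.
have -> : \int[mu]_(x in D) f x = \int[nu]_(x in D) f x.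
  by apply: eq_measure_integral => A mA AD; rewrite /= /mrestr (setIidl AD).
have ge0 (g : T -> \bar R) : (forall x, 0 <= g x) -> \int[nu]_x g x = \int[nu]_x (g \_ D) x.
  move=> g0; rewrite !ge0_integralTE//; last first.
    by move=> x; rewrite /patch; case: ifP.
  congr ereal_sup; apply/seteqP; split => _ [h hg <-]; last first.
    exists h => // x; apply: le_trans (hg x) _; rewrite /patch.
    by case: ifP.
  exists (proj_nnsfun h mD) => [x|].
    have := hg x; rewrite -mrestrict /patch; case: ifP => //.
  rewrite -!integralT_nnsfun; apply: ae_eq_integral => //.
  - by apply/measurable_EFinP.
  - by apply/measurable_EFinP.
  - by apply: mrestr_ae; apply: aeW => x Dx _; rewrite -mrestrict /patch mem_set.
rewrite integralE [RHS]integralE; congr (_ - _).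
  by rewrite ge0// [RHS]integral_mkcond.
by rewrite ge0// [RHS]integral_mkcond.
Qed.

Lemma Rintegral_mrestr (f : T -> R) : (\int[nu]_x f x = \int[mu]_(x in D) f x)%R.
Proof. by rewrite /Rintegral integral_mrestr. Qed.

Lemma integrable_of_mrestr (f : T -> \bar R) :
  nu.-integrable setT f -> mu.-integrable D f.
Proof.
move=> /integrableP[mf If]; apply/integrableP; split.
  exact: measurable_funTS.
by rewrite -integral_mrestr.
Qed.

End RestrictedMeasure.

Section C1Functions.
Variable R : realType.
Implicit Types (u v : R -> R) (s x h : R).

Lemma is_derive_C1 u u' : (forall x : R, is_derive x (1 : R) u (u' x)) ->
  (forall x, derivable u x 1) /\ derive1 u = u'.
Proof.
move=> du; split; first by move=> x; have := du x; exact: @ex_derive.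
by apply/funext => x; rewrite derive1E; have := du x; exact: @derive_val.
Qed.

Lemma derivable_is_derive u : (forall x, derivable u x 1) ->
  forall x : R, is_derive x (1 : R) u (derive1 u x).
Proof. by move=> du x; rewrite derive1E; apply: DeriveDef. Qed.

(** Meant for [sqpos]: a quadratic remainder yields the derivative at the kink without one-sided
    limits. *)
Lemma is_derive_sq_remainder u x l :
  (exists c : R, forall h, `|u (h + x) - u x - l * h| <= c * h ^+ 2) ->
  is_derive x (1 : R) u l.
Proof.
move=> [c hc].
have c0 : 0 <= c by have := hc 1; rewrite expr1n !mulr1; apply: le_trans; exact: normr_ge0.
have cvu : h^-1 *: ((u \o shift x) (h *: 1) - u x) @[h --> 0^'] --> l.
  apply/cvgrPdist_le => e e0; have d0 : 0 < e / (c + 1) by rewrite divr_gt0 ?ltr_wpDl.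
  near=> h; have h0 : h != 0 by near: h; exact: nbhs_dnbhs_neq.
  have hd : `|h| <= e / (c + 1).
    by near: h; apply: dnbhs0_le.
  rewrite /= [h *: 1]mulr1 /GRing.scale /=.
  have -> : l - h^-1 * (u (h + x) - u x) = - (h^-1 * (u (h + x) - u x - l * h)).
    by field.
  rewrite normrN normrM normfV mulrC ler_pdivrMr ?normr_gt0//.
  apply: le_trans (hc h) _; rewrite -(real_normK (num_real h)) expr2 mulrA.
  rewrite ler_wpM2r//; apply: le_trans (ler_wpM2l c0 hd) _.
  rewrite mulrA ler_pdivrMr ?ltr_wpDl//; nra.
by split; [apply/cvg_ex; exists l | apply: cvg_lim].
Unshelve. all: by end_near. Qed.

Definition sqpos s : R := (Num.max s 0) ^+ 2.

Lemma is_derive_sqpos s : is_derive s (1 : R) sqpos (2 * Num.max s 0).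
Proof.
apply: is_derive_sq_remainder; exists 1 => h; rewrite mul1r ler_norml /sqpos.
case: (ltP s 0) => s0; case: (ltP (h + s) 0) => hs0; apply/andP; split; nra.
Qed.

Lemma continuous_pos : continuous (fun s => Num.max s 0).
Proof. by move=> s; apply: continuous_max; [exact: cvg_id|exact: cvg_cst]. Qed.

Lemma sqpos_gt0 s : 0 < s -> 0 < sqpos s.
Proof. by move=> s0; rewrite /sqpos exprn_gt0// lt_max s0. Qed.

Lemma sqpos_le0 s : s <= 0 -> sqpos s = 0.
Proof. by move=> s0; rewrite /sqpos; have [] := leP s 0 => //; rewrite ?expr0n//; lra. Qed.

Lemma sqpos_ge0 s : 0 <= sqpos s.
Proof. exact: sqr_ge0. Qed.

Lemma is_derive_translate u u' c x : (forall y : R, is_derive y (1 : R) u (u' y)) ->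
  is_derive x (1 : R) (fun y => u (y - c)) (u' (x - c)).
Proof.
move=> du; have d1 : is_derive x (1 : R) (fun y : R => y - c) (1 - 0).
  exact: (is_deriveB (is_derive_id x 1) (is_derive_cst c x 1)).
have := du (x - c) => d2; apply: (is_derive_eq (@is_derive1_comp _ u (fun y => y - c) x _ _ d2 d1)).
by rewrite subr0 /GRing.scale /= mulr1.
Qed.

Lemma is_derive_reflect u u' c x : (forall y : R, is_derive y (1 : R) u (u' y)) ->
  is_derive x (1 : R) (fun y => u (c - y)) (- u' (c - x)).
Proof.
move=> du; have d1 : is_derive x (1 : R) (fun y : R => c - y) (0 - 1).
  exact: (is_deriveB (is_derive_cst c x 1) (is_derive_id x 1)).
have := du (c - x) => d2; apply: (is_derive_eq (@is_derive1_comp _ u (fun y => c - y) x _ _ d2 d1)).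
by rewrite sub0r /GRing.scale /= mulrN1.
Qed.

End C1Functions.

Section IntervalSobolev.
Variables (R : realType) (a b : R).
Local Notation nu := (itv_measure a b).
Implicit Types (u v q : R -> R) (x : R).

Definition itv_tests (_ : unit) (p q : R -> R) : Prop := itv_test a b q /\ p = derive1 q.

Definition C1_bounded q : Prop :=
  [/\ forall x, derivable q x 1, continuous (derive1 q) &
      exists c : R, forall x, `|q x| <= c].

Lemma continuous_derivable u : (forall x, derivable u x 1) -> continuous u.
Proof. by move=> du; exact: (is_derive_continuous (derivable_is_derive du)). Qed.

Lemma itv_test_continuous u : itv_test a b u -> continuous u.
Proof. by case=> du _ _; exact: continuous_derivable. Qed.

Lemma bounded_compact_support u a' b' : continuous u ->
  (forall x, u x != 0 -> a' <= x <= b') -> exists c : R, forall x, `|u x| <= c.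
Proof.
move=> cu su; have [c [c0 hc]] := @continuous_bounded_itv _ u a' b' (continuous_subspaceT cu).
exists c => x; have [->|/su] := eqVneq (u x) 0; [by rewrite normr0|exact: hc].
Qed.

Lemma itv_test_bounded u : itv_test a b u ->
  measurable_fun setT u /\ exists c : R, forall x, `|u x| <= c.
Proof.
move=> tu; have cu := itv_test_continuous tu; split; first exact: continuous_measurable_fun.
by case: tu => _ _ [a' [b' [_ _ h]]]; exact: bounded_compact_support h.
Qed.

Lemma itv_test_derive1_support u a' b' : (forall x, derivable u x 1) ->
  (forall x, u x != 0 -> a' <= x <= b') -> forall x, derive1 u x != 0 -> a' <= x <= b'.
Proof.
move=> du su x; apply: contra_neqT; rewrite negb_and -!ltNge => hx.
have nx : \forall y \near x, u y = 0.
  have zero y : ~~ (a' <= y <= b') -> u y = 0.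
    by move=> /negP hy; apply/eqP; apply: contrapT => /negP /su.
  case/orP: hx => hx; near=> y; apply: zero; rewrite negb_and -!ltNge.
    by apply/orP; left; near: y; exact: lt_nbhsl.
  by apply/orP; right; near: y; exact: lt_nbhsr.
rewrite derive1E; have -> : 'D_1 u x = 'D_1 (cst 0 : R -> R) x.
  by apply: near_eq_derive => //; rewrite oner_neq0.
by rewrite derive_cst.
Unshelve. all: by end_near. Qed.

Lemma itv_test_derive1_bounded u : itv_test a b u ->
  measurable_fun setT (derive1 u) /\ exists c : R, forall x, `|derive1 u x| <= c.
Proof.
move=> [du cu [a' [b' [_ _ h]]]]; split; first exact: continuous_measurable_fun.
exact: bounded_compact_support (itv_test_derive1_support du h).
Qed.

Lemma C1_bounded_measurable q : C1_bounded q ->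
  measurable_fun setT q /\ exists c : R, forall x, `|q x| <= c.
Proof.
by case=> dq _ bq; split => //; apply: continuous_measurable_fun; exact: continuous_derivable.
Qed.

Lemma itv_test_mul q u : (forall x, derivable q x 1) -> continuous (derive1 q) ->
  itv_test a b u -> itv_test a b (fun x => q x * u x) /\
  derive1 (fun x => q x * u x) = (fun x => derive1 q x * u x + q x * derive1 u x).
Proof.
move=> dq cq [du cu [a' [b' [aa bb h]]]].
have D x : is_derive x (1 : R) (fun x => q x * u x) (derive1 q x * u x + q x * derive1 u x).
  have h1 := derivable_is_derive dq x; have h2 := derivable_is_derive du x.
  by apply: (is_derive_eq (is_deriveM h1 h2)); rewrite /GRing.scale /=; ring.
have [dqu E] := is_derive_C1 D; split; last exact: E.
split; first exact: dqu.
  rewrite E => x.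
  exact: (cvgD (cvgM (cq x) (continuous_derivable du (x := x)))
               (cvgM (continuous_derivable dq (x := x)) (cu x))).
exists a', b'; split => // x qu; apply: h; apply: contraNneq qu => ->.
by rewrite mulr0.
Qed.

(** With w(x) the square of the positive part of x - c, the functions n w / (1 + n w) are of class
    C^1, stay in [0,1], vanish for x <= c and tend to 1 for x > c. *)
Lemma C1_step c : exists q : nat -> R -> R, [/\ forall n, C1_bounded (q n),
  forall n x, `|q n x| <= 1 & forall x, (fun n => q n x) @ \oo --> (\1_(`]c, +oo[ : set R) x : R)].
Proof.
pose w x := sqpos (x - c); have w0 x : 0 <= w x by exact: sqpos_ge0.
pose q n x := n%:R * w x / (1 + n%:R * w x).
have den n x : 0 < 1 + n%:R * w x by rewrite ltr_wpDr// mulr_ge0.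
have dw x : is_derive x (1 : R) w (2 * Num.max (x - c) 0).
  exact: (is_derive_translate c x (@is_derive_sqpos R)).
pose q' n x := n%:R * (2 * Num.max (x - c) 0) / (1 + n%:R * w x) ^+ 2.
have dq n x : is_derive x (1 : R) (q n) (q' n x).
  have d1 : is_derive x (1 : R) (fun x => n%:R * w x) (n%:R * (2 * Num.max (x - c) 0)).
    by have := dw x => d0; apply: is_derive_eq.
  have d2 : is_derive x (1 : R) (fun x => 1 + n%:R * w x) (n%:R * (2 * Num.max (x - c) 0)).
    by apply: (is_derive_eq (is_deriveD (is_derive_cst (1 : R) x 1) d1)); rewrite add0r.
  have d3 := @is_derive_div R (fun x => n%:R * w x) (fun x => 1 + n%:R * w x) x _ _
    (lt0r_neq0 (den n x)) d1 d2.
  apply: (is_derive_eq d3).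
  rewrite /q'; congr (_ / _); ring.
have cw : continuous w by exact: is_derive_continuous dw.
have q1 n x : `|q n x| <= 1.
  have wn : 0 <= n%:R * w x by rewrite mulr_ge0.
  rewrite /q ger0_norm; last by rewrite divr_ge0// ltW.
  by rewrite ler_pdivrMr// mul1r lerDr.
exists q; split => [n|n x|x]; [|exact: q1|].
  have [dqn E] := is_derive_C1 (dq n).
  split; [exact: dqn| |by exists 1; exact: q1].
  rewrite E => x; apply: cvgM.
    apply: cvgM; first exact: cvg_cst.
    apply: cvgM; first exact: cvg_cst.
    apply: (@continuous_comp _ _ _ (fun x => x - c) (fun s => Num.max s 0)).
      by apply: cvgB; [exact: cvg_id|exact: cvg_cst].
    exact: continuous_pos.
  apply: cvgV; first by rewrite expf_neq0// gt_eqF.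
  have cd : (1 + n%:R * w y) @[y --> x] --> (1 + n%:R * w x : R).
    by apply: cvgD; [exact: cvg_cst|apply: cvgM; [exact: cvg_cst|exact: cw]].
  exact: (cvgM cd cd).
rewrite indicE; have [cx|xc] := ltP c x; last first.
  have -> : (fun n => q n x) = (fun=> 0).
    by apply/funext => n; rewrite /q /w sqpos_le0 ?subr_le0// mulr0 mul0r.
  rewrite memNset; first exact: cvg_cst.
  by rewrite /= in_itv/= andbT; apply/negP; rewrite -leNgt.
rewrite mem_set/=; last by rewrite in_itv/= cx.
have wx : 0 < w x by rewrite sqpos_gt0// subr_gt0.
apply/cvgrPdist_le => e e0; near=> n.
have -> : 1 - q n x = (1 + n%:R * w x)^-1 by rewrite /q; field; rewrite gt_eqF.
rewrite ger0_norm ?invr_ge0 ?(ltW (den _ _))// -[leRHS]invrK lef_pV2 ?posrE ?invr_gt0//.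
have : e^-1 / w x <= n%:R by near: n; exact: nbhs_infty_ger.
by rewrite ler_pdivrMr//; lra.
Unshelve. all: by end_near. Qed.

Lemma itv_measure_fin : (nu setT < +oo)%E.
Proof.
rewrite /= /mrestr setTI lebesgue_measure_itv/=; case: ifP => // _.
exact: ltry.
Qed.

Lemma itv_ae (P : R -> Prop) : (forall x, a < x < b -> P x) -> \forall x \ae nu, P x.
Proof.
move=> h; apply: mrestr_ae; apply: aeW => x /=; rewrite in_itv/=; exact: h.
Qed.

Lemma itv_test_L2 u : itv_test a b u -> u \in Lfun nu 2%:E.
Proof.
by move=> /itv_test_bounded[mu_ [c hc]]; exact: (L2_bounded itv_measure_fin mu_ hc).
Qed.

Lemma itv_test_derive1_L2 u : itv_test a b u -> derive1 u \in Lfun nu 2%:E.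
Proof.
by move=> /itv_test_derive1_bounded[mu_ [c hc]]; exact: (L2_bounded itv_measure_fin mu_ hc).
Qed.

Lemma itv_bump a' b' : a < a' -> b' < b ->
  itv_test a b (fun x => sqpos (x - a') * sqpos (b' - x)).
Proof.
move=> aa bb.
pose D x := 2 * Num.max (x - a') 0 * sqpos (b' - x) + sqpos (x - a') * - (2 * Num.max (b' - x) 0).
have dD x : is_derive x (1 : R) (fun x => sqpos (x - a') * sqpos (b' - x)) (D x).
  have h1 := is_derive_translate a' x (@is_derive_sqpos R).
  have h2 := is_derive_reflect b' x (@is_derive_sqpos R).
  by apply: (is_derive_eq (is_deriveM h1 h2)); rewrite /GRing.scale /D /=; ring.
have [du E] := is_derive_C1 dD; split; first exact: du.
  have c1 : continuous (fun x => x - a') by move=> x; apply: cvgB; [exact: cvg_id|exact: cvg_cst].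
  have c2 : continuous (fun x => b' - x) by move=> x; apply: cvgB; [exact: cvg_cst|exact: cvg_id].
  have cs := is_derive_continuous (@is_derive_sqpos R).
  have cp := @continuous_pos R.
  have c3 x := continuous_comp (c1 x) (cs (x - a')).
  have c4 x := continuous_comp (c2 x) (cs (b' - x)).
  have c5 x := continuous_comp (c1 x) (cp (x - a')).
  have c6 x := continuous_comp (c2 x) (cp (b' - x)).
  rewrite E => x.
  exact: (cvgD (cvgM (cvgM (cvg_cst (2 : R)) (c5 x)) (c4 x))
               (cvgM (c3 x) (cvgN (cvgM (cvg_cst (2 : R)) (c6 x))))).
exists a', b'; split => // x; apply: contraNT; rewrite negb_and -!ltNge.
case/orP => h; first by rewrite sqpos_le0 ?mul0r// subr_le0 ltW.
by rewrite [sqpos (b' - x)]sqpos_le0 ?mulr0// subr_le0 ltW.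
Qed.

Lemma itv_bump_neq0 x : a < x < b ->
  exists n : nat, sqpos (x - (a + n.+1%:R^-1)) * sqpos (b - n.+1%:R^-1 - x) != 0.
Proof.
move=> /andP[ax xb].
have e0 : 0 < Num.min (x - a) (b - x) / 2 by rewrite divr_gt0// lt_min !subr_gt0 ax xb.
have := near_natSinv_le e0 => -[n _ /(_ n (leqnn _))] /=.
rewrite ler_pdivlMr// le_min => /andP[h1 h2]; exists n.
have n0 : 0 < n.+1%:R^-1 :> R by rewrite invr_gt0.
move: n0 h1 h2; move: (n.+1%:R^-1) => t n0 h1 h2.
by rewrite mulf_neq0// gt_eqF//; apply: sqpos_gt0; lra.
Qed.

(** Separation gives [g * t = 0] almost everywhere for each test separately. Countably many bumps on
    intervals exhausting ]a, b[ suffice to have a nonzero one at every interior point, so a single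
    null set serves for all. *)
Lemma itv_separation g : g \in Lfun nu 2%:E ->
  (forall q, itv_test a b q -> ipL2 nu g q = 0) -> \forall x \ae nu, g x = 0.
Proof.
move=> hg h.
have S t : itv_test a b t -> \forall x \ae nu, g x * t x = 0.
  apply: (@separation _ _ _ nu g (itv_test a b) C1_bounded (@RGenOInfty.G R)) => //.
  - exact: (L2_integrable itv_measure_fin hg).
  - exact: itv_test_bounded.
  - exact: C1_bounded_measurable.
  - by move=> q u [q1 q2 _] hu; have [] := itv_test_mul q1 q2 hu.
  - by move=> _ [c ->]; exact: measurable_itv.
  - by move=> A mA; have := @RGenOInfty.measurableE R; rewrite /measurable/= => <-.
  - move=> _ [c ->]; have [q [q1 q2 q3]] := C1_step c.
    by exists q, 1; split => //; exact: aeW.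
have ae_n : \forall x \ae nu, forall n : nat, 
    g x * (sqpos (x - (a + n.+1%:R^-1)) * sqpos (b - n.+1%:R^-1 - x)) = 0.
  apply/ae_foralln => n; apply: (S (fun x => sqpos (x - (a + n.+1%:R^-1)) * sqpos (b - n.+1%:R^-1 - x))).
  by apply: itv_bump; rewrite ?ltrDl ?gtrBl ?ltrDl invr_gt0.
have inn : \forall x \ae nu, a < x < b by exact: itv_ae.
by apply: filterS2 ae_n inn => x hx /itv_bump_neq0[n tx]; have /eqP := hx n; rewrite mulf_eq0 (negbTE tx) orbF => /eqP.
Qed.

Lemma itv_weak_derivation : weak_derivation nu (itv_wd a b) itv_tests.
Proof.
split.
- exact: itv_measure_fin.
- by move=> i _ q [tq ->]; split; [exact: itv_test_derive1_L2|exact: itv_test_L2].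
- move=> i u g; split.
    by move=> h _ q [tq ->]; rewrite /ipL2 !Rintegral_mrestr; exact: h.
  move=> h psi tpsi; have := h _ psi (conj tpsi erefl).
  by rewrite /ipL2 !Rintegral_mrestr.
- move=> i g hg h; apply: itv_separation => // q tq.
  exact: (h (derive1 q) q).
Qed.

End IntervalSobolev.

(** * Approximate point masses on the line and their primitives *)

Section Mollifier.
Variable R : realType.
Implicit Types (f : R -> R) (s x y : R).

Lemma itv_integral_derive (a b : R) f f' : a < b ->
  (forall s : R, is_derive s (1 : R) f (f' s)) -> continuous f' ->
  \int[itv_measure a b]_s f' s = f b - f a.
Proof.
move=> ab df cf'; rewrite Rintegral_mrestr /Rintegral.
rewrite -(@integral_itv_bndoo R a b _ true false); last first.
  by apply/measurable_EFinP; apply: measurable_funTS; exact: continuous_measurable_fun.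
by rewrite (FTC_everywhere ab df cf').
Qed.

Variable e : R.
Hypothesis e0 : 0 < e.

Definition diff2 f s : R := f s - 2 * f (s - e) + f (s - 2 * e).

Lemma is_derive_diff2 f f' : (forall s : R, is_derive s (1 : R) f (f' s)) ->
  forall s : R, is_derive s (1 : R) (diff2 f) (diff2 f' s).
Proof.
move=> df s; have d0 := df s.
have d1 := is_derive_translate e s df; have d2 := is_derive_translate (2 * e) s df.
by apply: is_derive_eq; rewrite /GRing.scale /= /diff2; ring.
Qed.

(** Second backward differences, divided by e^2, of the truncated powers s_+, s_+^2 / 2 and s_+^3 /
    6: a triangular bump of mass 1 on [0, 2e] and its first two primitives. Past 2e they are 0, 1
    and s - e. The one-sided support makes the shift by [y] live on [y, y + 2e]. *)
Definition hat s : R := diff2 (fun s => Num.max s 0) s / e ^+ 2.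
Definition step s : R := diff2 (fun s => sqpos s / 2) s / e ^+ 2.
Definition ramp s : R := diff2 (fun s => s * sqpos s / 6) s / e ^+ 2.

Lemma is_derive_divr f f' (c : R) : (forall s : R, is_derive s (1 : R) f (f' s)) ->
  forall s : R, is_derive s (1 : R) (fun s => f s / c) (f' s / c).
Proof.
move=> df s; have d0 := df s; have d1 := is_deriveZ c^-1 d0.
have E : (fun s => f s / c) = c^-1 *: f.
  by apply/funext => t; rewrite fctE /GRing.scale /= mulrC.
by rewrite E; apply: (is_derive_eq d1); rewrite /GRing.scale /= mulrC.
Qed.

Lemma is_derive_step s : is_derive s (1 : R) step (hat s).
Proof.
apply: is_derive_divr => {}s; apply: is_derive_diff2 => {}s.
have := @is_derive_divr (@sqpos R) (fun t => 2 * Num.max t 0) 2 (@is_derive_sqpos R) s.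
by move=> h; apply: (is_derive_eq h); rewrite mulrAC divff ?mul1r.
Qed.

Lemma is_derive_ramp s : is_derive s (1 : R) ramp (step s).
Proof.
apply: is_derive_divr => {}s; apply: is_derive_diff2 => {}s.
have h t : is_derive t (1 : R) (fun s : R => s * sqpos s) (3 * sqpos t).
  have d1 := @is_derive_sqpos R t.
  apply: (is_derive_eq (is_deriveM (is_derive_id t 1) d1)); rewrite /GRing.scale /= /sqpos.
  by case: (ltP t 0) => t0; rewrite ?mulr0 ?expr0n/=; ring.
by apply: (is_derive_eq (is_derive_divr 6 h s)); field.
Qed.

Let e20 : 0 < e ^+ 2. Proof. exact: exprn_gt0. Qed.

Lemma hat_ge0 s : 0 <= hat s.
Proof.
apply: divr_ge0; last exact: ltW.
rewrite /diff2; case: (ltP s 0) => h1; case: (ltP (s - e) 0) => h2;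
  case: (ltP (s - 2 * e) 0) => h3; lra.
Qed.

Lemma hat_support s : s < 0 \/ 2 * e < s -> hat s = 0.
Proof.
have e_gt0 := e0; move=> h; apply/eqP; rewrite /hat mulf_eq0; apply/orP; left; apply/eqP.
rewrite /diff2; case: (ltP s 0) => h1; case: (ltP (s - e) 0) => h2;
  case: (ltP (s - 2 * e) 0) => h3; case: h => h; lra.
Qed.

Lemma step_le0 s : s <= 0 -> step s = 0.
Proof. by have ? := e0; move=> s0; rewrite /step /diff2 !sqpos_le0; [ring|lra|lra|lra]. Qed.

Lemma step_ge s : 2 * e <= s -> step s = 1.
Proof.
have e_gt0 := e0; move=> s0; apply: (mulIf (lt0r_neq0 e20)); rewrite mul1r divfK ?lt0r_neq0//.
rewrite /diff2 /sqpos; case: (ltP s 0) => h1; case: (ltP (s - e) 0) => h2;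
  case: (ltP (s - 2 * e) 0) => h3; try lra; field.
Qed.

Lemma step01 s : 0 <= step s <= 1.
Proof.
have e_gt0 := e0; rewrite /step ler_pdivrMr// mul1r divr_ge0 ?(ltW e20)//=; last first.
  rewrite /diff2 /sqpos; case: (ltP s 0) => h1; case: (ltP (s - e) 0) => h2;
  case: (ltP (s - 2 * e) 0) => h3; nra.
rewrite /diff2 /sqpos; case: (ltP s 0) => h1; case: (ltP (s - e) 0) => h2;
  case: (ltP (s - 2 * e) 0) => h3; nra.
Qed.

Lemma ramp_le0 s : s <= 0 -> ramp s = 0.
Proof. by have ? := e0; move=> s0; rewrite /ramp /diff2 !sqpos_le0; [ring|lra|lra|lra]. Qed.

Lemma ramp_ge s : 2 * e <= s -> ramp s = s - e.
Proof.
have e_gt0 := e0; move=> s0; apply: (mulIf (lt0r_neq0 e20)); rewrite divfK ?lt0r_neq0//.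
rewrite /diff2 /sqpos; case: (ltP s 0) => h1; case: (ltP (s - e) 0) => h2;
  case: (ltP (s - 2 * e) 0) => h3; try lra; field.
Qed.

Lemma continuous_hat : continuous hat.
Proof.
have cp c : continuous (fun s : R => Num.max (s - c) 0).
  move=> s; apply: (@continuous_comp _ _ _ (fun s => s - c) (fun s => Num.max s 0)).
    by apply: cvgB; [exact: cvg_id|exact: cvg_cst].
  exact: continuous_pos.
move=> s; apply: cvgM; last exact: cvg_cst.
exact: (cvgD (cvgB (@continuous_pos R s) (cvgM (cvg_cst (2 : R)) (cp e s))) (cp (2 * e) s)).
Qed.

End Mollifier.

(** * Oscillation and slope bounds in terms of weak derivatives *)

Section IntervalEmbedding.
Variable R : realType.
Local Notation nu := (@itv_measure R (-1) 1).
Local Notation wd := (@itv_wd R (-1) 1).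
Local Notation W := (@itv_weak_derivation R (-1) 1).
Implicit Types (u v g h : R -> R) (s x y e : R).

Lemma itv_near_interior u x e : {within `[-1, 1], continuous u} -> 0 < e -> -1 <= x <= 1 ->
  exists x', [/\ -1 < x' < 1, `|x - x'| <= e & `|u x - u x'| <= e].
Proof.
move=> cu e0 /andP[]; rewrite le_eqVlt => /predU1P[<- _|x1].
  have [_ cl _] : [/\ {in `](-1), 1[, continuous u}, u @ (-1)^'+ --> u (-1) & u @ 1^'- --> u 1].
    by apply/continuous_within_itvP => //; lra.
  have /cvgrPdist_le /(_ e e0) H := cl.
  near (-1 : R)^'+ => x'; exists x'; split; last by near: x'.
    apply/andP; split; near: x'; [exact: nbhs_right_gt|apply: nbhs_right_lt; lra].
  rewrite distrC; have -> : x' - -1 = x' + 1 by ring.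
  have h1 : -1 < x' by near: x'; exact: nbhs_right_gt.
  have h2 : x' < -1 + e by near: x'; apply: nbhs_right_lt; lra.
  by rewrite ger0_norm; lra.
rewrite le_eqVlt => /predU1P[->|x2]; last by exists x; rewrite x1 x2 !subrr normr0 ltW.
have [_ _ cl] : [/\ {in `](-1), 1[, continuous u}, u @ (-1)^'+ --> u (-1) & u @ 1^'- --> u 1].
  by apply/continuous_within_itvP => //; lra.
have /cvgrPdist_le /(_ e e0) H := cl.
near (1 : R)^'- => x'; exists x'; split; last by near: x'.
  apply/andP; split; near: x'; [apply: nbhs_left_gt; lra|exact: nbhs_left_lt].
have h1 : x' < 1 by near: x'; exact: nbhs_left_lt.
have h2 : 1 - e < x' by near: x'; apply: nbhs_left_gt; lra.
by rewrite ger0_norm; lra.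
Unshelve. all: by end_near. Qed.

Lemma continuous_hat_shift e y : continuous (fun s => hat e (s - y)).
Proof.
move=> s; apply: (@continuous_comp _ _ _ (fun s => s - y) (hat e)); last exact: continuous_hat.
by apply: cvgB; [exact: cvg_id|exact: cvg_cst].
Qed.

Lemma hat_L2 e y : 0 < e -> (fun s => hat e (s - y)) \in Lfun nu 2%:E.
Proof.
move=> e0; have ch := @continuous_hat_shift e y.
have [c hc] : exists c : R, forall s, `|hat e (s - y)| <= c.
  apply: (@bounded_compact_support _ _ y (y + 2 * e)) => // s; apply: contraNT.
  rewrite negb_and -!ltNge => h; apply/eqP/hat_support => //.
  by case/orP: h => h; [left|right]; lra.
exact: (L2_bounded (itv_measure_fin _ _) (continuous_measurable_fun ch) hc).
Qed.

Lemma itv_mollify u y e1 : {within `[-1, 1], continuous u} -> u \in Lfun nu 2%:E ->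
  0 < e1 -> -1 < y < 1 -> exists2 e2 : R, 0 < e2 & forall e, 0 < e -> e <= e2 ->
    y + 2 * e < 1 /\ `|\int[nu]_s (u s * hat e (s - y)) - u y| <= e1.
Proof.
move=> cu Lu e10 /andP[y1 y2].
have [ci _ _] : [/\ {in `](-1), 1[, continuous u}, u @ (-1)^'+ --> u (-1) & u @ 1^'- --> u 1].
  by apply/continuous_within_itvP => //; lra.
have /ci /cvgrPdist_le /(_ e1 e10) : y \in `](-1), 1[ by rewrite in_itv/= y1.
move=> /nbhs_ballP[r /= r0 hr].
(* For [e <= e2] the support [y, y + 2e] lies within distance [r] of [y] and stays below 1. *)
pose e2 := Num.min r (1 - y) / 3.
have m0 : 0 < Num.min r (1 - y) by rewrite lt_min r0 subr_gt0.
exists e2; first by rewrite divr_gt0.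
move=> e e0; rewrite ler_pdivlMr// le_min => /andP[h1 h2]; split; first lra.
have ds (s : R) : is_derive s (1 : R) (fun s => step e (s - y)) (hat e (s - y)).
  exact: (is_derive_translate y s (is_derive_step e)).
have ch := @continuous_hat_shift e y.
have I1 : \int[nu]_s hat e (s - y) = 1.
  rewrite (itv_integral_derive _ ds ch); last lra.
  by rewrite step_ge ?step_le0 ?subr0//; lra.
have Lh := hat_L2 y e0.
have ih : nu.-integrable setT (EFin \o (fun s => hat e (s - y))).
  exact: (L2_integrable (itv_measure_fin _ _) Lh).
have iuh := L2_prod Lu Lh.
have -> : \int[nu]_s (u s * hat e (s - y)) - u y =
    \int[nu]_s (- u y * hat e (s - y) + u s * hat e (s - y)).
  by rewrite Rintegral_lin// I1; ring.
have i1 := integrable_lin (- u y) ih iuh.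
apply: le_trans (le_normr_Rintegral measurableT i1) _.
apply: (@le_trans _ _ (\int[nu]_s (e1 * hat e (s - y)))); last by rewrite RintegralZl// I1 mulr1.
apply: le_Rintegral => //.
- by have := integrable_norm i1; apply: eq_integrable.
- exact: (integrableZl measurableT e1 ih).
move=> s _; rewrite -mulrDl normrM [`|hat e _|]ger0_norm; last exact: hat_ge0.
have [->|hs] := eqVneq (hat e (s - y)) 0; first by rewrite !mulr0.
have sy : 0 <= s - y <= 2 * e.
  by apply: contraNT hs; rewrite negb_and -!ltNge => h; apply/eqP/hat_support => //; exact/orP.
rewrite ler_wpM2r ?hat_ge0// addrC distrC; apply: hr.
case/andP: sy => sy1 sy2; rewrite /ball /= distrC ger0_norm//; lra.
Qed.

Lemma ipL2_le_normL1 c g p : g \in Lfun nu 2%:E -> p \in Lfun nu 2%:E ->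
  (forall s, `|p s| <= c) -> `|ipL2 nu g p| <= c * \int[nu]_s `|g s|.
Proof.
move=> hg hp hc; have ig := L2_integrable (itv_measure_fin _ _) hg.
have ing : nu.-integrable setT (EFin \o (fun s => `|g s|)).
  by have := integrable_norm ig; apply: eq_integrable.
have igp := L2_prod hg hp.
apply: le_trans (le_normr_Rintegral measurableT igp) _.
rewrite -RintegralZl//; apply: le_Rintegral => //.
- by have := integrable_norm igp; apply: eq_integrable.
- exact: (integrableZl measurableT c ing).
by move=> s _; rewrite normrM mulrC ler_wpM2r.
Qed.

Lemma ipL2_hatB u e x y : u \in Lfun nu 2%:E -> 0 < e ->
  ipL2 nu u (fun s => hat e (s - y) - hat e (s - x)) =
  \int[nu]_s (u s * hat e (s - y)) - \int[nu]_s (u s * hat e (s - x)).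
Proof.
move=> Lu e0; have h1 := L2_prod Lu (hat_L2 y e0); have h2 := L2_prod Lu (hat_L2 x e0).
transitivity (\int[nu]_s (-1 * (u s * hat e (s - x)) + u s * hat e (s - y))).
  by apply: eq_Rintegral => s _; ring.
by apply: eq_trans (Rintegral_lin (-1) h2 h1) _; rewrite mulN1r addrC.
Qed.

Lemma itv_mollify2 u x y e1 : {within `[-1, 1], continuous u} -> u \in Lfun nu 2%:E ->
  0 < e1 -> -1 < x < 1 -> -1 < y < 1 -> exists2 e2 : R, 0 < e2 &
    forall e, 0 < e -> e <= e2 -> [/\ y + 2 * e < 1, x + 2 * e < 1 &
    `|ipL2 nu u (fun s => hat e (s - y) - hat e (s - x)) - (u y - u x)| <= e1].
Proof.
move=> cu Lu e10 hx hy; have e12 : 0 < e1 / 2 by rewrite divr_gt0.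
have [a a0 ha] := itv_mollify cu Lu e12 hx; have [b b0 hb] := itv_mollify cu Lu e12 hy.
exists (Num.min a b); first by rewrite lt_min a0.
move=> e e0; rewrite le_min => /andP[/(ha e e0)[h1 h2] /(hb e e0)[h3 h4]].
split => //; rewrite ipL2_hatB//.
set A := \int[nu]_s _ in h2 *; set B := \int[nu]_s _ in h4 *.
have -> : B - A - (u y - u x) = (B - u y) - (A - u x) by ring.
by apply: le_trans (ler_normB _ _) _; lra.
Qed.

(** The test function [psi] is a difference of two steps, bounded by 1, whose derivative
    approximates delta_y - delta_x; one integration by parts turns the difference of values into an
    integral of [g * psi]. *)
Lemma itv_diff_le u g x y : {within `[-1, 1], continuous u} -> u \in Lfun nu 2%:E ->
  has_wpartial nu wd tt u g -> -1 < y < 1 -> -1 < x < 1 ->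
  `|u x - u y| <= \int[nu]_s `|g s|.
Proof.
move=> cu Lu [Lg ug] hy hx; wlog yx : x y hx hy / y <= x.
  by move=> H; have [yx|/ltW xy] := leP y x; [exact: H|rewrite distrC; exact: H].
apply/ler_addgt0Pr => e1 e10.
have [e e0 /(_ e e0 (lexx _))[ey ex he]] := itv_mollify2 cu Lu e10 hx hy.
pose psi s := step e (s - y) - step e (s - x).
have dpsi (s : R) : is_derive s (1 : R) psi (hat e (s - y) - hat e (s - x)).
  exact: (is_deriveB (is_derive_translate y s (is_derive_step e))
                     (is_derive_translate x s (is_derive_step e))).
have [dp E] := is_derive_C1 dpsi.
have tpsi : itv_test (-1) 1 psi.
  split; first exact: dp.
    rewrite E => s.
    exact: (cvgB (continuous_hat_shift (e := e) (y := y) (x := s))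
                 (continuous_hat_shift (e := e) (y := x) (x := s))).
  exists y, (x + 2 * e); split; [by case/andP: hy|by []|move=> s; apply: contraNT].
  rewrite negb_and -!ltNge /psi => /orP[h|h].
    by rewrite !step_le0 ?subrr//; lra.
  by rewrite !step_ge ?subrr//; lra.
have Lp := itv_test_L2 tpsi.
have bp s : `|psi s| <= 1.
  have /andP[h1 h2] := step01 e0 (s - x); have /andP[h3 h4] := step01 e0 (s - y).
  by rewrite ler_norml /psi; apply/andP; split; lra.
have := ipL2_le_normL1 Lg Lp bp; rewrite mul1r.
have /(wd_def W) /(_ _ _ (conj tpsi erefl)) := ug; rewrite E => ug'.
rewrite -normrN -ug' => H.
rewrite distrC; move: he H; move: (ipL2 nu u _) => m he H.
have -> : u y - u x = m - (m - (u y - u x)) by ring.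
by apply: le_trans (ler_normB _ _) _; exact: lerD.
Qed.

(* The test function has second derivative an approximate
   (delta_y - delta_x) / (x - y) - (delta_y' - delta_x') / (x' - y'). *)
Lemma itv_slope_le u g h x y x' y' : {within `[-1, 1], continuous u} ->
  u \in Lfun nu 2%:E -> has_wpartial nu wd tt u g -> has_wpartial nu wd tt g h ->
  -1 < y -> y < x -> x < 1 -> -1 < y' -> y' < x' -> x' < 1 ->
  `|(u x - u y) / (x - y) - (u x' - u y') / (x' - y')| <= 2 * \int[nu]_s `|h s|.
Proof.
move=> cu Lu [Lg ug] [Lh gh] y1 yx x1 y1' yx' x1'.
apply/ler_addgt0Pr => e1 e10.
have k0 : 0 < x - y by rewrite subr_gt0.
have k0' : 0 < x' - y' by rewrite subr_gt0.
(* Mollification errors get divided by the chord lengths, so they are taken small relative to the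
   shorter chord. *)
pose eta := (e1 / 2) * Num.min (x - y) (x' - y').
have eta0 : 0 < eta by rewrite mulr_gt0 ?divr_gt0// lt_min k0.
have etak : eta / (x - y) <= e1 / 2.
  by rewrite ler_pdivrMr// ler_wpM2l ?divr_ge0 ?ge_min ?lexx// ltW.
have etak' : eta / (x' - y') <= e1 / 2.
  by rewrite ler_pdivrMr// ler_wpM2l ?divr_ge0 ?ge_min ?lexx ?orbT// ltW.
have hx : -1 < x < 1 by rewrite x1 (lt_trans y1 yx).
have hy : -1 < y < 1 by rewrite y1 (lt_trans yx x1).
have hx' : -1 < x' < 1 by rewrite x1' (lt_trans y1' yx').
have hy' : -1 < y' < 1 by rewrite y1' (lt_trans yx' x1').
have [a a0 ha] := itv_mollify2 cu Lu eta0 hx hy.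
have [b b0 hb] := itv_mollify2 cu Lu eta0 hx' hy'.
pose e := Num.min a b; have e0 : 0 < e by rewrite lt_min a0.
have ea : e <= a by rewrite ge_min lexx.
have eb : e <= b by rewrite ge_min lexx orbT.
have [ey ex he] := ha e e0 ea; have [ey' ex' he'] := hb e e0 eb.
pose psi s := (ramp e (s - y) - ramp e (s - x)) / (x - y) -
              (ramp e (s - y') - ramp e (s - x')) / (x' - y').
pose psi' s := (step e (s - y) - step e (s - x)) / (x - y) -
               (step e (s - y') - step e (s - x')) / (x' - y').
pose psi'' s := (hat e (s - y) - hat e (s - x)) / (x - y) -
                (hat e (s - y') - hat e (s - x')) / (x' - y').
have D (f f' : R -> R) (s : R) : (forall t : R, is_derive t (1 : R) f (f' t)) ->
  is_derive s (1 : R) (fun s => (f (s - y) - f (s - x)) / (x - y) - (f (s - y') - f (s - x')) / (x' - y'))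
    ((f' (s - y) - f' (s - x)) / (x - y) - (f' (s - y') - f' (s - x')) / (x' - y')).
  move=> df; have T c t := is_derive_translate c t df.
  have D1 a1 a2 (k : R) := is_derive_divr k (fun t => is_deriveB (T a1 t) (T a2 t)).
  exact: (is_deriveB (D1 y x (x - y) s) (D1 y' x' (x' - y') s)).
have dpsi (s : R) : is_derive s (1 : R) psi (psi' s) by exact: D (is_derive_ramp e).
have dpsi' (s : R) : is_derive s (1 : R) psi' (psi'' s) by exact: D (is_derive_step e).
have [dp E] := is_derive_C1 dpsi; have [dp' E'] := is_derive_C1 dpsi'.
have cpsi'' : continuous psi''.
  have ch c s := @continuous_hat_shift e c s.
  move=> s.
  exact: (cvgB (cvgM (cvgB (ch y s) (ch x s)) (cvg_cst _)) (cvgM (cvgB (ch y' s) (ch x' s)) (cvg_cst _))).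
pose l := Num.min y y'; pose r := Num.max (x + 2 * e) (x' + 2 * e).
have l1 : -1 < l by rewrite lt_min y1.
have r1 : r < 1 by rewrite gt_max ex.
have ly : l <= y by rewrite ge_min lexx.
have ly' : l <= y' by rewrite ge_min lexx orbT.
have rx : x + 2 * e <= r by rewrite le_max lexx.
have rx' : x' + 2 * e <= r by rewrite le_max lexx orbT.
have tpsi : itv_test (-1) 1 psi.
  split; [exact: dp|by rewrite E; exact: is_derive_continuous dpsi'|].
  exists l, r; split; [by []|by []|move=> s; apply: contraNT].
  rewrite negb_and -!ltNge /psi => /orP[hs|hs].
    by rewrite !ramp_le0 ?subrr ?mul0r ?subrr//; clear -hs ly ly' yx yx'; lra.
  (* To the right of the transition zones [ramp] is affine with slope 1, so each quotient equals 1.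
     Only the difference of two of them has compact support, which is why slopes are compared rather
     than bounded outright. *)
  have -> : (ramp e (s - y) - ramp e (s - x)) / (x - y) = 1.
    by rewrite !ramp_ge; [field; rewrite gt_eqF|clear -hs rx rx' yx yx' e0; lra..].
  have -> : (ramp e (s - y') - ramp e (s - x')) / (x' - y') = 1.
    by rewrite !ramp_ge; [field; rewrite gt_eqF|clear -hs rx rx' yx yx' e0; lra..].
  by rewrite subrr.
have tpsi' : itv_test (-1) 1 psi'.
  split; [exact: dp'|by rewrite E'|].
  exists l, r; split; [by []|by []|move=> s; apply: contraNT].
  rewrite negb_and -!ltNge /psi' => /orP[hs|hs].
    by rewrite !step_le0 ?subrr ?mul0r ?subrr//; clear -hs ly ly' yx yx'; lra.
  by rewrite !step_ge ?subrr ?mul0r ?subrr//; clear -hs rx rx' yx yx' e0; lra.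
have Lp := itv_test_L2 tpsi.
(* [ramp] is 1-Lipschitz because [step] takes values in [0,1]; the two quotients together give the
   factor 2 of the conclusion. *)
have slope1 c c' (s : R) : c < c' -> `|(ramp e (s - c) - ramp e (s - c')) / (c' - c)| <= 1.
  move=> cc; have cc0 : 0 < c' - c by rewrite subr_gt0.
  rewrite normrM normfV [`|c' - c|]gtr0_norm// ler_pdivrMr//.
  pose M := Num.max `|s - c| `|s - c'|.
  have st t : - M <= t <= M -> `|step e t| <= 1.
    by move=> _; have /andP[h1 h2] := step01 e0 t; rewrite ger0_norm.
  have := derive_lipschitz (is_derive_ramp e) st; move=> /(_ (s - c) (s - c')).
  rewrite -!ler_norml !le_max !lexx orbT => /(_ isT isT) H.
  have -> : c' - c = `|s - c - (s - c')| by rewrite (_ : _ - _ = c' - c) ?gtr0_norm//; ring.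
  by [].
have bp s : `|psi s| <= 2.
  apply: le_trans (ler_normB _ _) _; rewrite -[2]/(1 + 1).
  by apply: lerD; apply: slope1.
have := ipL2_le_normL1 Lh Lp bp.
have /(wd_def W) /(_ _ _ (conj tpsi erefl)) := gh; rewrite E => gh'.
have /(wd_def W) /(_ _ _ (conj tpsi' erefl)) := ug; rewrite E' => ug'.
rewrite -normrN -gh' -normrN -ug' => H.
have Ep : ipL2 nu u psi'' =
    ipL2 nu u (fun s => hat e (s - y) - hat e (s - x)) / (x - y) -
    ipL2 nu u (fun s => hat e (s - y') - hat e (s - x')) / (x' - y').
  have hL c c' : (fun s => hat e (s - c) - hat e (s - c')) \in Lfun nu 2%:E.
    exact: (quad_sub (@isL2_lin _ _ _ nu) (hat_L2 c e0) (hat_L2 c' e0)).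
  have z0 : (fun=> 0) \in Lfun nu 2%:E.
    by apply: (@L2_bounded _ _ _ _ (itv_measure_fin _ _) 0) => // s; rewrite normr0.
  have h1 := ipL2_lin (- (x' - y')^-1) (hL y' x') z0 Lu.
  have h2 := ipL2_lin (x - y)^-1 (hL y x) (L2_lin (- (x' - y')^-1) (hL y' x') z0) Lu.
  rewrite ipL2C [ipL2 nu u _]ipL2C [X in _ - X / _]ipL2C.
  have z1 : ipL2 nu (fun=> 0) u = 0.
    by rewrite /ipL2 (_ : (fun x0 => 0 * u x0) = fun=> 0) ?Rintegral_cst ?mul0r//; apply/funext => s; rewrite mul0r.
  transitivity (ipL2 nu (fun s => (x - y)^-1 * (hat e (s - y) - hat e (s - x)) +
    (- (x' - y')^-1 * (hat e (s - y') - hat e (s - x')) + 0)) u).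
    by congr (ipL2 nu _ u); apply/funext => s; rewrite /psi''; ring.
  by apply: eq_trans h2 _; rewrite h1 z1; ring.
move: he he' Ep; move: (ipL2 nu u (fun s => hat e (s - y) - hat e (s - x))) => m.
move: (ipL2 nu u (fun s => hat e (s - y') - hat e (s - x'))) => m' he he' Ep.
have -> : (u x - u y) / (x - y) - (u x' - u y') / (x' - y') =
    - ipL2 nu u psi'' + ((m - (u y - u x)) / (x - y) - (m' - (u y' - u x')) / (x' - y')).
  by rewrite Ep; field; rewrite !gt_eqF.
apply: le_trans (ler_normD _ _) _; rewrite normrN; apply: lerD => //.
apply: le_trans (ler_normB _ _) _.
rewrite !normrM !normfV [`|x - y|]gtr0_norm// [`|x' - y'|]gtr0_norm//.
have -> : e1 = e1 / 2 + e1 / 2 by field.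
apply: lerD.
  by apply: le_trans etak; rewrite ler_wpM2r// invr_ge0 ltW.
by apply: le_trans etak'; rewrite ler_wpM2r// invr_ge0 ltW.
Qed.

End IntervalEmbedding.

(** * Sup bound, Lipschitz bound and completeness of H^2(-1,1) *)

Section H2Theory.
Variable R : realType.
Local Notation nu := (@itv_measure R (-1) 1).
Local Notation wd := (@itv_wd R (-1) 1).
Local Notation W := (@itv_weak_derivation R (-1) 1).
Local Notation norm2 u := (Num.sqrt (H2_sqnorm u)).
Implicit Types (u v g h : R -> R) (s x y e : R).

Lemma itv_measureT : fine (nu setT) = 2.
Proof.
rewrite /= /mrestr setTI lebesgue_measure_itv/= lte_fin.
by rewrite ifT; [rewrite -EFinD/=; ring|lra].
Qed.

Lemma sqnormL2_itv_le (c : R) u v : u \in Lfun nu 2%:E -> v \in Lfun nu 2%:E ->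
  (forall x, -1 < x < 1 -> `|u x| <= c * `|v x|) ->
  sqnormL2 nu u <= c ^+ 2 * sqnormL2 nu v.
Proof.
move=> hu hv uv.
have iv : lebesgue_measure.-integrable `](-1), 1[ (EFin \o (fun x => c ^+ 2 * v x ^+ 2)).
  exact: (integrable_of_mrestr (integrableZl measurableT (c ^+ 2) (L2_sqr hv))).
rewrite /sqnormL2 -RintegralZl//; last exact: L2_sqr.
rewrite !Rintegral_mrestr; apply: le_Rintegral => //.
  exact: (integrable_of_mrestr (L2_sqr hu)).
move=> x /=; rewrite in_itv/= => /uv h.
rewrite -(real_normK (num_real (u x))) -(real_normK (num_real (v x))) -exprMn.
by rewrite lerXn2r// ?nnegrE ?normr_ge0// (le_trans _ h).
Qed.

Lemma L2_cst (c : R) : (fun=> c) \in Lfun nu 2%:E.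
Proof. by apply: (@L2_bounded _ _ _ _ (itv_measure_fin _ _) `|c|). Qed.

Lemma sqnormL2_cst (c : R) : sqnormL2 nu (fun=> c) = 2 * c ^+ 2.
Proof. by rewrite /sqnormL2 Rintegral_cst// itv_measureT mulrC. Qed.

Lemma itv_normL1 g : g \in Lfun nu 2%:E -> \int[nu]_s `|g s| <= 2 * Num.sqrt (sqnormL2 nu g).
Proof.
move=> hg; apply: le_trans (L2_normL1 (itv_measure_fin _ _) hg) _.
rewrite itv_measureT ler_wpM2r ?sqrtr_ge0//.
by rewrite -[leRHS]ger0_norm// -sqrtr_sqr ler_sqrt; nra.
Qed.

Lemma H2_sqnorm_ge0 u : 0 <= H2_sqnorm u.
Proof. exact: sobolev_sqnorm_ge0. Qed.

Lemma H2_L2 u : H2 u -> u \in Lfun nu 2%:E.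
Proof. by case=> _; exact: sobolev_L2. Qed.

Lemma H2_interior_close u x y e : H2 u -> -1 <= x <= 1 -> -1 <= y <= 1 -> 0 < e ->
  exists x' y', [/\ -1 < x' < 1, -1 < y' < 1, `|x' - y'| <= `|x - y| + e &
    `|u x - u y| <= `|u x' - u y'| + e].
Proof.
move=> [cu _] hx hy e0; have e2 : 0 < e / 2 by rewrite divr_gt0.
have [x' [hx' xx ux]] := itv_near_interior cu e2 hx.
have [y' [hy' yy uy]] := itv_near_interior cu e2 hy.
exists x', y'; split => //.
  have -> : x' - y' = (x - y) + - (x - x') + (y - y') by ring.
  apply: le_trans (ler_normD _ _) _; apply: le_trans (lerD (ler_normD _ _) (lexx _)) _.
  by rewrite normrN; lra.
have -> : u x - u y = (u x' - u y') + (u x - u x') + - (u y - u y') by ring.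
apply: le_trans (ler_normD _ _) _; apply: le_trans (lerD (ler_normD _ _) (lexx _)) _.
by rewrite normrN; lra.
Qed.

Lemma H2_osc u x y : H2 u -> -1 <= x <= 1 -> -1 <= y <= 1 -> `|u x - u y| <= 2 * norm2 u.
Proof.
move=> hu hx hy; apply/ler_addgt0Pr => e e0.
have [x' [y' [hx' hy' _ uxy]]] := H2_interior_close hu hx hy e0.
apply: le_trans uxy _; rewrite lerD2r; case: (hu) => cu su.
have Lg : wpartial nu wd tt u \in Lfun nu 2%:E := wpartial_L2 tt su.
apply: le_trans (itv_diff_le cu (H2_L2 hu) (sobolev_has tt su) hy' hx') _.
apply: le_trans (itv_normL1 Lg) _; rewrite ler_wpM2l// ler_wsqrtr//.
apply: le_trans (@sqnormL2_le_sobolev _ _ _ nu _ wd 1 _) _.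
exact: (@sqn_wpartial_le _ _ _ nu _ wd 1).
Qed.

(** The constant is 2 + 4. The oscillation is at most 2n, n being the norm, so a value above 6n
    would keep [u] above 4n throughout and make its squared L^2 norm at least 32 n^2, more than
    n^2. *)
Lemma H2_sup u x : H2 u -> -1 <= x <= 1 -> `|u x| <= 6 * norm2 u.
Proof.
move=> hu hx; rewrite leNgt; apply/negP => ux.
set n := norm2 u in ux *; have n0 : 0 <= n by exact: sqrtr_ge0.
have lb y : -1 < y < 1 -> `|4 * n| <= 1 * `|u y|.
  move=> /andP[y1 y2]; have hy : -1 <= y <= 1 by rewrite !ltW.
  rewrite mul1r ger0_norm ?mulr_ge0//; have := H2_osc hu hx hy; rewrite -/n => h.
  have : `|u x| <= `|u x - u y| + `|u y| by rewrite -{1}(subrK (u y) (u x)) ler_normD.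
  lra.
have := sqnormL2_itv_le (L2_cst (4 * n)) (H2_L2 hu) lb.
rewrite sqnormL2_cst expr1n mul1r => h.
have : sqnormL2 nu u <= n ^+ 2.
  by rewrite /n sqr_sqrtr ?H2_sqnorm_ge0// sqnormL2_le_sobolev.
(* For n = 0 the comparison of 32 n^2 with n^2 is void; the vanishing oscillation then keeps [u]
   above half of its value at [x], against a zero L^2 norm. *)
have [n1|n1] := eqVneq n 0; last by have : 0 < n by [rewrite lt_def n1]; nra.
have u0 : sqnormL2 nu u = 0.
  apply/eqP; rewrite eq_le sqnormL2_ge0 andbT; apply: le_trans (@sqnormL2_le_sobolev _ _ _ nu _ wd 2 u) _.
  by rewrite -/(H2_sqnorm u) -(sqr_sqrtr (H2_sqnorm_ge0 u)) -/n n1 expr0n.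
pose k := `|u x| / 2; have k0 : 0 < k by rewrite divr_gt0//; move: ux; rewrite n1 mulr0.
have lb' y : -1 < y < 1 -> `|k| <= 1 * `|u y|.
  move=> /andP[y1 y2]; have hy : -1 <= y <= 1 by rewrite !ltW.
  rewrite mul1r ger0_norm ?(ltW k0)//; have := H2_osc hu hx hy; rewrite -/n n1 mulr0 => h'.
  have : `|u x| <= `|u x - u y| + `|u y| by rewrite -{1}(subrK (u y) (u x)) ler_normD.
  by rewrite /k; have := normr_ge0 (u x); lra.
have := sqnormL2_itv_le (L2_cst k) (H2_L2 hu) lb'.
by rewrite sqnormL2_cst u0 mulr0; nra.
Qed.

(** The constant is 4 + 2: any chord slope differs by at most twice the L^1 norm of the second
    derivative, hence by 4n, from the slope of the reference chord over [-1/2, 1/2], which the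
    oscillation bounds by 2n. Endpoints are reached by approximation from the interior. *)
Lemma H2_lipschitz u x y : H2 u -> -1 <= x <= 1 -> -1 <= y <= 1 ->
  `|u x - u y| <= 6 * norm2 u * `|x - y|.
Proof.
move=> hu hx hy; set n := norm2 u; have n0 : 0 <= n by exact: sqrtr_ge0.
have [cu su] := hu.
have S a b : -1 < b -> b < a -> a < 1 -> `|u a - u b| <= 6 * n * (a - b).
  move=> b1 ba a1; have ab0 : 0 < a - b by rewrite subr_gt0.
  have sg : sobolev nu wd 1 (wpartial nu wd tt u) := sobolev_wpartial tt su.
  have Lh := wpartial_L2 tt sg.
  have [] : -1 < - (1 / 2) :> R /\ - (1 / 2) < 1 / 2 :> R by split; lra.
  move=> q1 q2; have q3 : 1 / 2 < 1 :> R by lra.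
  have := itv_slope_le cu (H2_L2 hu) (sobolev_has tt su) (sobolev_has tt sg) b1 ba a1 q1 q2 q3.
  have -> : 1 / 2 - - (1 / 2) = 1 :> R by field.
  rewrite divr1 => H.
  have h1 : \int[nu]_s `|wpartial nu wd tt (wpartial nu wd tt u) s| <= 2 * n.
    apply: le_trans (itv_normL1 Lh) _; rewrite ler_wpM2l// ler_wsqrtr//.
    apply: le_trans (@sqnormL2_le_sobolev _ _ _ nu _ wd 0 _) _.
    apply: le_trans (@sqn_wpartial_le _ _ _ nu _ wd 0 _ tt) _.
    exact: (@sqn_wpartial_le _ _ _ nu _ wd 1 _ tt).
  have h2 : `|u (1 / 2) - u (- (1 / 2))| <= 2 * n.
    by apply: H2_osc => //; apply/andP; split; lra.
  have : `|(u a - u b) / (a - b)| <= 6 * n.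
    rewrite -[X in `|X|](subrK (u (1 / 2) - u (- (1 / 2)))).
    by apply: le_trans (ler_normD _ _) _; lra.
  by rewrite normrM normfV [`|a - b|]gtr0_norm// ler_pdivrMr.
apply/ler_addgt0Pr => e e0.
(* Moving to interior points costs this amount once in the values and [6 * n] times in the distance,
   in total [e]. *)
have d0 : 0 < e / (1 + 6 * n) by rewrite divr_gt0// ltr_wpDr// mulr_ge0.
have [a [b [ha hb ab uab]]] := H2_interior_close hu hx hy d0.
apply: le_trans uab _.
have : `|u a - u b| <= 6 * n * `|a - b|.
  case/andP: ha hb => a1 a2 /andP[b1 b2].
  case: (ltgtP a b) => [h|h|->]; last by rewrite !subrr !normr0 mulr0.
    by rewrite distrC [`|a - b|]distrC [`|b - a|]gtr0_norm ?subr_gt0//; exact: S.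
  by rewrite [`|a - b|]gtr0_norm ?subr_gt0//; exact: S.
move=> h; apply: le_trans (lerD h (lexx _)) _.
apply: le_trans (lerD (ler_wpM2l _ ab) (lexx _)) _; first by rewrite mulr_ge0.
have -> : 6 * n * (`|x - y| + e / (1 + 6 * n)) + e / (1 + 6 * n) = 6 * n * `|x - y| + e; last by [].
by field; rewrite gt_eqF// ltr_wpDr// mulr_ge0.
Qed.

Lemma within_continuous_lin (A : set R) (a : R) u v : {within A, continuous u} ->
  {within A, continuous v} -> {within A, continuous (fun x => a * u x + v x)}.
Proof.
move=> cu cv x.
exact: (cvgD (cvgM (cvg_cst a) (cu x)) (cv x)).
Qed.

Lemma H2_lin (a : R) u v : H2 u -> H2 v -> H2 (fun x => a * u x + v x).
Proof.
move=> [cu su] [cv sv]; split; first exact: within_continuous_lin.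
exact: (sobolev_lin W a su sv).
Qed.

Lemma within_continuous_uniform_limit (A : set R) (u : nat -> R -> R) (w : R -> R) :
  (forall n, {within A, continuous (u n)}) ->
  (forall e, 0 < e -> exists n, forall x, A x -> `|u n x - w x| <= e) ->
  {within A, continuous w}.
Proof.
move=> cu h; apply/subspace_continuousP => x Ax; apply/cvgrPdist_le => e e0.
have [n hn] := h (e / 3) (divr_gt0 e0 (ltr0Sn _ 2)).
have /subspace_continuousP/(_ x Ax)/cvgrPdist_le/(_ (e / 3) (divr_gt0 e0 (ltr0Sn _ 2))) c := cu n.
near=> y.
have Ay : A y by near: y; exact: withinT.
have h1 : `|u n x - u n y| <= e / 3 by near: y.
have -> : w x - w y = - (u n x - w x) + (u n x - u n y) + (u n y - w y) by ring.
apply: le_trans (ler_normD _ _) _; apply: le_trans (lerD (ler_normD _ _) (lexx _)) _.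
by rewrite normrN; have := hn x Ax; have := hn y Ay; lra.
Unshelve. all: by end_near. Qed.

(** The Sobolev limit [l0] is known only up to null sets, whereas [H2] asks for continuity up to the
    endpoints. By the sup bound the sequence is also uniformly Cauchy on [-1,1]; its uniform limit
    is continuous and agrees with [l0] almost everywhere. *)
Lemma H2_complete (u : nat -> R -> R^o) : (forall n, H2 (u n)) ->
  cauchy_sq (fun w : R -> R^o => H2_sqnorm w) u ->
  exists l : R -> R^o, H2 l /\ cvg_sq (fun w : R -> R^o => H2_sqnorm w) u l.
Proof.
move=> hu cu.
have su n : isSob nu wd 2 (u n) by case: (hu n).
have [l0 [sl0 cl0]] := sobolev_complete W su cu.
have Hsub n m : H2 (u n - u m) by rewrite fct_subE; exact: H2_lin.
have unif e : 0 < e -> exists n0, forall n m, (n0 <= n)%N -> (n0 <= m)%N ->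
    forall x, -1 <= x <= 1 -> `|u n x - u m x| <= e.
  move=> e0; have d0 : 0 < (e / 6) ^+ 2 by rewrite exprn_gt0// divr_gt0.
  have [n0 h] := cu _ d0; exists n0 => n m nn mm x hx.
  apply: le_trans (H2_sup (Hsub n m) hx) _; rewrite mulrC -ler_pdivlMr//.
  have -> : e / 6 = Num.sqrt ((e / 6) ^+ 2).
    by rewrite sqrtr_sqr ger0_norm// divr_ge0// ltW.
  by apply: ler_wsqrtr; exact: h.
(* Nothing is known about [u n] outside [-1,1]; cutting off there makes the sequence converge
   everywhere, so that its limit is measurable on the whole line. *)
pose v n x : R := if -1 <= x <= 1 then u n x else 0.
have vcvg x : cvgn (v ^~ x).
  have [hx|/negbTE hx] := boolP (-1 <= x <= 1); last first.
    have -> : v ^~ x = (fun=> 0) by apply/funext => n; rewrite /v hx.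
    exact: is_cvg_cst.
  have -> : v ^~ x = (fun n => u n x : R) by apply/funext => n; rewrite /v hx.
  apply/cauchy_cvgP/cauchy_exP => e e0.
  have [n0 h] := unif (e / 2) (divr_gt0 e0 (ltr0Sn _ 1)).
  exists (u n0 x); exists n0 => // m /= mm; rewrite /ball/=.
  by apply: le_lt_trans (h _ _ (leqnn _) mm x hx) _; rewrite ltr_pdivrMr// ltr_pMr// ltr1n.
pose w x : R := limn (v ^~ x).
have vw x : v ^~ x @ \oo --> w x by exact: vcvg.
have uw e : 0 < e -> exists n0, forall n, (n0 <= n)%N -> forall x, -1 <= x <= 1 -> `|u n x - w x| <= e.
  move=> e0; have [n0 h] := unif e e0; exists n0 => n nn x hx.
  have cd : (fun m => `|u n x - v m x|) @ \oo --> `|u n x - w x|.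
    by apply: cvg_norm; apply: cvgB; [exact: cvg_cst|exact: vw].
  apply: (cvgr_to_le cd); exists n0 => // m /= mm.
  by rewrite /v hx; exact: h.
have mw : measurable_fun setT w.
  apply: (@measurable_fun_cvg _ _ _ setT v) => [n|x _]; last exact: vw.
  rewrite /v; have -> : (fun x => if -1 <= x <= 1 then u n x else 0) =
      (fun x => \1_(`[-1, 1] : set R) x * u n x).
    apply/funext => x; rewrite indicE; case: ifP => hx.
      by rewrite mem_set ?mul1r//= in_itv.
    by rewrite memNset ?mul0r//= in_itv/= hx.
  apply: measurable_funM; first exact: measurable_indic.
  exact: (L2_measurable (H2_L2 (hu n))).
have cw : {within `[-1, 1], continuous w}.
  apply: (@within_continuous_uniform_limit _ u) => [n|e e0]; first by case: (hu n).
  have [n0 h] := uw e e0; exists n0 => x /=; rewrite in_itv/=; exact: h.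
have [c [c0 hc]] := continuous_bounded_itv cw.
have w0 x : ~~ (-1 <= x <= 1) -> w x = 0.
  move=> /negbTE hx; have E : v ^~ x = (fun=> 0) by apply/funext => n; rewrite /v hx.
  by rewrite /w E lim_cst.
have Lw : w \in Lfun nu 2%:E.
  apply: (L2_bounded (itv_measure_fin _ _) mw (c := c)) => x.
  by have [/hc//|/w0 ->] := boolP (-1 <= x <= 1); rewrite normr0.
have Ll0 : l0 \in Lfun nu 2%:E := sobolev_L2 sl0.
have cuw : cvg_sq (fun w : R -> R^o => sqnormL2 nu w) u (w : R -> R^o).
  move=> e e0; have d0 : 0 < Num.sqrt (e / 2) by rewrite sqrtr_gt0 divr_gt0.
  have [n0 h] := uw _ d0; exists n0 => n nn.
  have LD : isL2 nu (u n - (w : R -> R^o)).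
    exact: (quad_sub (@isL2_lin _ _ _ nu) (H2_L2 (hu n)) Lw).
  have bD x : -1 < x < 1 -> `|u n x - w x| <= Num.sqrt (e / 2) * `|1 : R|.
    by move=> /andP[x1 x2]; rewrite normr1 mulr1; apply: h => //; rewrite !ltW.
  apply: le_trans (sqnormL2_itv_le LD (L2_cst 1) bD) _.
  rewrite sqnormL2_cst sqr_sqrtr ?divr_ge0 ?(ltW e0)// expr1n mulr1.
  by apply: eq_leW; field.
have wl : \forall x \ae nu, l0 x = w x.
  have hD : isL2 nu (l0 - w : R -> R^o) by exact: (quad_sub (@isL2_lin _ _ _ nu) Ll0 Lw).
  have : sqnormL2 nu (l0 - w : R -> R^o) = 0.
    apply/eqP; rewrite eq_le sqnormL2_ge0 andbT; apply/ler_addgt0Pr => e e0; rewrite add0r.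
    have e4 : 0 < e / 4 by rewrite divr_gt0.
    have [n0 h0] := cl0 _ e4; have [n1 h1] := cuw _ e4.
    have /h0 a0 : (n0 <= maxn n0 n1)%N by rewrite leq_maxl.
    have /h1 a1 : (n1 <= maxn n0 n1)%N by rewrite leq_maxr.
    have Lun : isL2 nu (u (maxn n0 n1)) by exact: H2_L2.
    have := quad_sq_trans (@isL2_lin _ _ _ nu) (@sqnormL2_ge0 _ _ _ nu) (@isL2_NE _ _ _ nu) Ll0 Lun Lw.
    rewrite (quad_subC (@isL2_lin _ _ _ nu) (@isL2_NE _ _ _ nu) Ll0 Lun).
    have := @sqnormL2_le_sobolev _ _ _ nu _ wd 2 (u (maxn n0 n1) - l0).
    lra.
  move=> /(sqnormL2_ae0 hD); apply: filterS => x h; apply/eqP; rewrite -subr_eq0.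
  by apply/eqP.
have sw : sobolev nu wd 2 w := sobolev_ae W sl0 Lw wl.
exists w; split; first by split.
move=> e e0; have [n0 h] := cl0 e e0; exists n0 => n /h; apply: le_trans; apply: eq_leW.
have L1 : isL2 nu (u n - (w : R -> R^o)) by exact: (quad_sub (@isL2_lin _ _ _ nu) (H2_L2 (hu n)) Lw).
have L2' : isL2 nu (u n - l0) by exact: (quad_sub (@isL2_lin _ _ _ nu) (H2_L2 (hu n)) Ll0).
apply: (@sobolev_sqnorm_ae _ _ _ _ _ _ _ W 2) => //.
by apply: filterS wl => x E; rewrite !fctE E.
Unshelve. all: by end_near. Qed.

End H2Theory.

Section H2Smooth.
Variable R : realType.
Local Notation nu := (@itv_measure R (-1) 1).
Local Notation wd := (@itv_wd R (-1) 1).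
Local Notation W := (@itv_weak_derivation R (-1) 1).
Implicit Types (u v : R -> R) (x : R).

(** A continuous function may be unbounded outside [-1,1]. Truncating it at its bound on that
    interval changes it only on a null set of the restricted measure. *)
Lemma itv_L2_continuous u : continuous u -> u \in Lfun nu 2%:E.
Proof.
move=> cu; have mu := continuous_measurable_fun cu.
have [c [c0 hc]] := @continuous_bounded_itv _ u (-1) 1 (continuous_subspaceT cu).
have mt : measurable_fun setT (fun x => Num.max (- c) (Num.min (u x) c)).
  by apply: measurable_maxr => //; exact: measurable_minr.
have bt x : `|Num.max (- c) (Num.min (u x) c)| <= c.
  rewrite ler_norml le_max lexx/= ge_max ge_min lexx orbT andbT.
  by rewrite (le_trans _ c0)// oppr_le0.
have Lt : (fun x => Num.max (- c) (Num.min (u x) c)) \in Lfun nu 2%:E.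
  exact: (L2_bounded (itv_measure_fin _ _) mt bt).
apply: (L2_ae Lt mu); apply: itv_ae => x /andP[x1 x2]; have : `|u x| <= c by apply: hc; rewrite !ltW.
by rewrite ler_norml => /andP[h1 h2]; rewrite min_l// max_r.
Qed.

Lemma itv_has_wpartial u : (forall x, derivable u x 1) -> continuous (derive1 u) ->
  has_wpartial nu wd tt u (derive1 u).
Proof.
move=> du cu; split; first exact: itv_L2_continuous.
have cu0 := continuous_derivable du.
apply/(wd_def W) => _ psi [tpsi ->].
have [tu E] := itv_test_mul du cu tpsi.
have cp := itv_test_continuous tpsi.
have I0 : \int[nu]_x derive1 (fun x => u x * psi x) x = 0.
  case: (tu) => dup cup [a' [b' [aa bb h]]].
  rewrite (itv_integral_derive _ (derivable_is_derive dup) cup); last lra.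
  have z x : (x <= -1) || (1 <= x) -> u x * psi x = 0.
    move=> hx; apply/eqP; apply: contraLR hx => /h /andP[h1 h2].
    by rewrite negb_or -!ltNge; apply/andP; split; lra.
  by rewrite !z ?lexx ?orbT// subrr.
have i1 : nu.-integrable setT (EFin \o (fun x => derive1 u x * psi x)).
  by apply: L2_prod; [exact: itv_L2_continuous|exact: itv_test_L2].
have i2 : nu.-integrable setT (EFin \o (fun x => u x * derive1 psi x)).
  by apply: L2_prod; [exact: itv_L2_continuous|exact: itv_test_derive1_L2].
apply/eqP; rewrite -addr_eq0; apply/eqP; rewrite -[RHS]I0 E /ipL2.
have J := Rintegral_lin 1 i2 i1; rewrite mul1r in J.
apply: eq_trans (esym J) _; apply: eq_Rintegral => x _; ring.
Qed.

Lemma Cn_derive1 n u : Cn n.+1 u -> (forall x, derivable u x 1) /\ Cn n (derive1 u).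
Proof.
move=> [du cu]; split; first exact: (du 0%N).
split=> [k kn s|]; first by have := du k.+1 kn s; rewrite derive1Sn.
by move: cu; rewrite derive1Sn.
Qed.

Lemma H2_C2 u : Cn 2 u -> H2 u.
Proof.
move=> /Cn_derive1[d0 /Cn_derive1[d1 [_ c2]]].
have c1 := continuous_derivable d1; have c0 := continuous_derivable d0.
split; first exact: continuous_subspaceT.
apply: (has_sobolev W (g := fun=> derive1 u)) => [|[]|[]]; first exact: itv_L2_continuous.
  exact: itv_has_wpartial.
apply: (has_sobolev W (g := fun=> derive1 (derive1 u))) => [|[]|[]]; first exact: itv_L2_continuous.
  exact: itv_has_wpartial.
by split => //; exact: itv_L2_continuous.
Qed.

Lemma Cn2_is_derive u u' u'' : (forall x : R, is_derive x (1 : R) u (u' x)) ->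
  (forall x : R, is_derive x (1 : R) u' (u'' x)) -> continuous u'' -> Cn 2 u.
Proof.
move=> /is_derive_C1[du E] /is_derive_C1[du' E'] cu; split.
  case=> [|[|k]]; [move=> _ s; exact: du|move=> _ s; rewrite /= E; exact: du'|by []].
by rewrite /= E E'.
Qed.

End H2Smooth.

(** * The product space H^2(-1,1)^2 as a quadratic space *)

Section H22Theory.
Variable R : realType.
Local Notation nu := (@itv_measure R (-1) 1).
Local Notation wd := (@itv_wd R (-1) 1).
Local Notation W := (@itv_weak_derivation R (-1) 1).
Local Notation V := ((R -> R^o) * (R -> R^o))%type.
Implicit Types (u v z : V).

(** The codomain [R^o] supplies the module structure on functions that the abstract quadratic lemmas
    require. *)
Definition isH2 (u : R -> R^o) : Prop := @H2 R u.
Definition H2sq (u : R -> R^o) : R := @H2_sqnorm R u.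
Definition H2ip (u v : R -> R^o) : R := sobolev_ip nu wd 2 u v.

Lemma isH2_lin a (u v : R -> R^o) : isH2 u -> isH2 v -> isH2 (a *: u + v).
Proof. exact: H2_lin. Qed.

Lemma H2sq_NE a (u v : R -> R^o) : isH2 u -> isH2 v ->
  H2sq (a *: u + v) = a ^+ 2 * H2sq u + 2 * a * H2ip u v + H2sq v.
Proof. by move=> [_ hu] [_ hv]; exact: (isSob_NE W a hu hv). Qed.

Lemma H2sq_ge0 (u : R -> R^o) : 0 <= H2sq u.
Proof. exact: H2_sqnorm_ge0. Qed.

Definition isH22 z : Prop := isH2 z.1 /\ isH2 z.2.
Definition H22sq z : R := H2sq z.1 + H2sq z.2.
Definition H22ip z z' : R := H2ip z.1 z'.1 + H2ip z.2 z'.2.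

Lemma isH22_lin a u v : isH22 u -> isH22 v -> isH22 (a *: u + v).
Proof. by case=> u1 u2 [v1 v2]; split; [exact: isH2_lin u1 v1|exact: isH2_lin u2 v2]. Qed.

Lemma H22sq_ge0 u : 0 <= H22sq u.
Proof. by rewrite addr_ge0// H2sq_ge0. Qed.

Lemma H22sq_NE a u v : isH22 u -> isH22 v ->
  H22sq (a *: u + v) = a ^+ 2 * H22sq u + 2 * a * H22ip u v + H22sq v.
Proof.
case=> [u1 u2] [v1 v2]; rewrite /H22sq /H22ip.
have -> : (a *: u + v).1 = a *: u.1 + v.1 by [].
have -> : (a *: u + v).2 = a *: u.2 + v.2 by [].
rewrite (H2sq_NE a u1 v1) (H2sq_NE a u2 v2).
move: (H2sq u.1) (H2sq u.2) (H2ip u.1 v.1) (H2ip u.2 v.2) (H2sq v.1) (H2sq v.2).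
by move=> *; ring.
Qed.

Lemma H2sq_fst z : H2sq z.1 <= H22sq z.
Proof. by rewrite lerDl H2sq_ge0. Qed.

Lemma H2sq_snd z : H2sq z.2 <= H22sq z.
Proof. by rewrite lerDr H2sq_ge0. Qed.

Lemma H22_complete (u : nat -> V) : (forall n, isH22 (u n)) ->
  cauchy_sq H22sq u -> exists l, isH22 l /\ cvg_sq H22sq u l.
Proof.
move=> hu cu.
have h1 n : isH2 (u n).1 by have [h _] := hu n; exact: h.
have h2 n : isH2 (u n).2 by have [_ h] := hu n; exact: h.
have k1 : cauchy_sq H2sq (fun n => (u n).1).
  move=> e /cu[n0 h]; exists n0 => n m nn mm.
  exact: le_trans (H2sq_fst (u n - u m)) (h n m nn mm).
have k2 : cauchy_sq H2sq (fun n => (u n).2).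
  move=> e /cu[n0 h]; exists n0 => n m nn mm.
  exact: le_trans (H2sq_snd (u n - u m)) (h n m nn mm).
have [l1 [hl1 c1]] := H2_complete h1 k1.
have [l2 [hl2 c2]] := H2_complete h2 k2.
exists (l1, l2); split; first by split; [exact: hl1|exact: hl2].
move=> e e0; have e2 : 0 < e / 2 by rewrite divr_gt0.
have [n1 q1] := c1 _ e2; have [n2 q2] := c2 _ e2.
exists (maxn n1 n2) => n; rewrite geq_max => /andP[/q1 a1 /q2 a2].
have -> : e = e / 2 + e / 2 by field.
exact: lerD a1 a2.
Qed.

Lemma H22sq0_eq u v : isH22 u -> isH22 v -> H22sq (u - v) = 0 -> @eq_H22 R u v.
Proof.
move=> hu hv h s hs; have [h1 h2] : isH22 (u - v) by exact: (quad_sub isH22_lin).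
have z1 : H2sq (u - v).1 = 0.
  by apply/eqP; rewrite eq_le H2sq_ge0 andbT -h H2sq_fst.
have z2 : H2sq (u - v).2 = 0.
  by apply/eqP; rewrite eq_le H2sq_ge0 andbT -h H2sq_snd.
have b1 := H2_sup h1 hs; have b2 := H2_sup h2 hs.
rewrite -/(H2sq _) z1 sqrtr0 mulr0 in b1; rewrite -/(H2sq _) z2 sqrtr0 mulr0 in b2.
have e1 : u.1 s - v.1 s = 0 by apply/eqP; rewrite -normr_le0; exact: b1.
have e2 : u.2 s - v.2 s = 0 by apply/eqP; rewrite -normr_le0; exact: b2.
by split; apply/eqP; rewrite -subr_eq0; apply/eqP.
Qed.

End H22Theory.

Lemma ae_forall_fin d (T : measurableType d) (R : realType) (mu : {measure set T -> \bar R})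
    (I : finType) (P : I -> T -> Prop) :
  (forall i, \forall x \ae mu, P i x) -> \forall x \ae mu, forall i, P i x.
Proof. exact: filter_forall. Qed.

(** * The operator in H^{-1} *)

Section NegativeSobolev.
Variables (R : realType) (d : nat).
Local Notation mu := (torus_measure R d).
Local Notation wd := (@torus_wd R d).
Local Notation W := (torus_weak_derivation R d).
Local Notation L := (('rV[R]_d -> R) -> R).
Implicit Types (u v w : 'rV[R]_d -> R) (l : L).

Lemma Hk_norm_ge0 k u : 0 <= Hk_norm k u.
Proof. exact: sqrtr_ge0. Qed.

Lemma Hk_lin k (a : R) u v : Hk k u -> Hk k v -> Hk k (fun x => a * u x + v x).
Proof. exact: (sobolev_lin W). Qed.

Lemma Hk0 k : Hk k (fun _ : 'rV[R]_d => 0 : R).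
Proof. exact/trig_Hk/trig_poly0. Qed.

Lemma Hk_scale k (a : R) u : Hk k u -> Hk k (fun x => a * u x).
Proof.
move=> hu; have := Hk_lin a hu (Hk0 k).
by congr Hk; apply/funext => x; rewrite addr0.
Qed.

Lemma Hk_normZ k (a : R) u : Hk k u -> Hk_norm k (fun x => a * u x) = `|a| * Hk_norm k u.
Proof.
move=> hu; have := @quadZ R ('rV[R]_d -> R^o) _ _ _
  (isSob_lin W (k := k)) (@isSob_NE _ _ _ _ _ _ _ W k) a _ hu.
by rewrite /Hk_norm /sobolev_norm => E; rewrite -sqrtr_sqr -sqrtrM ?sqr_ge0//; congr Num.sqrt.
Qed.

Lemma Hk_normD k u v : Hk k u -> Hk k v ->
  Hk_norm k (fun x => u x + v x) <= Hk_norm k u + Hk_norm k v.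
Proof.
move=> hu hv.
exact: (@quad_triangle R ('rV[R]_d -> R^o) _ _ _ (sobolev_sqnorm_ge0 (mu := mu) (wd := wd) k)
  (@isSob_NE _ _ _ _ _ _ _ W k) _ _ hu hv).
Qed.

Lemma Hk_norm0 k : Hk_norm k (fun _ : 'rV[R]_d => 0 : R) = 0.
Proof.
by have := Hk_normZ 0 (Hk0 k); rewrite normr0 !mul0r.
Qed.

Lemma Hm1_scale l (a : R) v : Hm1 l -> Hk 1 v -> l (fun x => a * v x) = a * l v.
Proof.
move=> [lin _] hv.
have l0 : l (fun=> 0) = 0.
  have := lin (-1) v v hv hv; rewrite mulN1r addNr.
  by rewrite (_ : (fun x => -1 * v x + v x) = fun=> 0)//; apply/funext => x; rewrite mulN1r addNr.
have := lin a v (fun=> 0) hv (Hk0 1); rewrite l0 addr0 => <-.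
by congr l; apply/funext => x; rewrite addr0.
Qed.

Lemma Hm1_has_sup l : Hm1 l ->
  has_sup [set `|l v| | v in [set v | Hk 1 v /\ Hk_norm 1 v <= 1]].
Proof.
move=> hl; split.
  by exists `|l (fun=> 0)|; exists (fun=> 0) => //; split; [exact: Hk0|rewrite Hk_norm0 ler01].
case: hl => _ [C hC]; exists `|C| => _ /= [v [hv v1] <-].
apply: le_trans (hC v hv) _; apply: le_trans (ler_wpM2r (Hk_norm_ge0 _ _) (ler_norm C)) _.
by rewrite ler_piMr.
Qed.

Lemma Hm1_norm_bound l v : Hm1 l -> Hk 1 v -> `|l v| <= Hm1_norm l * Hk_norm 1 v.
Proof.
(* A vector of zero norm cannot be normalized; there boundedness alone gives [l v = 0]. *)
move=> hl hv; have [v0|v0] := eqVneq (Hk_norm 1 v) 0.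
  by case: (hl) => _ [C /(_ v hv)]; rewrite v0 !mulr0.
have vp : 0 < Hk_norm 1 v by rewrite lt_def v0 Hk_norm_ge0.
rewrite -ler_pdivrMr//.
have -> : `|l v| / Hk_norm 1 v = `|l (fun x => (Hk_norm 1 v)^-1 * v x)|.
  by rewrite Hm1_scale// normrM ger0_norm ?invr_ge0 ?ltW// mulrC.
apply: sup_upper_bound; first exact: Hm1_has_sup.
exists (fun x => (Hk_norm 1 v)^-1 * v x) => //; split; first exact: Hk_scale.
by rewrite Hk_normZ// ger0_norm ?invr_ge0 ?(ltW vp)// mulVf.
Qed.

Lemma Hm1_norm_le l (C : R) : (forall v, Hk 1 v -> `|l v| <= C * Hk_norm 1 v) -> 0 <= C ->
  Hm1_norm l <= C.
Proof.
move=> hC C0; apply: ge_sup.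
  by exists `|l (fun=> 0)|; exists (fun=> 0) => //; split; [exact: Hk0|rewrite Hk_norm0 ler01].
move=> _ /= [v [hv v1] <-]; apply: le_trans (hC v hv) _.
by rewrite ler_piMr.
Qed.

Lemma Hm1_norm_ge0 l : Hm1 l -> 0 <= Hm1_norm l.
Proof.
move=> hl; apply: le_trans (normr_ge0 (l (fun=> 0))) _.
apply: sup_upper_bound; first exact: Hm1_has_sup.
by exists (fun=> 0) => //; split; [exact: Hk0|rewrite Hk_norm0 ler01].
Qed.

Lemma eq_Hm1_norm l l' : eq_Hm1 l l' -> Hm1_norm l = Hm1_norm l'.
Proof.
move=> h; rewrite /Hm1_norm; congr sup; apply/seteqP; split => _ [v [hv v1] <-].
  by exists v => //; rewrite h.
by exists v => //; rewrite h.
Qed.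

Lemma Hm1_lin (a : R) l l' : Hm1 l -> Hm1 l' -> Hm1 (fun v => a * l v + l' v).
Proof.
move=> hl hl'; split.
  by case: hl hl' => lin _ [lin' _] c v w hv hw; rewrite lin// lin'//; ring.
exists (`|a| * Hm1_norm l + Hm1_norm l') => v hv.
apply: le_trans (ler_normD _ _) _; rewrite normrM mulrDl -mulrA.
by apply: lerD; [rewrite ler_wpM2l// Hm1_norm_bound|exact: Hm1_norm_bound].
Qed.

Lemma Hm1_norm_lin_le (a : R) l l' : Hm1 l -> Hm1 l' ->
  Hm1_norm (fun v => a * l v + l' v) <= `|a| * Hm1_norm l + Hm1_norm l'.
Proof.
move=> hl hl'; apply: Hm1_norm_le => [v hv|]; last first.
  by rewrite addr_ge0 ?mulr_ge0 ?Hm1_norm_ge0.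
apply: le_trans (ler_normD _ _) _; rewrite normrM mulrDl -mulrA.
by apply: lerD; [rewrite ler_wpM2l// Hm1_norm_bound|exact: Hm1_norm_bound].
Qed.

Lemma Hm1_sub l l' : Hm1 l -> Hm1 l' -> Hm1 (fun v => l v - l' v).
Proof.
move=> hl hl'; have := Hm1_lin (-1) hl' hl.
by congr Hm1; apply/funext => v; rewrite mulN1r addrC.
Qed.

Lemma Hm1_norm0_eq l : Hm1 l -> Hm1_norm l = 0 -> forall v, Hk 1 v -> l v = 0.
Proof.
move=> hl l0 v hv; apply/eqP; rewrite -normr_le0.
by have := Hm1_norm_bound hl hv; rewrite l0 mul0r.
Qed.

Local Notation nL2 g := (Num.sqrt (sqnormL2 mu g)).

Lemma pd_norm_le k i u : Hk_norm k (pd i u) <= Hk_norm k.+1 u.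
Proof. by apply: ler_wsqrtr; rewrite /pd; exact: (@sqn_wpartial_le _ _ _ mu _ wd k). Qed.

Lemma nL2_le_Hk k u : nL2 u <= Hk_norm k u.
Proof. by apply: ler_wsqrtr; exact: (@sqnormL2_le_sobolev _ _ _ mu _ wd k). Qed.

Lemma pd_nL2_le i u : nL2 (pd i u) <= Hk_norm 1 u.
Proof. exact: le_trans (nL2_le_Hk 0 _) (pd_norm_le 0 i u). Qed.

Lemma integrable_div (g : 'I_d -> 'rV[R]_d -> R) v :
  (forall i, g i \in Lfun mu 2%:E) -> Hk 1 v ->
  mu.-integrable setT (EFin \o (fun x => \sum_(i < d) g i x * pd i v x)) /\
  div g v = - \sum_(i < d) ipL2 mu (g i) (pd i v).
Proof.
move=> hg hv.
have ig i : mu.-integrable setT (EFin \o (fun x => g i x * pd i v x)).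
  by apply: L2_prod => //; exact: pd_L2 hv.
have [h1 h2] := Rintegral_seq_sum (enum 'I_d) ig.
have E : (fun x => \sum_(i < d) g i x * pd i v x) =
    (fun x => \sum_(i <- enum 'I_d) g i x * pd i v x).
  by apply/funext => x; rewrite big_enum.
split; first by rewrite E.
by rewrite /div E; congr (- _); apply: eq_trans h2 _; rewrite big_enum.
Qed.

Lemma div_lin (a : R) (g h : 'I_d -> 'rV[R]_d -> R) v :
  (forall i, g i \in Lfun mu 2%:E) -> (forall i, h i \in Lfun mu 2%:E) -> Hk 1 v ->
  div (fun i x => a * g i x + h i x) v = a * div g v + div h v.
Proof.
move=> hg hh hv.
have hgh i : (fun x => a * g i x + h i x) \in Lfun mu 2%:E by exact: L2_lin.
have [_ ->] := integrable_div hg hv; have [_ ->] := integrable_div hh hv.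
have [_ ->] := integrable_div hgh hv.
rewrite mulrN -opprD; congr (- _); rewrite mulr_sumr -big_split /=.
by apply: eq_bigr => i _; rewrite ipL2_lin//; exact: pd_L2 hv.
Qed.

Lemma div_ae (g h : 'I_d -> 'rV[R]_d -> R) v :
  (forall i, g i \in Lfun mu 2%:E) -> (forall i, h i \in Lfun mu 2%:E) -> Hk 1 v ->
  (forall i, \forall x \ae mu, g i x = h i x) -> div g v = div h v.
Proof.
move=> hg hh hv gh; have [_ ->] := integrable_div hg hv; have [_ ->] := integrable_div hh hv.
by congr (- _); apply: eq_bigr => i _; apply: ipL2_ae => //; exact: pd_L2 hv.
Qed.

Lemma div_bound (C : R) (g : 'I_d -> 'rV[R]_d -> R) v :
  (forall i, g i \in Lfun mu 2%:E) -> (forall i, nL2 (g i) <= C) -> Hk 1 v ->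
  `|div g v| <= d%:R * C * Hk_norm 1 v.
Proof.
move=> hg hC hv; have [_ ->] := integrable_div hg hv; rewrite normrN.
apply: le_trans (ler_norm_sum _ _ _) _.
apply: (@le_trans _ _ (\sum_(i < d) C * Hk_norm 1 v)).
  apply: ler_sum => i _; apply: le_trans (ipL2_CS (hg i) (pd_L2 i hv)) _.
  by apply: ler_pM; rewrite ?sqrtr_ge0// pd_nL2_le.
by rewrite sumr_const card_ord -mulrA mulr_natl.
Qed.

Lemma div_Hm1 (g : 'I_d -> 'rV[R]_d -> R) : (forall i, g i \in Lfun mu 2%:E) -> Hm1 (div g).
Proof.
move=> hg; split=> [a v w hv hw|].
  have [_ ->] := integrable_div hg hv; have [_ ->] := integrable_div hg hw.
  have [_ ->] := integrable_div hg (Hk_lin a hv hw).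
  rewrite mulrN -opprD; congr (- _); rewrite mulr_sumr -big_split /=.
  apply: eq_bigr => i _; have Lv := pd_L2 i hv; have Lw := pd_L2 i hw.
  rewrite !(ipL2C mu (g i)) -ipL2_lin//.
  apply: ipL2_ae => //; [exact: (pd_L2 i (Hk_lin a hv hw))|exact: L2_lin|].
  exact: (pd_lin i a hv hw).
exists (d%:R * \sum_(i < d) nL2 (g i)) => v hv; apply: div_bound => // i.
by rewrite (bigD1 i)//= lerDl sumr_ge0// => j _; exact: sqrtr_ge0.
Qed.

Lemma nL2D (g h : 'rV[R]_d -> R) : g \in Lfun mu 2%:E -> h \in Lfun mu 2%:E ->
  nL2 (fun x => g x + h x) <= nL2 g + nL2 h.
Proof.
move=> hg hh.
exact: (@quad_triangle R ('rV[R]_d -> R^o) _ _ _ (@sqnormL2_ge0 _ _ _ mu) (@isL2_NE _ _ _ mu) _ _ hg hh).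
Qed.

Lemma nL2_mul_le (c : R) (q w : 'rV[R]_d -> R) : measurable_fun setT q ->
  (forall x, `|q x| <= c) -> w \in Lfun mu 2%:E ->
  (fun x => q x * w x) \in Lfun mu 2%:E /\ nL2 (fun x => q x * w x) <= c * nL2 w.
Proof.
move=> mq qc hw; have c0 : 0 <= c := le_trans (normr_ge0 _) (qc 0).
have hqw := L2_bounded_mul mq qc hw; split => //.
rewrite -[c in leRHS]ger0_norm// -sqrtr_sqr -sqrtrM ?sqr_ge0//; apply: ler_wsqrtr.
by apply: sqnormL2_le_mul => // x; rewrite normrM ler_wpM2r.
Qed.

Lemma Hk_sum (I : Type) k (s : seq I) (f : I -> 'rV[R]_d -> R) : (forall j, Hk k (f j)) ->
  Hk k (fun x => \sum_(j <- s) f j x) /\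
  Hk_norm k (fun x => \sum_(j <- s) f j x) <= \sum_(j <- s) Hk_norm k (f j).
Proof.
move=> hf; elim: s => [|i s [IH1 IH2]].
  have -> : (fun x => \sum_(j <- [::]) f j x) = (fun=> 0) by apply/funext => x; rewrite big_nil.
  by rewrite big_nil Hk_norm0; split; [exact: Hk0|].
have -> : (fun x => \sum_(j <- i :: s) f j x) = (fun x => 1 * f i x + \sum_(j <- s) f j x).
  by apply/funext => x; rewrite big_cons mul1r.
split; first exact: Hk_lin.
rewrite big_cons; apply: le_trans (Hk_normD (Hk_scale 1 (hf i)) IH1) _.
by rewrite Hk_normZ// normr1 mul1r lerD2l.
Qed.

Lemma pd_Hk k i u : Hk k.+1 u -> Hk k (pd i u).
Proof. exact: sobolev_wpartial. Qed.

Lemma HkW k u : Hk k.+1 u -> Hk k u.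
Proof. exact: sobolevW. Qed.

Lemma laplacian_Hk k u : Hk k.+2 u ->
  Hk k (laplacian u) /\ Hk_norm k (laplacian u) <= d%:R * Hk_norm k.+2 u.
Proof.
move=> hu; have h j : Hk k (pd j (pd j u)) by do 2! apply: pd_Hk.
have [h1 h2] := Hk_sum (enum 'I_d) h.
have E : laplacian u = (fun x => \sum_(j <- enum 'I_d) pd j (pd j u) x).
  by apply/funext => x; rewrite big_enum.
rewrite E; split => //; apply: le_trans h2 _; rewrite big_enum /=.
apply: (@le_trans _ _ (\sum_(j < d) Hk_norm k.+2 u)).
  by apply: ler_sum => j _; apply: le_trans (pd_norm_le k j _) (pd_norm_le k.+1 j u).
by rewrite sumr_const card_ord mulr_natl.
Qed.

Lemma pd_ae i u v : u \in Lfun mu 2%:E -> v \in Lfun mu 2%:E ->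
  (\forall x \ae mu, u x = v x) -> pd i u = pd i v.
Proof. by move=> hu hv uv; exact: (wpartial_ae W i hu hv uv). Qed.

(** Linearity of the inner derivative holds almost everywhere only, yet it may be used under the
    outer one since the chosen derivative depends only on the class of its argument. *)
Lemma laplacian_lin (a : R) u v : Hk 2 u -> Hk 2 v ->
  \forall x \ae mu, laplacian (fun x => a * u x + v x) x = a * laplacian u x + laplacian v x.
Proof.
move=> hu hv.
have H j : \forall x \ae mu, pd j (pd j (fun x => a * u x + v x)) x =
    a * pd j (pd j u) x + pd j (pd j v) x.
  rewrite (pd_ae j _ _ (pd_lin j a hu hv)).
  - exact: pd_lin (pd_Hk j hu) (pd_Hk j hv).
  - exact: pd_L2 (Hk_lin a hu hv).
  - by apply: L2_lin; [exact: pd_L2 hu|exact: pd_L2 hv].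
have H' := ae_forall_fin H; apply: filterS H' => x hx.
by rewrite /laplacian mulr_sumr -big_split; apply: eq_bigr => j _; exact: hx.
Qed.

Lemma grad_laplacian_L2 i u : Hk 3 u -> pd i (laplacian u) \in Lfun mu 2%:E /\
  nL2 (pd i (laplacian u)) <= d%:R * Hk_norm 3 u.
Proof.
move=> hu; have [h1 h2] := laplacian_Hk hu; split; first exact: pd_L2 h1.
exact: le_trans (pd_nL2_le i _) h2.
Qed.

Lemma grad_laplacian_sub i u v : Hk 3 u -> Hk 3 v ->
  nL2 (fun x => pd i (laplacian u) x - pd i (laplacian v) x) <=
  d%:R * Hk_norm 3 (fun x => u x - v x).
Proof.
move=> hu hv.
have E : (fun x => u x - v x) = (fun x => -1 * v x + u x) by apply/funext => x; ring.
have hw : Hk 3 (fun x => u x - v x) by rewrite E; exact: Hk_lin.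
have [h1 h2] := laplacian_Hk hw; apply: le_trans h2.
apply: le_trans (pd_nL2_le i _); apply: eq_leW; congr Num.sqrt.
have [lu _] := laplacian_Hk hu; have [lv _] := laplacian_Hk hv.
have A := laplacian_lin (-1) (HkW hv) (HkW hu).
have D := pd_lin i (-1) lv lu.
have Lw : laplacian (fun x => -1 * v x + u x) \in Lfun mu 2%:E.
  exact: (sobolev_L2 (laplacian_Hk (Hk_lin (-1) hv hu)).1).
have Ll := Hk_lin (-1) lv lu.
have E2 : pd i (laplacian (fun x => u x - v x)) =
    pd i (fun x => -1 * laplacian v x + laplacian u x).
  transitivity (pd i (laplacian (fun x => -1 * v x + u x))); first by congr (pd i (laplacian _)).
  exact: (pd_ae i Lw (sobolev_L2 Ll) A).
apply: eq_trans (congr1 (sqnormL2 mu) (esym E2)); apply: sqnormL2_ae.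
- have -> : (fun x => pd i (laplacian u) x - pd i (laplacian v) x) =
      (fun x => -1 * pd i (laplacian v) x + pd i (laplacian u) x).
    by apply/funext => x; rewrite mulN1r addrC.
  exact: L2_lin (pd_L2 i lv) (pd_L2 i lu).
- exact: pd_L2 Ll.
have ringE (p q : R) : p - q = -1 * q + p by ring.
apply: filterS D => x Dx; exact: eq_trans (ringE _ _) (esym Dx).
Qed.

End NegativeSobolev.

(** * The operator at an admissible state and its dependence on that state *)

Section Operator.
Variables (R : realType) (d : nat) (gamma : R).
Local Notation mu := (torus_measure R d).
Local Notation nL2 g := (Num.sqrt (sqnormL2 mu g)).
Local Notation norm2 b := (Num.sqrt (H2_sqnorm b)).
Local Notation V := ((R -> R^o) * (R -> R^o))%type.
Implicit Types (u v : 'rV[R]_d -> R) (b : R -> R) (z : V).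

Lemma H3_sub u v : H3 u -> H3 v -> H3 (fun x => u x - v x).
Proof.
move=> [pu cu hu] [pv cv hv]; split; [by move=> i x; rewrite pu pv|exact: continuous_rowB|].
have := Hk_lin (-1) hv hu; congr Hk; apply/funext => x.
by rewrite mulN1r addrC.
Qed.

Definition state u : Prop := H3 u /\ forall x, -1 <= u x <= 1.

(** The sup bound makes H^3 convergence uniform; strict inequalities become weak ones in the limit,
    which is why [state] uses the closed interval. *)
Lemma state_closure u (v : R -> 'rV[R]_d -> R) : (d <= 3)%N -> H3 u ->
  (forall e : R, 0 < e -> [/\ H3 (v e), forall x, -1 < v e x < 1 &
    Hk_norm 3 (fun x => u x - v e x) <= e]) -> state u.
Proof.
move=> d3 hu hv; split => // x; rewrite -ler_norml; apply/ler_addgt0Pr => e e0.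
(* The factor 2^3 is the constant of the sup bound. *)
have e8 : 0 < e / 2 ^+ 3 by rewrite divr_gt0// exprn_gt0.
have [hve rve le_e] := hv _ e8; have /andP[h1 h2] := rve x.
have := le_trans (H3_bound x d3 (H3_sub hu hve)) (ler_wpM2l (exprn_ge0 3 (ler0n _ 2)) le_e).
rewrite mulrCA divff ?expf_neq0// mulr1 !ler_norml => /andP[h3 h4]; apply/andP; split; lra.
Qed.

Lemma state_comp b u : H2 b -> state u ->
  measurable_fun setT (fun x => b (u x)) /\ forall x, `|b (u x)| <= 6 * norm2 b.
Proof.
move=> hb [[_ cu _] ru]; split; last by move=> x; exact: H2_sup.
exact: (measurableT_comp (L2_measurable (H2_L2 hb)) (measurable_continuous_row cu)).
Qed.

Lemma state_mul b u (w : 'rV[R]_d -> R) : H2 b -> state u -> w \in Lfun mu 2%:E ->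
  (fun x => b (u x) * w x) \in Lfun mu 2%:E /\
  nL2 (fun x => b (u x) * w x) <= 6 * norm2 b * nL2 w.
Proof. by move=> hb su; have [h1 h2] := state_comp hb su; exact: nL2_mul_le. Qed.

Lemma state_L2 u i : state u -> pd i u \in Lfun mu 2%:E /\ pd i (laplacian u) \in Lfun mu 2%:E.
Proof.
by case=> [[_ _ hu] _]; split; [exact: pd_L2 hu|exact: (grad_laplacian_L2 i hu).1].
Qed.

Lemma CHop_L2 u z i : state u -> isH22 z ->
  (fun x => z.1 (u x) * pd i (laplacian u) x) \in Lfun mu 2%:E /\
  (fun x => z.2 (u x) * pd i u x) \in Lfun mu 2%:E.
Proof.
move=> su [h1 h2]; have [l1 l2] := state_L2 i su.
by split; [exact: (state_mul h1 su l2).1|exact: (state_mul h2 su l1).1].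
Qed.

Lemma CHop_Hm1 u z : state u -> isH22 z -> Hm1 (CHop gamma u z).
Proof.
move=> su hz; apply: Hm1_lin; apply: div_Hm1 => i; have [l1 l2] := CHop_L2 i su hz.
  exact: l1.
exact: l2.
Qed.

Lemma CHop_lin u (a : R) z z' v : state u -> isH22 z -> isH22 z' -> Hk 1 v ->
  CHop gamma u (a *: z + z') v = a * CHop gamma u z v + CHop gamma u z' v.
Proof.
move=> su hz hz' hv.
have l1 i := (CHop_L2 i su hz).1; have l1' i := (CHop_L2 i su hz').1.
have l2 i := (CHop_L2 i su hz).2; have l2' i := (CHop_L2 i su hz').2.
have e1 := div_lin a l1 l1' hv; have e2 := div_lin a l2 l2' hv.
rewrite /CHop.
have -> : (fun (i : 'I_d) x => (a *: z + z').1 (u x) * pd i (laplacian u) x) =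
  (fun i x => a * (z.1 (u x) * pd i (laplacian u) x) + z'.1 (u x) * pd i (laplacian u) x).
  apply/funext => i; apply/funext => x.
  by change ((a * z.1 (u x) + z'.1 (u x)) * pd i (laplacian u) x =
    a * (z.1 (u x) * pd i (laplacian u) x) + z'.1 (u x) * pd i (laplacian u) x); ring.
have -> : (fun (i : 'I_d) x => (a *: z + z').2 (u x) * pd i u x) =
  (fun i x => a * (z.2 (u x) * pd i u x) + z'.2 (u x) * pd i u x).
  apply/funext => i; apply/funext => x.
  by change ((a * z.2 (u x) + z'.2 (u x)) * pd i u x =
    a * (z.2 (u x) * pd i u x) + z'.2 (u x) * pd i u x); ring.
rewrite e1 e2.
have ringE (A A' B B' : R) :
  - gamma * (a * A + A') + (a * B + B') = a * (- gamma * A + B) + (- gamma * A' + B') by ring.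
exact: ringE.
Qed.

Lemma Hk_normWle j k u : (j <= k)%N -> Hk_norm j u <= Hk_norm k u.
Proof.
elim: k => [|k IH]; first by rewrite leqn0 => /eqP ->.
rewrite leq_eqVlt => /predU1P[-> //|]; rewrite ltnS => /IH h; apply: le_trans h _.
by apply: ler_wsqrtr; exact: (@sobolev_sqnormW _ _ _ mu _ (@torus_wd R d)).
Qed.

Lemma two_div_bound (g h : 'I_d -> 'rV[R]_d -> R) (A B : R) v :
  (forall i, g i \in Lfun mu 2%:E) -> (forall i, nL2 (g i) <= A) ->
  (forall i, h i \in Lfun mu 2%:E) -> (forall i, nL2 (h i) <= B) -> Hk 1 v ->
  `|- gamma * div g v + div h v| <= d%:R * (`|gamma| * A + B) * Hk_norm 1 v.
Proof.
move=> hg gA hh hB hv; apply: le_trans (ler_normD _ _) _.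
rewrite mulrDr mulrDl; apply: lerD; last exact: div_bound.
rewrite normrM normrN mulrCA -!mulrA ler_wpM2l// mulrA.
exact: div_bound.
Qed.

Lemma CHop_bound u : state u -> exists2 K : R, 0 <= K &
  forall z, isH22 z -> Hm1_norm (CHop gamma u z) <= K * Num.sqrt (H22sq z).
Proof.
move=> su; have [[_ _ hu] _] := su; have n0 := Hk_norm_ge0 3 u.
exists (d%:R * (`|gamma| * (6 * (d%:R * Hk_norm 3 u)) + 6 * Hk_norm 3 u)).
  by rewrite !(mulr_ge0, addr_ge0).
move=> z hz; have [h1 h2] := hz; have s0 : 0 <= Num.sqrt (H22sq z) by exact: sqrtr_ge0.
apply: Hm1_norm_le => [v hv|]; last by rewrite !(mulr_ge0, addr_ge0).
set s := Num.sqrt (H22sq z).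
have -> : d%:R * (`|gamma| * (6 * (d%:R * Hk_norm 3 u)) + 6 * Hk_norm 3 u) * s =
    d%:R * (`|gamma| * (6 * s * (d%:R * Hk_norm 3 u)) + 6 * s * Hk_norm 3 u) by ring.
apply: two_div_bound => // i; have [l1 l2] := CHop_L2 i su hz; have [k1 k2] := state_L2 i su.
- exact: l1.
- apply: le_trans (state_mul h1 su k2).2 _; apply: ler_pM; rewrite ?mulr_ge0 ?sqrtr_ge0//.
    by rewrite ler_wpM2l//; apply: ler_wsqrtr; exact: H2sq_fst.
  exact: (grad_laplacian_L2 i hu).2.
- exact: l2.
apply: le_trans (state_mul h2 su k1).2 _; apply: ler_pM; rewrite ?mulr_ge0 ?sqrtr_ge0//.
  by rewrite ler_wpM2l//; apply: ler_wsqrtr; exact: H2sq_snd.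
exact: le_trans (pd_nL2_le i u) (Hk_normWle u (isT : (1 <= 3)%N)).
Qed.

(** Write the difference as (b(u) - b(u')) w + b(u') (w - w'). The first term takes the Lipschitz
    bound of [b], the second its sup bound; only [w], attached to [u], occurs alone on the right. *)
Lemma state_mul_sub b u u' (w w' : 'rV[R]_d -> R) (dl : R) : H2 b -> state u -> state u' ->
  (forall x, `|u x - u' x| <= dl) -> w \in Lfun mu 2%:E -> w' \in Lfun mu 2%:E ->
  (fun x => b (u x) * w x - b (u' x) * w' x) \in Lfun mu 2%:E /\
  nL2 (fun x => b (u x) * w x - b (u' x) * w' x) <=
  6 * norm2 b * (dl * nL2 w + nL2 (fun x => w x - w' x)).
Proof.
move=> hb su su' hd hw hw'.
have Lww : (fun x => w x - w' x) \in Lfun mu 2%:E.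
  exact: (quad_sub (@isL2_lin _ _ _ mu) hw hw').
have [m1 _] := state_comp hb su; have [m2 b2] := state_comp hb su'.
have lip x : `|b (u x) - b (u' x)| <= 6 * norm2 b * dl.
  apply: le_trans (H2_lipschitz hb (su.2 x) (su'.2 x)) _.
  by rewrite ler_wpM2l// mulr_ge0// sqrtr_ge0.
have [p1 p2] := nL2_mul_le (measurable_funB m1 m2) lip hw.
have [q1 q2] := nL2_mul_le m2 b2 Lww.
have E : (fun x => b (u x) * w x - b (u' x) * w' x) =
    (fun x => (b (u x) - b (u' x)) * w x + b (u' x) * (w x - w' x)).
  by apply/funext => x; ring.
rewrite E; split.
  exact: (quad_add (@isL2_lin _ _ _ mu) p1 q1).
apply: le_trans (nL2D p1 q1) _; rewrite mulrDr; apply: lerD => //.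
by rewrite mulrA.
Qed.

(** Both fluxes are differences of the preceding kind, with the gradient of the Laplacian or of the
    state as second factor. The constant is built from the norm of [u] alone, so it is uniform over
    all perturbed states. *)
Lemma CHop_perturb u : (d <= 3)%N -> state u -> exists2 C : R, 0 <= C & forall u' z,
  state u' -> isH22 z ->
  Hm1_norm (fun v => CHop gamma u z v - CHop gamma u' z v) <=
  C * Hk_norm 3 (fun x => u x - u' x) * Num.sqrt (H22sq z).
Proof.
move=> d3 su; have [hu3 _] := su; have [_ _ hu] := hu3; have n0 := Hk_norm_ge0 3 u.
have dR : 0 <= (d%:R : R) by exact: ler0n.
pose C := d%:R * (`|gamma| * (6 * (2 ^+ 3 * (d%:R * Hk_norm 3 u) + d%:R)) + 6 * (2 ^+ 3 * Hk_norm 3 u + 1)).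
have C0 : 0 <= C by rewrite !(mulr_ge0, addr_ge0).
exists C => //.
move=> u' z su' hz; have [hu3' _] := su'; have [_ _ hu'] := hu3'; have [h1 h2] := hz.
set w := fun x => u x - u' x.
have hw : H3 w by exact: H3_sub.
have bd x : `|u x - u' x| <= 2 ^+ 3 * Hk_norm 3 w := H3_bound x d3 hw.
have e0 := Hk_norm_ge0 3 w; set e := Hk_norm 3 w in e0 bd *.
set s := Num.sqrt (H22sq z); have s0 : 0 <= s by exact: sqrtr_ge0.
apply: Hm1_norm_le => [v hv|]; last by rewrite mulr_ge0// mulr_ge0.
have G1 i := state_mul_sub h1 su su' bd (state_L2 i su).2 (state_L2 i su').2.
have G2 i := state_mul_sub h2 su su' bd (state_L2 i su).1 (state_L2 i su').1.
pose g i x := z.1 (u x) * pd i (laplacian u) x - z.1 (u' x) * pd i (laplacian u') x.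
pose h i x := z.2 (u x) * pd i u x - z.2 (u' x) * pd i u' x.
have E : CHop gamma u z v - CHop gamma u' z v = - gamma * div g v + div h v.
  have E1 := div_lin (-1) (fun i => (CHop_L2 i su' hz).1) (fun i => (CHop_L2 i su hz).1) hv.
  have E2 := div_lin (-1) (fun i => (CHop_L2 i su' hz).2) (fun i => (CHop_L2 i su hz).2) hv.
  have ringE (p q : R) : p - q = -1 * q + p by ring.
  have -> : g = (fun i x => -1 * (z.1 (u' x) * pd i (laplacian u') x) + z.1 (u x) * pd i (laplacian u) x).
    by apply/funext => i; apply/funext => x; exact: ringE.
  have -> : h = (fun i x => -1 * (z.2 (u' x) * pd i u' x) + z.2 (u x) * pd i u x).
    by apply/funext => i; apply/funext => x; exact: ringE.
  rewrite E1 E2 /CHop.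
  have ringE2 (A A' B B' : R) : - gamma * A + B - (- gamma * A' + B') =
    - gamma * (-1 * A' + A) + (-1 * B' + B) by ring.
  exact: ringE2.
rewrite E.
pose X := Hk_norm 3 u.
have -> : C * e * s =
  d%:R * (`|gamma| * (6 * s * (2 ^+ 3 * e * (d%:R * X) + d%:R * e)) + 6 * s * (2 ^+ 3 * e * X + e)).
  by rewrite /C -/X; move: X => X; ring.
have k0 : 0 <= 2 ^+ 3 * e by rewrite mulr_ge0.
apply: two_div_bound => // i.
- exact: (G1 i).1.
- apply: le_trans (G1 i).2 _; apply: ler_pM.
  + by rewrite mulr_ge0 ?sqrtr_ge0.
  + by rewrite addr_ge0 ?mulr_ge0 ?sqrtr_ge0.
  + by rewrite ler_wpM2l//; apply: ler_wsqrtr; exact: H2sq_fst.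
  apply: lerD; last exact: grad_laplacian_sub.
  exact: (ler_wpM2l k0 (grad_laplacian_L2 i hu).2).
- exact: (G2 i).1.
apply: le_trans (G2 i).2 _; apply: ler_pM.
+ by rewrite mulr_ge0 ?sqrtr_ge0.
+ by rewrite addr_ge0 ?mulr_ge0 ?sqrtr_ge0.
+ by rewrite ler_wpM2l//; apply: ler_wsqrtr; exact: H2sq_snd.
apply: lerD.
  exact: (ler_wpM2l k0 (le_trans (pd_nL2_le i u) (Hk_normWle u (isT : (1 <= 3)%N)))).
have hww : Hk 3 w by case: hw.
apply: le_trans (Hk_normWle w (isT : (1 <= 3)%N)); apply: le_trans (pd_nL2_le i w).
apply: eq_leW; congr Num.sqrt; apply: sqnormL2_ae.
- exact: (quad_sub (@isL2_lin _ _ _ mu) (state_L2 i su).1 (state_L2 i su').1).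
- exact: pd_L2 hww.
have D := pd_lin i (-1) hu' hu.
have ringE (p q : R) : p - q = -1 * q + p by ring.
have -> : pd i w = pd i (fun x => -1 * u' x + u x).
  by congr pd; apply/funext => x; exact: ringE.
apply: filterS D => x Dx; exact: eq_trans (ringE _ _) (esym Dx).
Qed.

End Operator.

(** * Tikhonov regularization *)

Section AbstractTikhonov.
Context {R : realType} {V : lmodType R}.
Variables (H : V -> Prop) (N : V -> R) (B : V -> V -> R).
Hypothesis H_lin : forall a u v, H u -> H v -> H (a *: u + v).
Hypothesis N_ge0 : forall u, 0 <= N u.
Hypothesis NE : forall a u v, H u -> H v ->
  N (a *: u + v) = a ^+ 2 * N u + 2 * a * B u v + N v.
Hypothesis N_complete : forall u : nat -> V, (forall n, H (u n)) -> cauchy_sq N u ->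
  exists l, H l /\ cvg_sq N u l.
Implicit Types (u v z : V) (e : V -> R).

(** The last hypothesis combines closedness of [S] with continuity of [J] along [N]-convergent
    sequences. Comparing two minimizers with their midpoint also gives uniqueness up to a null
    difference. *)
Lemma uniformly_convex_minimizer (S : V -> Prop) (J : V -> R) (c : R) : 0 < c ->
  (forall u, S u -> H u) -> (forall u v, S u -> S v -> S (2^-1 *: (u + v))) ->
  (exists u, S u) -> (forall u, S u -> 0 <= J u) ->
  (forall u v, S u -> S v ->
     J (2^-1 *: (u + v)) <= (J u + J v) / 2 - c * N (u - v)) ->
  (forall (u : nat -> V) l, (forall n, S (u n)) -> H l -> cvg_sq N u l ->
     S l /\ forall e : R, 0 < e -> exists n0, forall n, (n0 <= n)%N -> `|J (u n) - J l| <= e) ->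
  exists z, [/\ S z, (forall z', S z' -> J z <= J z') &
    forall z', S z' -> (forall z'', S z'' -> J z' <= J z'') -> N (z' - z) = 0].
Proof.
move=> c0 SH Smid Sne J0 Jmid Jcl.
have [m [m0 mJ [u [Su Ju cu]]]] := uniformly_convex_cauchy c0 SH Smid Sne J0 Jmid.
have [l [Hl cl]] := N_complete (fun n => SH _ (Su n)) cu.
have [Sl Jl] := Jcl u l Su Hl cl.
have lm : J l <= m.
  apply/ler_addgt0Pr => e e0; have e2 : 0 < e / 2 by rewrite divr_gt0.
  have [n0 h0] := Jl _ e2; have [n1 _ h1] := near_natSinv_le e2.
  have := h0 _ (leq_maxl n0 n1); rewrite ler_norml => /andP[_ a2].
  have := h0 _ (leq_maxl n0 n1); rewrite ler_norml => /andP[a1 _].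
  have a3 : (maxn n0 n1).+1%:R^-1 <= e / 2 by apply: h1; rewrite /= leq_maxr.
  by have := Ju (maxn n0 n1); move: ((maxn n0 n1).+1%:R^-1) a3 => k; lra.
exists l; split => // [z' /mJ|z' Sz' hz']; first exact: le_trans.
have := Jmid _ _ Sz' Sl; have := mJ _ (Smid _ _ Sz' Sl); have := hz' _ Sl; have := mJ _ Sl.
move=> h1 h2 h3 h4; apply/eqP; rewrite eq_le N_ge0 andbT.
by rewrite -(pmulr_rle0 _ c0); lra.
Qed.

(* residuals z |-> |A z - y| of bounded linear operators *)
Definition residual e (K : R) : Prop :=
  [/\ forall z, H z -> 0 <= e z,
      forall z z', H z -> H z' -> e (2^-1 *: (z + z')) <= (e z + e z') / 2,
      0 <= K & forall z z', H z -> H z' -> `|e z - e z'| <= K * Num.sqrt (N (z - z'))].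

Lemma residual_cvg e K (u : nat -> V) l : residual e K -> (forall n, H (u n)) -> H l ->
  cvg_sq N u l -> forall eps : R, 0 < eps -> exists n0, forall n, (n0 <= n)%N ->
    `|e (u n) - e l| <= eps.
Proof.
move=> [_ _ K0 lip] hu hl cu eps eps0.
have k1 : 0 < K + 1 by rewrite ltr_wpDl.
have [n0 h] := cu _ (exprn_gt0 2 (divr_gt0 eps0 k1)); exists n0 => n /h {}h.
apply: le_trans (lip _ _ (hu n) hl) _.
have : Num.sqrt (N (u n - l)) <= eps / (K + 1).
  have -> : eps / (K + 1) = Num.sqrt ((eps / (K + 1)) ^+ 2).
    by rewrite sqrtr_sqr ger0_norm// divr_ge0 ?(ltW k1)// ltW.
  exact: ler_wsqrtr.
move=> hs; apply: le_trans (ler_wpM2l K0 hs) _.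
by rewrite mulrCA ler_piMr ?(ltW eps0)// ler_pdivrMr// mul1r lerDl.
Qed.

Lemma H_mid z z' : H z -> H z' -> H (2^-1 *: (z + z')).
Proof. by move=> hz hz'; apply: (quad_scale H_lin); exact: (quad_add H_lin). Qed.

Lemma tikhonov_minimizer e K (alpha : R) : residual e K -> 0 < alpha -> (exists z, H z) ->
  let J z := e z ^+ 2 + alpha * N z in
  exists z, [/\ H z, (forall z', H z' -> J z <= J z') &
    forall z', H z' -> (forall z'', H z'' -> J z' <= J z'') -> N (z' - z) = 0].
Proof.
move=> re a0 Hne J; have [e_ge0 e_mid K0 lip] := re.
have c0 : 0 < alpha / 4 by rewrite divr_gt0.
apply: (uniformly_convex_minimizer c0) => //.
- exact: H_mid.
- by move=> u hu; rewrite addr_ge0 ?sqr_ge0// mulr_ge0// ltW.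
- move=> u v hu hv; rewrite /J (quad_mid H_lin NE hu hv).
  have h0 := e_ge0 _ (H_mid hu hv); have h1 := e_mid _ _ hu hv.
  have : e (2^-1 *: (u + v)) ^+ 2 <= ((e u + e v) / 2) ^+ 2.
    by rewrite lerXn2r// nnegrE (le_trans h0 h1).
  have : ((e u + e v) / 2) ^+ 2 <= (e u ^+ 2 + e v ^+ 2) / 2.
    by have := sqr_ge0 (e u - e v); nra.
  by move: (N u) (N v) (N (u - v)) => *; nra.
move=> u l hu hl cu; split => // eps eps0.
have eps2 : 0 < eps / 2 by rewrite divr_gt0.
have el := e_ge0 _ hl.
(* The difference of squared residuals is (e(u_n) - e(l)) (e(u_n) + e(l)), and the minimum with 1
   bounds the second factor by [2 * e l + 1]. *)
have d0 : 0 < Num.min 1 (eps / 2 / (2 * e l + 1)).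
  by rewrite lt_min ltr01 divr_gt0// ltr_wpDl// mulr_ge0.
have [n0 h0] := residual_cvg re hu hl cu d0.
have [n1 h1] := quad_cvgN H_lin N_ge0 NE hu hl cu (divr_gt0 eps2 a0).
exists (maxn n0 n1) => n; rewrite geq_max => /andP[/h0 q0 /h1 q1].
have -> : J (u n) - J l = (e (u n) - e l) * (e (u n) + e l) + alpha * (N (u n) - N l).
  by rewrite /J; ring.
apply: le_trans (ler_normD _ _) _.
have -> : eps = eps / 2 + eps / 2 by field.
apply: lerD; last by rewrite normrM gtr0_norm// mulrC -ler_pdivlMr.
move: q0; rewrite le_min => /andP[p1 p2].
have en := e_ge0 _ (hu n).
rewrite normrM [`|e (u n) + e l|]ger0_norm ?addr_ge0//.
have : e (u n) + e l <= 2 * e l + 1 by move: p1; rewrite ler_norml => /andP[_]; lra.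
move=> p3; apply: le_trans (ler_wpM2l (normr_ge0 _) p3) _.
by rewrite -ler_pdivlMr// ltr_wpDl// mulr_ge0.
Qed.

(** The zero set of a residual is midpoint convex because residuals are nonnegative and midpoint
    convex, and closed by their Lipschitz bound; [N] itself is uniformly convex on it by the
    parallelogram law. *)
Lemma min_norm_exists e K : residual e K -> (exists z, H z /\ e z = 0) ->
  exists z, [/\ H z, e z = 0 & (forall z', H z' -> e z' = 0 -> N z <= N z') /\
    forall z', H z' -> e z' = 0 -> (forall z'', H z'' -> e z'' = 0 -> N z' <= N z'') ->
      N (z' - z) = 0].
Proof.
move=> re ne; have [e_ge0 e_mid K0 lip] := re.
have c0 : 0 < 1 / 4 :> R by lra.
have [||||||z [[z1 z2] z3 z4]] := @uniformly_convex_minimizer (fun z => H z /\ e z = 0) N _ c0.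
- by move=> u [].
- move=> u v [hu eu] [hv ev]; split; first exact: H_mid.
  apply/eqP; rewrite eq_le e_ge0 ?andbT; last exact: H_mid.
  by have := e_mid _ _ hu hv; rewrite eu ev addr0 mul0r.
- exact: ne.
- by [].
- by move=> u v [hu _] [hv _]; rewrite (quad_mid H_lin NE hu hv); lra.
- move=> u l hu hl cu; have Hu n : H (u n) by case: (hu n).
  split; last exact: (quad_cvgN H_lin N_ge0 NE Hu hl cu).
  split => //; apply/eqP; rewrite -normr_le0; apply/ler_addgt0Pr => eps eps0.
  have [n0 h] := residual_cvg re Hu hl cu eps0.
  by have := h _ (leqnn _); rewrite (proj2 (hu n0)) sub0r normrN add0r.
exists z; split=> //; split => [z' h1 h2|z' h1 h2 h3]; first exact: z3.
by apply: z4 => // z'' [w1 w2]; exact: h3.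
Qed.

(* Nearly feasible points of small norm: midpoints replace weak compactness. *)
Lemma near_feasible_norm e K zdag : residual e K -> H zdag -> e zdag = 0 ->
  (forall z, H z -> e z = 0 -> N zdag <= N z) ->
  forall eps : R, 0 < eps -> exists2 rho : R, 0 < rho & forall z, H z -> e z <= rho ->
    N zdag - eps <= N z.
Proof.
move=> re hzd ezd min eps eps0; have [e_ge0 e_mid K0 lip] := re.
apply: contrapT => no.
have bad rho : 0 < rho -> exists z, [/\ H z, e z <= rho & N z < N zdag - eps].
  move=> r0; apply: contrapT => hno; apply: no; exists rho => // z hz ez.
  by rewrite leNgt; apply/negP => lt; apply: hno; exists z.
pose r (n : nat) : R := n.+1%:R^-1; have r0 n : 0 < r n by rewrite invr_gt0.
have r_anti n m : (n <= m)%N -> r m <= r n.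
  by move=> nm; rewrite /r lef_pV2 ?posrE// ler_nat ltnS.
(* Below, [D n] is the infimum of the squared norm among points of residual at most 1/(n+1). It
   increases with [n], and the absurd hypothesis bounds it by [N zdag - eps], so it has a finite
   supremum. *)
pose F n := [set N z | z in [set z | H z /\ e z <= r n]].
have hF n : has_inf (F n).
  split; last by exists 0 => _ [z _ <-].
  by exists (N zdag), zdag => //; split => //; rewrite ezd ltW.
pose D n := inf (F n).
have DN n z : H z -> e z <= r n -> D n <= N z.
  by move=> hz ez; apply: (ge_inf (hF n).2); exists z.
have DM n : D n <= N zdag - eps.
  by have [z [hz ez nz]] := bad _ (r0 n); exact: le_trans (DN _ _ hz ez) (ltW nz).
have D_mono n m : (n <= m)%N -> D n <= D m.
  move=> nm; apply: lb_le_inf; first exact: (hF m).1.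
  by move=> _ [z [hz ez] <-]; apply: DN => //; exact: le_trans ez (r_anti _ _ nm).
have /choice[z hz] : forall n, exists z, [/\ H z, e z <= r n & N z <= D n + r n].
  move=> n; have [_ [z [hz ez] <-] nz] := inf_adherent (r0 n) (hF n).
  by exists z; split=> //; exact: ltW.
have Hz n : H (z n) by case: (hz n).
pose Dset := [set D n | n in setT].
have hD : has_sup Dset.
  by split; [exists (D 0%N), 0%N|exists (N zdag - eps) => _ [n _ <-]; exact: DM].
have D_sup n : D n <= sup Dset by apply: sup_upper_bound => //; exists n.
have cz : cauchy_sq N z.
  move=> x x0; have x8 : 0 < x / 8 by rewrite divr_gt0.
  have [_ [n1 _ <-] hn1] := sup_adherent x8 hD; have [n2 _ h2] := near_natSinv_le x8.
  (* The midpoint of [z n] and [z m] has residual at most [r n0], hence squared norm at least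
     [D n0], which is within [x / 8] of the supremum; the near-minimality defects are at most
     [x / 8] as well. The parallelogram identity multiplies their sum by 4. *)
  pose n0 := maxn n1 n2; exists n0 => n m nn mm.
  have Hm := H_mid (Hz n) (Hz m).
  have : D n0 <= N (2^-1 *: (z n + z m)).
    apply: DN => //; apply: le_trans (e_mid _ _ (Hz n) (Hz m)) _.
    have [_ a1 _] := hz n; have [_ a2 _] := hz m.
    by have := r_anti _ _ nn; have := r_anti _ _ mm; lra.
  rewrite (quad_mid H_lin NE (Hz n) (Hz m)).
  have [_ _ a1] := hz n; have [_ _ a2] := hz m.
  have b1 := r_anti _ _ nn; have b2 := r_anti _ _ mm.
  have b3 : r n0 <= x / 8 by apply: h2; rewrite /= leq_maxr.
  have b4 : D n1 <= D n0 by apply: D_mono; rewrite leq_maxl.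
  have b5 := D_sup n; have b6 := D_sup m.
  lra.
have [l [Hl cl]] := N_complete Hz cz.
have el : e l = 0.
  apply/eqP; rewrite eq_le e_ge0// andbT; apply/ler_addgt0Pr => x x0; rewrite add0r.
  have x2 : 0 < x / 2 by rewrite divr_gt0.
  have [n0 h0] := residual_cvg re Hz Hl cl x2; have [n1 _ h1] := near_natSinv_le x2.
  have := h0 _ (leq_maxl n0 n1); rewrite ler_norml => /andP[a1 _].
  have [_ a2 _] := hz (maxn n0 n1).
  have : r (maxn n0 n1) <= x / 2 by apply: h1; rewrite /= leq_maxr.
  lra.
have : N l <= N zdag - eps / 2.
  have x4 : 0 < eps / 4 by rewrite divr_gt0.
  have [n0 h0] := quad_cvgN H_lin N_ge0 NE Hz Hl cl x4; have [n1 _ h1] := near_natSinv_le x4.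
  have := h0 _ (leq_maxl n0 n1); rewrite ler_norml => /andP[a1 _].
  have [_ _ a2] := hz (maxn n0 n1).
  have : r (maxn n0 n1) <= eps / 4 by apply: h1; rewrite /= leq_maxr.
  have := DM (maxn n0 n1); lra.
have := min _ Hl el; lra.
Qed.

Lemma near_minimal e K zdag : residual e K -> H zdag -> e zdag = 0 ->
  (forall z, H z -> e z = 0 -> N zdag <= N z) ->
  forall eps : R, 0 < eps -> exists2 rho : R, 0 < rho & exists2 eta : R, 0 < eta &
    forall z, H z -> e z <= rho -> N z <= N zdag + eta -> N (z - zdag) <= eps.
Proof.
move=> re hzd ezd min eps eps0; have [e_ge0 e_mid K0 lip] := re.
(* The parallelogram identity bounds [N (z - zdag) / 4] by half of the excess [eta = eps / 4] plus
   the defect [eps / 8] at the midpoint, that is, by [eps / 4]. *)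
have [rho rho0 h] := near_feasible_norm re hzd ezd min (divr_gt0 eps0 (ltr0Sn R 7)).
exists rho => //; exists (eps / 4); first by rewrite divr_gt0.
move=> z hz ez Nz; have := h _ (H_mid hz hzd); rewrite (quad_mid H_lin NE hz hzd).
have : e (2^-1 *: (z + zdag)) <= rho.
  by apply: le_trans (e_mid _ _ hz hzd) _; rewrite ezd addr0; have := e_ge0 _ hz; lra.
move=> + /(_ _) h'; move=> /h'; lra.
Qed.

Theorem tikhonov_convergence e K zdag (C : R) (e_ : R -> V -> R) (alpha : R -> R) (x : R -> V) :
  residual e K -> H zdag -> e zdag = 0 ->
  (forall z, H z -> e z = 0 -> N zdag <= N z) -> 0 <= C ->
  (forall dl z, 0 < dl -> H z -> `|e_ dl z - e z| <= dl * (C * Num.sqrt (N z) + 1)) ->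
  (forall dl z, 0 < dl -> H z -> 0 <= e_ dl z) ->
  (forall dl, 0 < dl -> 0 < alpha dl) ->
  alpha dl @[dl --> 0^'+] --> 0 -> dl ^+ 2 / alpha dl @[dl --> 0^'+] --> 0 ->
  (forall dl, 0 < dl -> H (x dl) /\
     e_ dl (x dl) ^+ 2 + alpha dl * N (x dl) <= e_ dl zdag ^+ 2 + alpha dl * N zdag) ->
  forall eps : R, 0 < eps -> \forall dl \near 0^'+, N (x dl - zdag) <= eps.
Proof.
move=> re hzd ezd min C0 pert e_ge0 alpha0 ca cq hx eps eps0.
have [rho rho0 [eta eta0 near_min]] := near_minimal re hzd ezd min eps0.
pose C1 := C * Num.sqrt (N zdag) + 1.
have C1_gt0 : 0 < C1 by rewrite ltr_wpDl// mulr_ge0// sqrtr_ge0.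
(* The perturbation bound will also be applied at the minimizer, once its squared norm is known to
   be at most [N zdag + eta]. *)
pose C2 := C * Num.sqrt (N zdag + eta) + 1.
have C2_gt0 : 0 < C2 by rewrite ltr_wpDl// mulr_ge0// sqrtr_ge0.
have rho2 : 0 < (rho / 2) ^+ 2 by rewrite exprn_gt0// divr_gt0.
(* Thresholds: [t1] for delta^2 / alpha keeps the excess of norm below [eta]; [t2] for alpha and
   [t3] for delta^2 each contribute half of [(rho / 2) ^+ 2] to the squared perturbed residual; [t4]
   for delta keeps the change of residual at the minimizer below [rho / 2]. *)
have [t1 t10 ht1] : exists2 t : R, 0 < t & t * C1 ^+ 2 <= eta.
  by exists (eta / C1 ^+ 2); [rewrite divr_gt0// exprn_gt0|rewrite divfK// gt_eqF// exprn_gt0].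
have [t2 t20 ht2] : exists2 t : R, 0 < t & t * (N zdag + 1) <= (rho / 2) ^+ 2 / 2.
  have h : 0 < N zdag + 1 by rewrite ltr_wpDl.
  by exists ((rho / 2) ^+ 2 / 2 / (N zdag + 1)); [rewrite divr_gt0// divr_gt0|rewrite divfK// gt_eqF].
have [t3 t30 ht3] : exists2 t : R, 0 < t & t * C1 ^+ 2 <= (rho / 2) ^+ 2 / 2.
  by exists ((rho / 2) ^+ 2 / 2 / C1 ^+ 2); [rewrite !divr_gt0// exprn_gt0|rewrite divfK// gt_eqF// exprn_gt0].
have [t4 t40 ht4] : exists2 t : R, 0 < t & t * C2 <= rho / 2.
  by exists (rho / 2 / C2); [rewrite !divr_gt0|rewrite divfK// gt_eqF].
(* The bound 1 on delta yields delta^2 <= delta, so that [t3] may be imposed on delta itself. *)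
have m0 : 0 < Num.min 1 (Num.min t3 t4) by rewrite !lt_min ltr01 t30 t40.
near=> dl.
have d0 : 0 < dl by near: dl; exact: nbhs_right_gt.
have : dl <= Num.min 1 (Num.min t3 t4) by near: dl; exact: nbhs_right_le.
rewrite !le_min => /and3P[d1 d3 d4].
have a0 := alpha0 _ d0.
have a2 : alpha dl <= t2.
  by near: dl; apply: (cvgr_le _ ca).
have q1 : dl ^+ 2 / alpha dl <= t1.
  by near: dl; apply: (cvgr_le _ cq).
have [Hx Jx] := hx _ d0.
have dsq : dl ^+ 2 <= t3 by rewrite expr2; nra.
have ezd1 : e_ dl zdag ^+ 2 <= dl ^+ 2 * C1 ^+ 2.
  rewrite -exprMn lerXn2r ?nnegrE ?e_ge0// ?mulr_ge0 ?(ltW d0) ?(ltW C1_gt0)//.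
  by have := pert _ _ d0 hzd; rewrite ezd subr0 => /(le_trans (ler_norm _)).
have Nx : N (x dl) <= N zdag + eta.
  have h : alpha dl * N (x dl) <= alpha dl * N zdag + dl ^+ 2 * C1 ^+ 2.
    by have := sqr_ge0 (e_ dl (x dl)); lra.
  rewrite -(ler_pM2l a0); apply: le_trans h _; rewrite mulrDr lerD2l.
  move: q1; rewrite ler_pdivrMr// => q1.
  have := sqr_ge0 C1; move: (C1 ^+ 2) ht1 => c ht1 c0; nra.
have ex2 : e_ dl (x dl) ^+ 2 <= (rho / 2) ^+ 2.
  have := mulr_ge0 (ltW a0) (N_ge0 (x dl)).
  have : alpha dl * N zdag <= (rho / 2) ^+ 2 / 2.
    by apply: le_trans ht2; have := N_ge0 zdag; nra.
  have : dl ^+ 2 * C1 ^+ 2 <= (rho / 2) ^+ 2 / 2.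
    by apply: le_trans ht3; rewrite ler_wpM2r// sqr_ge0.
  lra.
have ex : e_ dl (x dl) <= rho / 2.
  by move: ex2; rewrite ler_pXn2r// nnegrE ?e_ge0// divr_ge0// ltW.
apply: near_min => //.
have := pert _ _ d0 Hx; rewrite ler_norml => /andP[h1 _].
have : dl * (C * Num.sqrt (N (x dl)) + 1) <= rho / 2.
  apply: le_trans ht4; apply: ler_pM; [exact: ltW| |by []|].
    by rewrite addr_ge0// mulr_ge0// sqrtr_ge0.
  by rewrite lerD2r ler_wpM2l//; exact: ler_wsqrtr.
lra.
Unshelve. all: by end_near. Qed.

End AbstractTikhonov.

(** * Residuals of the identification problem and solvability by the exact coefficients *)

Section CahnHilliardOperator.
Variables (R : realType) (d : nat) (gamma : R).
Local Notation mu := (torus_measure R d).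
Local Notation wd := (@torus_wd R d).
Local Notation W := (torus_weak_derivation R d).
Local Notation V := ((R -> R^o) * (R -> R^o))%type.
Local Notation L := (('rV[R]_d -> R) -> R).
Implicit Types (u v : 'rV[R]_d -> R) (z : V) (y l : L).

Lemma Hm1_norm_dist l l' : Hm1 l -> Hm1 l' ->
  `|Hm1_norm l - Hm1_norm l'| <= Hm1_norm (fun v => l v - l' v).
Proof.
move=> hl hl'.
have D k k' : Hm1 k -> Hm1 k' -> Hm1_norm k <= Hm1_norm (fun v => k v - k' v) + Hm1_norm k'.
  move=> hk hk'; have hs := Hm1_sub hk hk'.
  have := Hm1_norm_lin_le 1 hs hk'; rewrite normr1 mul1r; apply: le_trans.
  by apply: eq_leW; apply: eq_Hm1_norm => v _; ring.
have h1 := D _ _ hl hl'; have h2 := D _ _ hl' hl.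
have E : Hm1_norm (fun v => l' v - l v) = Hm1_norm (fun v => l v - l' v).
  apply/eqP; rewrite eq_le; apply/andP; split.
    apply: Hm1_norm_le => [v hv|]; last exact/Hm1_norm_ge0/Hm1_sub.
    by rewrite distrC; exact: (Hm1_norm_bound (Hm1_sub hl hl') hv).
  apply: Hm1_norm_le => [v hv|]; last exact/Hm1_norm_ge0/Hm1_sub.
  by rewrite distrC; exact: (Hm1_norm_bound (Hm1_sub hl' hl) hv).
by move: h2; rewrite E ler_norml => h2; apply/andP; split; lra.
Qed.

Definition CHres u y z : R := Hm1_norm (fun v => CHop gamma u z v - y v).

Lemma CHres_Hm1 u y z : state u -> Hm1 y -> isH22 z -> Hm1 (fun v => CHop gamma u z v - y v).
Proof. by move=> su hy hz; apply: Hm1_sub => //; exact: CHop_Hm1. Qed.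

Lemma CHop_sub u z z' v : state u -> isH22 z -> isH22 z' -> Hk 1 v ->
  CHop gamma u (z - z') v = CHop gamma u z v - CHop gamma u z' v.
Proof.
move=> su hz hz' hv; have := CHop_lin gamma (-1) su hz' hz hv.
by rewrite scaleN1r addrC => ->; ring.
Qed.

Lemma CHres_residual u y : state u -> Hm1 y ->
  exists K, residual (@isH22 R) (@H22sq R) (CHres u y) K.
Proof.
move=> su hy; have [K K0 hK] := CHop_bound gamma su; exists K.
have rH z : isH22 z -> Hm1 (fun v => CHop gamma u z v - y v) by exact: CHres_Hm1.
have r0 z : isH22 z -> 0 <= CHres u y z by move=> hz; exact: (Hm1_norm_ge0 (rH _ hz)).
split; [exact: r0|move=> z z' hz hz'|exact: K0|move=> z z' hz hz'].
  apply: Hm1_norm_le => [v hv|]; last by rewrite divr_ge0// addr_ge0// r0.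
  have hs : isH22 (1 *: z + z') by exact: isH22_lin.
  have E : CHop gamma u (2^-1 *: (z + z')) v - y v =
      2^-1 * (CHop gamma u z v - y v) + 2^-1 * (CHop gamma u z' v - y v).
    have h0 : isH22 (0 : V) by exact: (quad0 (@isH22_lin R) hz).
    have e1 := CHop_lin gamma 1 su hz hz' hv.
    have e2 := CHop_lin gamma 2^-1 su hs h0 hv.
    have e3 := CHop_sub su hz hz hv; rewrite subrr subrr in e3.
    rewrite e1 e3 scale1r addr0 in e2.
    by rewrite e2; field.
  rewrite E; apply: le_trans (ler_normD _ _) _; rewrite !normrM.
  have b1 := Hm1_norm_bound (rH _ hz) hv; have b2 := Hm1_norm_bound (rH _ hz') hv.
  rewrite (ger0_norm (_ : 0 <= 2^-1)) ?invr_ge0//.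
  rewrite -/(CHres u y z) in b1; rewrite -/(CHres u y z') in b2.
  by move: b1 b2; rewrite !mulrDl; lra.
apply: le_trans (Hm1_norm_dist (rH _ hz) (rH _ hz')) _.
have hzz : isH22 (z - z') by exact: (quad_sub (@isH22_lin R)).
apply: le_trans (hK _ hzz); apply: eq_leW; apply: eq_Hm1_norm => v hv.
have ringE (p q r : R) : p - r - (q - r) = p - q by ring.
by rewrite CHop_sub//; exact: ringE.
Qed.

Lemma CHres_eq0 u y z : state u -> Hm1 y -> isH22 z ->
  CHres u y z = 0 <-> eq_Hm1 (CHop gamma u z) y.
Proof.
move=> su hy hz; split => [e0 v hv|h].
  by apply/eqP; rewrite -subr_eq0; apply/eqP; exact: (Hm1_norm0_eq (CHres_Hm1 su hy hz) e0 hv).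
have H0 := Hm1_norm_ge0 (CHres_Hm1 su hy hz).
apply/eqP; rewrite eq_le H0 andbT; apply: Hm1_norm_le => // v hv.
by rewrite h// subrr normr0 mul0r.
Qed.

Lemma CHres_perturb u y : (d <= 3)%N -> state u -> Hm1 y -> exists2 C : R, 0 <= C &
  forall (dl : R) u' y' z, 0 < dl -> state u' -> Hm1 y' -> isH22 z ->
    Hk_norm 3 (fun x => u x - u' x) <= dl -> Hm1_norm (fun v => y v - y' v) <= dl ->
    `|CHres u' y' z - CHres u y z| <= dl * (C * Num.sqrt (H22sq z) + 1).
Proof.
move=> d3 su hy; have [C C0 hC] := CHop_perturb gamma d3 su; exists C => //.
move=> dl u' y' z dl0 su' hy' hz hu hyy.
have s0 : 0 <= Num.sqrt (H22sq z) by exact: sqrtr_ge0.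
rewrite distrC; apply: le_trans (Hm1_norm_dist (CHres_Hm1 su hy hz) (CHres_Hm1 su' hy' hz)) _.
have h1 : Hm1 (fun v => CHop gamma u z v - CHop gamma u' z v).
  by apply: Hm1_sub; exact: CHop_Hm1.
have h2 := Hm1_sub hy hy'.
have := Hm1_norm_lin_le (-1) h2 h1; rewrite normrN1 mul1r => b.
apply: (@le_trans _ _ (Hm1_norm (fun v => y v - y' v) + Hm1_norm (fun v => CHop gamma u z v - CHop gamma u' z v))).
  have ringE (p q p' q' : R) : p - q - (p' - q') = -1 * (q - q') + (p - p') by ring.
  by apply: le_trans b; apply: eq_leW; apply: eq_Hm1_norm => v _; exact: ringE.
rewrite mulrDr mulr1 addrC; apply: lerD => //.
apply: le_trans (hC u' z su' hz) _; rewrite mulrA ler_wpM2r// mulrC.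
by rewrite ler_wpM2r.
Qed.

(** A trigonometric polynomial is itself a classical test function, so the definition of the weak
    derivative applies to it directly. This restricted Green formula is enough, since such functions
    separate L^2. *)
Lemma ipL2_div_grad u q : Hk 2 u -> trig_poly q ->
  div (fun i => pd i u) q = ipL2 mu (laplacian u) q.
Proof.
move=> hu tq; have Tq := torus_test_trig tq; have hq : Hk 1 q by exact: trig_Hk.
have Lq := torus_test_L2 Tq.
have Lu i : pd i u \in Lfun mu 2%:E by exact: pd_L2 hu.
have [_ ->] := integrable_div Lu hq.
have Luu i : pd i (pd i u) \in Lfun mu 2%:E by exact: pd_L2 (pd_Hk i hu).
have ig i : mu.-integrable setT (EFin \o (fun x => pd i (pd i u) x * q x)) by exact: L2_prod.
have [_ I] := Rintegral_seq_sum (enum 'I_d) ig.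
have -> : ipL2 mu (laplacian u) q = \sum_(i < d) ipL2 mu (pd i (pd i u)) q.
  transitivity (\int[mu]_x (\sum_(i <- enum 'I_d) pd i (pd i u) x * q x)).
    by apply: eq_Rintegral => x _; rewrite /laplacian mulr_suml big_enum.
  by apply: eq_trans I _; rewrite big_enum.
rewrite -sumrN; apply: eq_bigr => i _.
have [_ /(_ q Tq) wu] := sobolev_has i (pd_Hk i hu : sobolev mu wd 1 (pd i u)).
have {}wu : ipL2 mu (pd i u) ('D_(delta_mx 0 i) q) = - ipL2 mu (pd i (pd i u)) q := wu.
rewrite -[RHS]opprK -wu; congr (- _); rewrite !(ipL2C mu (pd i u)).
apply: ipL2_ae => //; [exact: pd_L2 hq|exact: torus_test_derive_L2|].
exact: wpartial_torus_test.
Qed.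

Lemma H2_mul (b b' b'' g g' g'' : R -> R) :
  (forall s : R, is_derive s (1 : R) b (b' s)) -> (forall s : R, is_derive s (1 : R) b' (b'' s)) ->
  (forall s : R, is_derive s (1 : R) g (g' s)) -> (forall s : R, is_derive s (1 : R) g' (g'' s)) ->
  continuous b'' -> continuous g'' -> H2 (fun s => b s * g s).
Proof.
move=> db db' dg dg' cb'' cg''.
have D1 (s : R) : is_derive s (1 : R) (fun s => b s * g s) (b' s * g s + b s * g' s).
  have h1 := db s; have h2 := dg s.
  by apply: (is_derive_eq (is_deriveM h1 h2)); rewrite /GRing.scale /=; ring.
have D2 (s : R) : is_derive s (1 : R) (fun s => b' s * g s + b s * g' s)
    (b'' s * g s + 2 * (b' s * g' s) + b s * g'' s).
  have h1 := db s; have h2 := dg s; have h3 := db' s; have h4 := dg' s.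
  apply: (is_derive_eq (is_deriveD (is_deriveM h3 h2) (is_deriveM h1 h4))).
  by rewrite /GRing.scale /=; ring.
have cb := is_derive_continuous db; have cb' := is_derive_continuous db'.
have cg := is_derive_continuous dg; have cg' := is_derive_continuous dg'.
have D3 : continuous (fun s => b'' s * g s + 2 * (b' s * g' s) + b s * g'' s).
  move=> s.
  exact: (cvgD (cvgD (cvgM (cb'' s) (cg s)) (cvgM (cvg_cst (2 : R)) (cvgM (cb' s) (cg' s))))
               (cvgM (cb s) (cg'' s))).
exact: (H2_C2 (Cn2_is_derive D1 D2 D3)).
Qed.

Lemma H2_mul_derive1 (b f : R -> R) : Cn 2 b -> Cn 3 f -> H2 (fun s => b s * derive1 f s).
Proof.
move=> /Cn_derive1[b0 /Cn_derive1[b1 [_ b2]]].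
move=> /Cn_derive1[_ /Cn_derive1[f1 /Cn_derive1[f2 [_ f3]]]].
exact: (H2_mul (derivable_is_derive b0) (derivable_is_derive b1)
  (derivable_is_derive f1) (derivable_is_derive f2) b2 f3).
Qed.

(** The chemical potential [m] is given only through a weak equation. Testing against trigonometric
    polynomials identifies it almost everywhere with an explicit function, which lies in H^1 because
    [u] is in H^3; the two then share their derivatives, and multiplying the gradient by [b(u)]
    produces the two fluxes of the operator. *)
Lemma cahn_hilliard_pair b f u y : (d <= 3)%N -> state u -> condition_B b -> condition_F f ->
  cahn_hilliard_at gamma b f u y ->
  H22 (b, fun s => b s * derive1 f s) /\
  eq_Hm1 (CHop gamma u (b, fun s => b s * derive1 f s)) y.
Proof.
move=> d3 su [cb _] [F [fE cF _ _]] [_ _ [m [hm chm chy]]].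
(* From F of class C^4 one gets f of class C^3, so that f', and with it the product with [b], is of
   class C^2 and belongs to H^2(-1,1). *)
have cf : Cn 3 f by have [_] := Cn_derive1 cF; rewrite -fE.
have hb := H2_C2 cb; have hbf := H2_mul_derive1 cb cf; split; first by split; [exact: hb|exact: hbf].
have [hu3 _] := su; have [pu cu hu] := hu3.
have [f0 cf1] := Cn_derive1 cf; have [f1 cf2] := Cn_derive1 cf1.
have [f2 _] := Cn_derive1 cf2.
have hfu i := has_wpartial_comp i d3 hu3 (derivable_is_derive f0) (derivable_is_derive f1)
  (continuous_derivable f2).
have cfu : continuous (fun x => f (u x)) := continuous_row_comp (continuous_derivable f0) cu.
have Lfu : (fun x => f (u x)) \in Lfun mu 2%:E.
  have [c hc] : exists c : R, forall x, `|f (u x)| <= c.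
    by apply: torus_bounded cfu => i x; rewrite pu.
  exact: (L2_bounded (torus_measure_fin R d) (measurable_continuous_row cfu) hc).
have Hfu : Hk 1 (fun x => f (u x)).
  apply: (has_sobolev W (g := fun i x => derive1 f (u x) * pd i u x)) => // i.
  by split => //; case: (hfu i).
have [Hlap _] := laplacian_Hk hu.
pose w0 x := - gamma * laplacian u x + f (u x).
have Hw0 : Hk 1 w0 by exact: Hk_lin.
have Lm : m \in Lfun mu 2%:E := sobolev_L2 hm.
have Lw0 : w0 \in Lfun mu 2%:E := sobolev_L2 Hw0.
have Llap : laplacian u \in Lfun mu 2%:E := sobolev_L2 Hlap.
have mw0 : \forall x \ae mu, m x = w0 x.
  have Ld : (fun x => -1 * w0 x + m x) \in Lfun mu 2%:E by exact: L2_lin.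
  have : \forall x \ae mu, -1 * w0 x + m x = 0.
    apply: trig_separation => // q tq.
    have Lq := torus_test_L2 (torus_test_trig tq).
    rewrite ipL2_lin//.
    have e1 := chm q (trig_Hk 1 tq).
    have e2 : ipL2 mu w0 q = - gamma * ipL2 mu (laplacian u) q + ipL2 mu (fun x => f (u x)) q.
      exact: ipL2_lin.
    rewrite (ipL2_div_grad (HkW hu) tq) in e1.
    have {}e1 : ipL2 mu m q = - gamma * ipL2 mu (laplacian u) q + ipL2 mu (fun x => f (u x)) q := e1.
    by rewrite e2 e1 mulN1r addNr.
  by apply: filterS => x h; apply/eqP; rewrite -subr_eq0 addrC -mulN1r; apply/eqP.
move=> v hv; rewrite chy//.
have Lbm i : (fun x => b (u x) * pd i m x) \in Lfun mu 2%:E.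
  exact: (state_mul hb su (pd_L2 i hm)).1.
have hz : isH22 ((b, fun s => b s * derive1 f s) : V) by split; [exact: hb|exact: hbf].
have L1 i := (CHop_L2 i su hz).1; have L2' i := (CHop_L2 i su hz).2.
rewrite /CHop /= -(div_lin (- gamma) L1 L2' hv); apply: div_ae => // [i|i].
  exact: L2_lin (L1 i) (L2' i).
rewrite (pd_ae i Lm Lw0 mw0).
have D := pd_lin i (- gamma) Hlap Hfu.
have U : \forall x \ae mu, pd i (fun x => f (u x)) x = derive1 f (u x) * pd i u x.
  exact: (wpartial_unique W (hfu i)).
have ringE (p q r k : R) : - gamma * (p * q) + p * k * r = p * (- gamma * q + k * r) by ring.
apply: filterS2 D U => x Dx Ux; rewrite Ux in Dx.
exact: eq_trans (ringE _ _ _ _) (congr1 (fun t => b (u x) * t) (esym Dx)).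
Qed.

End CahnHilliardOperator.

(** * Well-posedness of the regularized problems and convergence to the minimum-norm solution *)

Theorem mainTheorem8 (R : realType) (d : nat) (hd : (1 <= d <= 3)%N)
  (b f : R -> R) (hb : condition_B b) (hf : condition_F f)
  (gamma : R) (hgamma : 0 < gamma)
  (T : R) (phi : R -> 'rV[R]_d -> R) (dphi : R -> ('rV[R]_d -> R) -> R)
  (hsol : cahn_hilliard_solution gamma b f T phi dphi)
  (t : R) (ht : 0 < t < T)
  (hsolt : cahn_hilliard_at gamma b f (phi t) (dphi t))
  (hphi : H3 (phi t)) (hdphi : Hm1 (dphi t))
  (phid : R -> 'rV[R]_d -> R) (yd : R -> ('rV[R]_d -> R) -> R)
  (hphid : forall delta, 0 < delta -> H3 (phid delta))
  (hyd : forall delta, 0 < delta -> Hm1 (yd delta))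
  (hrange : forall delta, 0 < delta -> forall x, -1 < phid delta x < 1)
  (hphi_phid : forall delta, 0 < delta ->
     Hk_norm 3 (fun x => phi t x - phid delta x) <= delta)
  (hy_yd : forall delta, 0 < delta ->
     Hm1_norm (fun v => dphi t v - yd delta v) <= delta) :
  (* the operators map H^2(-1,1)^2 into H^{-1} *)
  [/\ (forall z, H22 z -> Hm1 (CHop gamma (phi t) z)),
      (forall delta, 0 < delta ->
         forall z, H22 z -> Hm1 (CHop gamma (phid delta) z)),
      (* the minimizer exists and is unique *)
      (forall delta alpha, 0 < delta -> 0 < alpha ->
         let J := tikhonov gamma (phid delta) (yd delta) alpha in
         exists z, is_minimizer J z /\
           forall z', is_minimizer J z' -> eq_H22 z' z) &
      (* the minimum-norm solution exists, is unique and is the limit *)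
      exists zdag : (R -> R) * (R -> R),
      [/\ is_min_norm_solution gamma (phi t) (dphi t) zdag,
          (forall z, is_min_norm_solution gamma (phi t) (dphi t) z ->
             eq_H22 z zdag) &
          forall (alpha : R -> R) (zd : R -> (R -> R) * (R -> R)),
            (forall delta, 0 < delta -> 0 < alpha delta) ->
            alpha delta @[delta --> 0^'+] --> 0 ->
            delta ^+ 2 / alpha delta @[delta --> 0^'+] --> 0 ->
            (forall delta, 0 < delta ->
               is_minimizer
                 (tikhonov gamma (phid delta) (yd delta) (alpha delta))
                 (zd delta)) ->
            H22_norm (zd delta - zdag) @[delta --> 0^'+] --> 0]].
Proof.
have d3 : (d <= 3)%N by case/andP: hd.
set u := phi t; set y := dphi t.
have sd dl : 0 < dl -> state (phid dl).
  move=> dl0; split; first exact: hphid.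
  by move=> x; have /andP[h1 h2] := hrange _ dl0 x; rewrite !ltW.
have su : state u.
  apply: (state_closure d3 hphi (v := phid)) => dl dl0.
  by split; [exact: hphid|exact: hrange|exact: hphi_phid].
have [K re] := CHres_residual gamma su hdphi.
(* The exact coefficients make the limit equation solvable; the minimum-norm solution itself may be
   a different pair. *)
have [hz0 sol0] := cahn_hilliard_pair d3 su hb hf hsolt.
have Hne : exists z, @isH22 R z by exists (b, fun s => b s * derive1 f s).
have Hne0 : exists z, @isH22 R z /\ CHres gamma u y z = 0.
  by exists (b, fun s => b s * derive1 f s); split; [exact: hz0|exact/CHres_eq0].
have [zdag [hzd ezd [mzd uzd]]] :=
  min_norm_exists (@isH22_lin R) (@H22sq_ge0 R) (@H22sq_NE R) (@H22_complete R) re Hne0.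
have feas z : H22 z -> eq_Hm1 (CHop gamma u z) y -> CHres gamma u y z = 0.
  by move=> hz h; apply/(CHres_eq0 gamma su hdphi hz).
split.
- by move=> z hz; exact: CHop_Hm1.
- by move=> dl dl0 z hz; apply: CHop_Hm1; [exact: sd|exact: hz].
- move=> dl alpha dl0 al0 J.
  have [Kd red] := CHres_residual gamma (sd _ dl0) (hyd _ dl0).
  have [z [hz minz uz]] := tikhonov_minimizer (@isH22_lin R) (@H22sq_ge0 R) (@H22sq_NE R)
    (@H22_complete R) red al0 Hne.
  exists z; split; first by split; [exact: hz|exact: minz].
  move=> z' [hz' mz']; apply: (H22sq0_eq hz' hz); exact: (uz z' hz' mz').
exists zdag; split.
- split; [exact: hzd|exact/(CHres_eq0 gamma su hdphi hzd)|].
  move=> z' hz' hy'; apply: ler_wsqrtr; exact: (mzd z' hz' (feas _ hz' hy')).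
- move=> z [hz ez mz]; apply: (H22sq0_eq hz hzd); apply: (uzd z hz (feas _ hz ez)).
  move=> z'' hz'' ez''.
  have := mz z'' hz'' (proj1 (CHres_eq0 gamma su hdphi hz'') ez'').
  by rewrite ler_sqrt //; exact: H22sq_ge0.
move=> alpha zd alpha0 ca cq hzdl.
(* The constant is fixed by the exact state before delta is chosen, hence uniform along the family
   of data. *)
have [C C0 pert] := CHres_perturb gamma d3 su hdphi.
have H := tikhonov_convergence (@isH22_lin R) (@H22sq_ge0 R) (@H22sq_NE R) (@H22_complete R)
  (e_ := fun dl z => CHres gamma (phid dl) (yd dl) z) (x := zd) re hzd ezd mzd C0 _ _ alpha0 ca cq _.
have {}H eps : 0 < eps -> \forall dl \near 0^'+, H22sq (zd dl - zdag) <= eps.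
  apply: H.
  - move=> dl z dl0 hz.
    exact: (pert dl _ _ z dl0 (sd _ dl0) (hyd _ dl0) hz (hphi_phid _ dl0) (hy_yd _ dl0)).
  - move=> dl z dl0 hz; exact: (Hm1_norm_ge0 (CHres_Hm1 gamma (sd _ dl0) (hyd _ dl0) hz)).
  - by move=> dl dl0; have [h1 h2] := hzdl _ dl0; split; [exact: h1|exact: (h2 _ hzd)].
apply/cvgrPdist_le => eps eps0.
(* The abstract theorem controls the squared norm, so it is used at [eps ^+ 2]. *)
have := H _ (exprn_gt0 2 eps0); apply: filterS => dl h.
rewrite sub0r normrN ger0_norm ?sqrtr_ge0//.
rewrite -(ger0_norm (ltW eps0)) -sqrtr_sqr; exact: ler_wsqrtr.
Qed.
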